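(* Let $\mathcal C$ be a modular semisimple spherical category over an algebraically closed field $\mathbb F$. Then there is a canonical equivalence $$\mathcal Z_1(\mathcal C)\simeq\mathcal C\boxtimes\widetilde{\mathcal C}$$ of braided tensor categories.
   Context: Categories are $\mathbb F$-linear with finite dimensional Hom-spaces, tensor categories are taken strict. Semisimple: finite direct sums, split idempotents, every object a finite direct sum of simple objects ($\mathrm{End}(X)\cong\mathbb F$), simple unit. Spherical: pivotal with left and right traces equal, giving traces $tr_X$. Modular: a semisimple spherical braided category with finitely many isomorphism classes of simple objects $X_i$ such that the matrix $S(X_i,X_j)=tr_{X_iX_j}(c(X_j,X_i)\circ c(X_i,X_j))$ is invertible. $\widetilde{\mathcal C}$ is the braided tensor category which coincides with $\mathcal C$ as a tensor category but has the braiding $\tilde c(X,Y)=c(Y,X)^{-1}$. $\mathcal C\boxtimes\widetilde{\mathcal C}$ is the completion under finite direct sums of the category with objects $X\boxtimes Y$ ($X\in\mathcal C,Y\in\widetilde{\mathcal C}$) and $\mathrm{Hom}(X\boxtimes Y,Z\boxtimes W)=\mathrm{Hom}_{\mathcal C}(X,Z)\otimes_{\mathbb F}\mathrm{Hom}_{\widetilde{\mathcal C}}(Y,W)$, with componentwise tensor product and braiding. Center: a half braiding for $X$ is a family of isomorphisms $e_X(Y):XY\to YX$ natural in $Y$ with $e_X(YZ)=(\mathrm{id}_Y\otimes e_X(Z))(e_X(Y)\otimes\mathrm{id}_Z)$, $e_X(\mathbf 1)=\mathrm{id}_X$. $\mathcal Z_1(\mathcal C)$ has objects $(X,e_X)$;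 morphisms are $t\in\mathrm{Hom}_{\mathcal C}(X,Y)$ with $(\mathrm{id}_Z\otimes t)e_X(Z)=e_Y(Z)(t\otimes\mathrm{id}_Z)$ for all $Z$; $(X,e_X)\otimes(Y,e_Y)=(XY,e_{XY})$, $e_{XY}(Z)=(e_X(Z)\otimes\mathrm{id}_Y)(\mathrm{id}_X\otimes e_Y(Z))$; braiding $c((X,e_X),(Y,e_Y))=e_X(Y)$. *)

(* Defs.v *)
From HB Require Import structures.
From mathcomp Require Import all_boot all_order all_algebra.
From mathcomp Require Import boolp.

Set Implicit Arguments.
Unset Strict Implicit.
Unset Printing Implicit Defensive.

Import GRing.Theory.
Local Open Scope ring_scope.

Section FiniteProduct.
Variables (F : fieldType) (I : finType) (V : I -> vectType F).

Definition dprodv := {dffun forall i, V i}.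
HB.instance Definition _ := Choice.copy dprodv {dffun forall i, V i}.

Definition dprodv_of (f : forall i, V i) : dprodv := finfun f.

Lemma dprodv_ofE f i : dprodv_of f i = f i.
Proof. by rewrite /dprodv_of ffunE. Qed.

Lemma dprodvP (f g : dprodv) : (forall i, f i = g i) <-> f = g.
Proof. by split=> [H|->//]; apply/ffunP. Qed.

Let zero : dprodv := dprodv_of (fun _ => 0).
Let opp (f : dprodv) := dprodv_of (fun i => - f i).
Let add (f g : dprodv) := dprodv_of (fun i => f i + g i).
Let scale (a : F) (f : dprodv) := dprodv_of (fun i => a *: f i).

Fact dprodv_addA : associative add.
Proof. by move=> f g h; apply/dprodvP=> i; rewrite !dprodv_ofE addrA. Qed.
Fact dprodv_addC : commutative add.
Proof. by move=> f g; apply/dprodvP=> i; rewrite !dprodv_ofE addrC. Qed.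
Fact dprodv_add0 : left_id zero add.
Proof. by move=> f; apply/dprodvP=> i; rewrite !dprodv_ofE add0r. Qed.
Fact dprodv_addN : left_inverse zero opp add.
Proof. by move=> f; apply/dprodvP=> i; rewrite !dprodv_ofE addNr. Qed.
HB.instance Definition _ :=
  GRing.isZmodule.Build dprodv dprodv_addA dprodv_addC dprodv_add0 dprodv_addN.

Fact dprodv_scaleA a b f : scale a (scale b f) = scale (a * b) f.
Proof. by apply/dprodvP=> i; rewrite !dprodv_ofE scalerA. Qed.
Fact dprodv_scale1 : left_id 1 scale.
Proof. by move=> f; apply/dprodvP=> i; rewrite !dprodv_ofE scale1r. Qed.
Fact dprodv_scaleDr : right_distributive scale +%R.
Proof. by move=> a f g; apply/dprodvP=> i; rewrite !dprodv_ofE scalerDr. Qed.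
Fact dprodv_scaleDl f : {morph scale^~ f : a b / a + b}.
Proof. by move=> a b; apply/dprodvP=> i; rewrite !dprodv_ofE scalerDl. Qed.
HB.instance Definition _ := GRing.Zmodule_isLmodule.Build F dprodv
  dprodv_scaleA dprodv_scale1 dprodv_scaleDr dprodv_scaleDl.

Lemma dprodvD (f g : dprodv) i : (f + g) i = f i + g i.
Proof. exact: dprodv_ofE. Qed.
Lemma dprodvZ a (f : dprodv) i : (a *: f) i = a *: f i.
Proof. exact: dprodv_ofE. Qed.
Lemma dprodv0 i : (0 : dprodv) i = 0.
Proof. exact: dprodv_ofE. Qed.

Let ix := {i : I & 'I_(\dim {:V i})}.
Let val_ix (f : dprodv) (t : ix) : F :=
  coord (vbasis {:V (tag t)}) (tagged t) (f (tag t)).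

Fact dprodv_vect_iso : Vector.axiom #|{: ix}| dprodv.
Proof.
exists (fun f => \row_k val_ix f (enum_val k)).
  by move=> a f g; apply/rowP=> k; rewrite !mxE /val_ix dprodvD dprodvZ linearP.
exists (fun r : 'rV_(#|{: ix}|) => dprodv_of (fun i => \sum_(j < \dim {:V i})
    r 0 (enum_rank (Tagged (fun i => 'I_(\dim {:V i})) j : ix)) *: (vbasis {:V i})`_j)).
  move=> f; apply/dprodvP=> i; rewrite dprodv_ofE [RHS](coord_vbasis (memvf _)).
  by apply: eq_bigr => j _; rewrite mxE enum_rankK.
move=> r; apply/rowP=> k; rewrite mxE -[in RHS](enum_valK k) /val_ix.
case: (enum_val k) => i j /=; rewrite dprodv_ofE.
by rewrite coord_sum_free // (basis_free (vbasisP _)).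
Qed.
HB.instance Definition _ := Lmodule_hasFinDim.Build F dprodv dprodv_vect_iso.

End FiniteProduct.

Section Tensor.
Variable F : fieldType.

(* V tensor W, through coordinates in the bases vbasis of V and W. *)
Definition tprod (V W : vectType F) : vectType F :=
  'M[F]_(\dim {:V}, \dim {:W}).

Definition pten (V W : vectType F) (v : V) (w : W) : tprod V W :=
  \matrix_(i, j) (coord (vbasis {:V}) i v * coord (vbasis {:W}) j w).

Definition bilinear_map (V W U : vectType F) (B : V -> W -> U) :=
  (forall w, linear (B^~ w)) /\ (forall v, linear (B v)).

(* The linear map on V tensor W induced by the bilinear map B. *)
Definition tlift (V W U : vectType F) (B : V -> W -> U) (t : tprod V W) : U :=
  \sum_i \sum_j t i j *: B (vbasis {:V})`_i (vbasis {:W})`_j.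

Lemma tlift_linear (V W U : vectType F) (B : V -> W -> U) : linear (tlift B).
Proof.
move=> a s t; rewrite /tlift scaler_sumr -big_split; apply: eq_bigr => i _ /=.
rewrite scaler_sumr -big_split; apply: eq_bigr => j _ /=.
by rewrite !mxE scalerDl scalerA.
Qed.

Lemma tlift_pten (V W U : vectType F) (B : V -> W -> U) v w :
  bilinear_map B -> tlift B (pten v w) = B v w.
Proof.
move=> [Bl Br].
pose Lr v0 : {linear W -> U} :=
  HB.pack (B v0) (GRing.isLinear.Build _ _ _ _ _ (Br v0)).
pose Ll w0 : {linear V -> U} :=
  HB.pack (B^~ w0) (GRing.isLinear.Build _ _ _ _ _ (Bl w0)).
transitivity (\sum_i coord (vbasis {:V}) i v *: B (vbasis {:V})`_i w); last first.
  rewrite [in RHS](coord_vbasis (memvf v)).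
  rewrite -[RHS]/(Ll w _) linear_sum; apply: eq_bigr => i _.
  by rewrite linearZ.
apply: eq_bigr => i _; rewrite [in RHS](coord_vbasis (memvf w)).
rewrite -[X in _ = _ *: X]/(Lr _ _) linear_sum scaler_sumr.
by apply: eq_bigr => j _; rewrite linearZ scalerA mxE.
Qed.

Lemma pten_bilinear (V W : vectType F) : bilinear_map (@pten V W).
Proof.
split=> [w|v] a x y; apply/matrixP=> i j; rewrite !mxE linearP /=.
  by rewrite mulrDl mulrA.
by rewrite mulrDr mulrCA.
Qed.

Lemma tprod_ind (V W : vectType F) (P : tprod V W -> Prop) :
  (forall v w, P (pten v w)) -> (forall s t, P s -> P t -> P (s + t)) ->
  forall t, P t.
Proof.
move=> Pp PD t; have P0 : P 0.
  have -> : 0 = pten 0 0 :> tprod V W.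
    by apply/matrixP=> i j; rewrite !mxE linear0 mul0r.
  exact: Pp.
rewrite (matrix_sum_delta t); apply: (big_ind P) => // i _.
apply: (big_ind P) => // j _.
have -> : t i j *: delta_mx i j =
    pten (t i j *: (vbasis {:V})`_i) (vbasis {:W})`_j :> tprod V W.
  apply/matrixP=> k l; rewrite !mxE linearZ /=.
  rewrite !coord_free ?(basis_free (vbasisP _)) // -mulrA -natrM mulnb.
  by rewrite -!val_eqE /= ![val k == _]eq_sym ![val l == _]eq_sym.
exact: Pp.
Qed.

End Tensor.

Section Solutions.
Variables (F : fieldType) (V : vectType F).

Definition submod_prop (P : V -> Prop) :=
  P 0 /\ forall (a : F) u v, P u -> P v -> P (a *: u + v).

Lemma ex_vspace (P : V -> Prop) :
  submod_prop P -> exists U : {vspace V}, forall v, v \in U <-> P v.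
Proof.
move=> [P0 PL].
pose Q d := `[< exists U : {vspace V}, (forall v, v \in U -> P v) /\ \dim U = d >].
have Q0 : exists d, Q d.
  exists 0%N; apply/asboolP; exists 0%VS; rewrite dimv0; split=> // v.
  by rewrite memv0 => /eqP ->.
have Qb d : Q d -> (d <= \dim {:V})%N.
  by move=> /asboolP [U [_ <-]]; exact/dimvS/subvf.
case: (ex_maxnP Q0 Qb) => d /asboolP [U [UP dU]] dmax.
exists U => v; split=> [|Pv]; first exact: UP.
have QU : Q (\dim (<[v]> + U)%VS).
  apply/asboolP; exists (<[v]> + U)%VS; split=> // w.
  by case/memv_addP=> _ /vlineP [a ->] [u uU ->]; apply: PL => //; exact: UP.
have /eqP e : (U == <[v]> + U)%VS.
  by rewrite eqEdim addvSr dU dmax.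
by rewrite e; apply: subvP (addvSl _ _) _ (memv_line v).
Qed.

Definition solsp (P : V -> Prop) (h : submod_prop P) : {vspace V} :=
  sval (cid (ex_vspace h)).

Lemma solspP (P : V -> Prop) (h : submod_prop P) v : v \in solsp h <-> P v.
Proof. exact: (svalP (cid (ex_vspace h))). Qed.

End Solutions.

Lemma lin0 (F : fieldType) (V W : vectType F) (f : V -> W) : linear f -> f 0 = 0.
Proof. by move=> /(_ (-1) 0 0); rewrite scaler0 addr0 scaleN1r addNr. Qed.

Local Obligation Tactic := idtac.

(* Hom-spaces are vectType, i.e., finite dimensional. *)
Record lcat (F : fieldType) := LCat {
  ob :> Type;
  hom : ob -> ob -> vectType F;
  idm : forall X, hom X X;
  hcomp : forall X Y Z, hom Y Z -> hom X Y -> hom X Z;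
  compA : forall W X Y Z (h : hom Y Z) (g : hom X Y) (f : hom W X),
    hcomp h (hcomp g f) = hcomp (hcomp h g) f;
  comp1m : forall X Y (f : hom X Y), hcomp (idm Y) f = f;
  compm1 : forall X Y (f : hom X Y), hcomp f (idm X) = f;
  comp_linl : forall X Y Z (f : hom X Y), linear (fun g : hom Y Z => hcomp g f);
  comp_linr : forall X Y Z (g : hom Y Z), linear (fun f : hom X Y => hcomp g f)
}.
Arguments idm {F l} X.
Arguments hcomp {F l X Y Z} g f.

Declare Scope cat_scope.
Delimit Scope cat_scope with CAT.
Local Open Scope cat_scope.
Notation "g ∘ f" := (hcomp g f) (at level 45, left associativity) : cat_scope.

Record isom (F : fieldType) (C : lcat F) (X Y : C) := Isom {
  fw : hom X Y;
  bw : hom Y X;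
  fwK : bw ∘ fw = idm X;
  bwK : fw ∘ bw = idm Y
}.

Definition isom_inv (F : fieldType) (C : lcat F) (X Y : C) (i : isom X Y) :
  isom Y X := Isom (bwK i) (fwK i).

Lemma compKl (F : fieldType) (C : lcat F) (X Y Z : C) (i : isom X Y)
    (f g : hom Y Z) : f ∘ fw i = g ∘ fw i -> f = g.
Proof.
by move=> /(congr1 (fun h => h ∘ bw i)); rewrite -!compA bwK !compm1.
Qed.

Lemma compKr (F : fieldType) (C : lcat F) (X Y Z : C) (i : isom X Y)
    (f g : hom Z X) : fw i ∘ f = fw i ∘ g -> f = g.
Proof.
by move=> /(congr1 (fun h => bw i ∘ h)); rewrite !compA fwK !comp1m.
Qed.

Lemma compE (F : fieldType) (C : lcat F) (X Y Z : C) (g : hom Y Z)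
    (f : hom X Y) (h : hom X Z) : g ∘ f = h ->
  forall W (k : hom Z W), k ∘ g ∘ f = k ∘ h.
Proof. by move=> <- W k; rewrite compA. Qed.

Lemma compE3 (F : fieldType) (C : lcat F) (W X Y Z : C) (h : hom Y Z)
    (g : hom X Y) (f : hom W X) (r : hom W Z) : h ∘ g ∘ f = r ->
  forall V (k : hom Z V), k ∘ h ∘ g ∘ f = k ∘ r.
Proof. by move=> <- V k; rewrite !compA. Qed.

Lemma compE5 (F : fieldType) (C : lcat F) (U V W X Y Z : C) (a : hom Y Z)
    (b : hom X Y) (c : hom W X) (d : hom V W) (e : hom U V) (r : hom U Z) :
  a ∘ b ∘ c ∘ d ∘ e = r ->
  forall T (k : hom Z T), k ∘ a ∘ b ∘ c ∘ d ∘ e = k ∘ r.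
Proof. by move=> <- T k; rewrite !compA. Qed.

(* Strictness is the separate predicate strict below: with explicit associators
   and unitors, the center and the product are tensor categories without
   transports along equalities of objects. *)
Record tcat (F : fieldType) := TCat {
  tc_lcat :> lcat F;
  tens : tc_lcat -> tc_lcat -> tc_lcat;
  tunit : tc_lcat;
  tensm : forall X X' Y Y' : tc_lcat,
    hom X X' -> hom Y Y' -> hom (tens X Y) (tens X' Y');
  tens11 : forall X Y : tc_lcat, tensm (idm X) (idm Y) = idm (tens X Y);
  tensM : forall (X X' X'' Y Y' Y'' : tc_lcat) (f' : hom X' X'') (f : hom X X')
      (g' : hom Y' Y'') (g : hom Y Y'),
    tensm (f' ∘ f) (g' ∘ g) = tensm f' g' ∘ tensm f g;
  tens_linl : forall (X X' Y Y' : tc_lcat) (g : hom Y Y'),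
    linear (fun f : hom X X' => tensm f g);
  tens_linr : forall (X X' Y Y' : tc_lcat) (f : hom X X'),
    linear (fun g : hom Y Y' => tensm f g);
  assoc : forall X Y Z, isom (tens (tens X Y) Z) (tens X (tens Y Z));
  lunit : forall X, isom (tens tunit X) X;
  runit : forall X, isom (tens X tunit) X;
  assoc_nat : forall (X X' Y Y' Z Z' : tc_lcat)
      (f : hom X X') (g : hom Y Y') (h : hom Z Z'),
    fw (assoc X' Y' Z') ∘ tensm (tensm f g) h =
    tensm f (tensm g h) ∘ fw (assoc X Y Z);
  lunit_nat : forall (X X' : tc_lcat) (f : hom X X'),
    fw (lunit X') ∘ tensm (idm tunit) f = f ∘ fw (lunit X);
  runit_nat : forall (X X' : tc_lcat) (f : hom X X'),
    fw (runit X') ∘ tensm f (idm tunit) = f ∘ fw (runit X);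
  pentagon : forall W X Y Z,
    fw (assoc W X (tens Y Z)) ∘ fw (assoc (tens W X) Y Z) =
    tensm (idm W) (fw (assoc X Y Z)) ∘ fw (assoc W (tens X Y) Z)
      ∘ tensm (fw (assoc W X Y)) (idm Z);
  triangle : forall X Y,
    tensm (idm X) (fw (lunit Y)) ∘ fw (assoc X tunit Y) =
    tensm (fw (runit X)) (idm Y)
}.
Arguments tens {F t} X Y.
Arguments tunit {F t}.
Arguments tensm {F t X X' Y Y'} f g.

Notation "X • Y" := (tens X Y) (at level 40, left associativity) : cat_scope.
Notation "f ⊗ g" := (tensm f g) (at level 40, left associativity) : cat_scope.
Notation α X Y Z := (fw (assoc X Y Z)).
Notation α' X Y Z := (bw (assoc X Y Z)).
Notation λ X := (fw (lunit X)).
Notation λ' X := (bw (lunit X)).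
Notation ρ X := (fw (runit X)).
Notation ρ' X := (bw (runit X)).

Record bcat (F : fieldType) := BCat {
  bc_tcat :> tcat F;
  braid : forall X Y : bc_tcat, isom (X • Y) (Y • X);
  braid_nat : forall (X X' Y Y' : bc_tcat) (f : hom X X') (g : hom Y Y'),
    fw (braid X' Y') ∘ (f ⊗ g) = (g ⊗ f) ∘ fw (braid X Y);
  braid_hexr : forall X Y Z : bc_tcat,
    fw (braid X (Y • Z)) =
    α' Y Z X ∘ (idm Y ⊗ fw (braid X Z)) ∘ α Y X Z
      ∘ (fw (braid X Y) ⊗ idm Z) ∘ α' X Y Z;
  braid_hexl : forall X Y Z : bc_tcat,
    fw (braid (X • Y) Z) =
    α Z X Y ∘ (fw (braid X Z) ⊗ idm Y) ∘ α' X Z Y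
      ∘ (idm X ⊗ fw (braid Y Z)) ∘ α X Y Z
}.

Section TensorTheory.
Variables (F : fieldType) (C : tcat F).
Implicit Types W X Y Z : C.

Lemma tensMl X X' X'' Y (f' : hom X' X'') (f : hom X X') :
  (f' ⊗ idm Y) ∘ (f ⊗ idm Y) = (f' ∘ f) ⊗ idm Y.
Proof. by rewrite -tensM comp1m. Qed.

Lemma tensMr X Y Y' Y'' (g' : hom Y' Y'') (g : hom Y Y') :
  (idm X ⊗ g') ∘ (idm X ⊗ g) = idm X ⊗ (g' ∘ g).
Proof. by rewrite -tensM comp1m. Qed.

Lemma tens_lr X X' Y Y' (f : hom X X') (g : hom Y Y') :
  (f ⊗ idm Y') ∘ (idm X ⊗ g) = f ⊗ g.
Proof. by rewrite -tensM comp1m compm1. Qed.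

Lemma tens_rl X X' Y Y' (f : hom X X') (g : hom Y Y') :
  (idm X' ⊗ g) ∘ (f ⊗ idm Y) = f ⊗ g.
Proof. by rewrite -tensM comp1m compm1. Qed.

Fact tens_fwK X X' Y Y' (i : isom X X') (j : isom Y Y') :
  (bw i ⊗ bw j) ∘ (fw i ⊗ fw j) = idm (X • Y).
Proof. by rewrite -tensM !fwK tens11. Qed.

Definition tensi X X' Y Y' (i : isom X X') (j : isom Y Y') :
  isom (X • Y) (X' • Y') :=
  Isom (tens_fwK i j) (tens_fwK (isom_inv i) (isom_inv j)).

Fact id_fwK X : idm X ∘ idm X = idm X. Proof. exact: comp1m. Qed.
Definition idi X : isom X X := Isom (id_fwK X) (id_fwK X).

Fact comp_fwK X Y Z (j : isom Y Z) (i : isom X Y) :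
  (bw i ∘ bw j) ∘ (fw j ∘ fw i) = idm X.
Proof. by rewrite compA -(compA (bw i)) fwK compm1 fwK. Qed.

Definition compi X Y Z (j : isom Y Z) (i : isom X Y) : isom X Z :=
  Isom (comp_fwK j i) (comp_fwK (isom_inv i) (isom_inv j)).

Lemma assoc_nat' (X X' Y Y' Z Z' : C)
      (f : hom X X') (g : hom Y Y') (h : hom Z Z') :
  α' X' Y' Z' ∘ (f ⊗ (g ⊗ h)) = f ⊗ g ⊗ h ∘ α' X Y Z.
Proof.
apply: (compKl (i := assoc X Y Z)); apply: (compKr (i := assoc X' Y' Z')).
by rewrite -!compA -assoc_nat !compA bwK comp1m -!compA fwK compm1.
Qed.

Lemma unit_tens_inj X Y (f g : hom X Y) : idm tunit ⊗ f = idm tunit ⊗ g -> f = g.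
Proof.
move=> e; apply: (compKl (i := lunit X)).
by rewrite -!lunit_nat e.
Qed.

Lemma tens_unit_inj X Y (f g : hom X Y) : f ⊗ idm tunit = g ⊗ idm tunit -> f = g.
Proof.
move=> e; apply: (compKl (i := runit X)).
by rewrite -!runit_nat e.
Qed.

Lemma lunit_tens X Y : λ (X • Y) ∘ α tunit X Y = λ X ⊗ idm Y.
Proof.
apply: unit_tens_inj.
apply: (compKl (i := compi (assoc tunit (tunit • X) Y)
                           (tensi (assoc tunit tunit X) (idi Y)))).
rewrite /= -tensMr !compA.
rewrite -(compA (idm tunit ⊗ λ (X • Y))) -(compA (idm tunit ⊗ λ (X • Y))).
rewrite -pentagon compA triangle.
have -> : ρ tunit ⊗ idm (X • Y) = ρ tunit ⊗ (idm X ⊗ idm Y) :> hom _ _.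
  by rewrite tens11.
by rewrite -assoc_nat -assoc_nat -triangle -tensMl compA.
Qed.

Lemma runit_tens X Y : (idm X ⊗ ρ Y) ∘ α X Y tunit = ρ (X • Y).
Proof.
apply: tens_unit_inj; apply: (compKr (i := assoc X Y tunit)).
rewrite -tensMl -triangle compA assoc_nat -triangle -tensMr.
rewrite -(tens11 X Y) [RHS]compA assoc_nat -[RHS]compA pentagon.
by rewrite !compA.
Qed.

Lemma lrunit : λ tunit = ρ (tunit : C).
Proof.
apply: tens_unit_inj; rewrite -triangle -lunit_tens; congr (_ ∘ _).
by apply: (compKr (i := lunit tunit)); rewrite lunit_nat.
Qed.

Lemma triangle' X Y : α X tunit Y ∘ (ρ' X ⊗ idm Y) = idm X ⊗ λ' Y.
Proof.
apply: (compKr (i := tensi (idi X) (lunit Y))) => /=.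
by rewrite compA triangle tensMl tensMr !bwK !tens11.
Qed.

Lemma lunit_tens' X Y : (λ X ⊗ idm Y) ∘ α' tunit X Y = λ (X • Y).
Proof. by rewrite -lunit_tens -compA bwK compm1. Qed.

Lemma runit_tens' X Y : α' X Y tunit ∘ (idm X ⊗ ρ' Y) = ρ' (X • Y).
Proof.
apply: (compKr (i := runit (X • Y))); rewrite bwK -runit_tens.
by rewrite compA -(compA _ _ (α' _ _ _)) bwK compm1 tensMr bwK tens11.
Qed.

Lemma pent2 X Y Z W :
  (idm X ⊗ α' Y Z W) ∘ α X Y (Z • W) =
  α X (Y • Z) W ∘ (α X Y Z ⊗ idm W) ∘ α' (X • Y) Z W.
Proof.
apply: (compKl (i := assoc (X • Y) Z W)); rewrite -compA pentagon.
by rewrite !compA tensMr fwK tens11 comp1m -[RHS]compA fwK compm1.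
Qed.

Lemma pent3 X Z Y W :
  (idm X ⊗ α Z Y W) ∘ α X (Z • Y) W =
  α X Z (Y • W) ∘ α (X • Z) Y W ∘ (α' X Z Y ⊗ idm W).
Proof.
by rewrite pentagon -compA tensMl bwK tens11 compm1.
Qed.

Lemma pent4 X Z Y W :
  α' X Z (Y • W) ∘ (idm X ⊗ α Z Y W) ∘ α X (Z • Y) W =
  α (X • Z) Y W ∘ (α' X Z Y ⊗ idm W).
Proof. by rewrite -compA pent3 !compA fwK comp1m. Qed.

Lemma pent6 W X Y Z :
  (idm W ⊗ α' X Y Z) ∘ α W X (Y • Z) ∘ α (W • X) Y Z =
  α W (X • Y) Z ∘ (α W X Y ⊗ idm Z).
Proof. by rewrite -compA pentagon !compA tensMr fwK tens11 comp1m. Qed.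

Lemma pent7 X Z W Y :
  α (X • Z) W Y ∘ (α' X Z W ⊗ idm Y) ∘ α' X (Z • W) Y =
  α' X Z (W • Y) ∘ (idm X ⊗ α Z W Y).
Proof. by rewrite -pent4 -[LHS]compA bwK compm1. Qed.

End TensorTheory.

Section Center.
Variables (F : fieldType) (C : tcat F).
Implicit Types W X Y Z : C.

(* For strict C the associators and unitors in hb_hex and hb_unit are
   identities: e(YZ) = (id_Y ⊗ e(Z)) (e(Y) ⊗ id_Z) and e(1) = id. *)
Record half_braiding (X : C) := HalfBraiding {
  hb : forall Y, isom (X • Y) (Y • X);
  hb_nat : forall Y Y' (f : hom Y Y'),
    fw (hb Y') ∘ (idm X ⊗ f) = (f ⊗ idm X) ∘ fw (hb Y);
  hb_hex : forall Y Z,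
    fw (hb (Y • Z)) =
    α' Y Z X ∘ (idm Y ⊗ fw (hb Z)) ∘ α Y X Z
      ∘ (fw (hb Y) ⊗ idm Z) ∘ α' X Y Z;
  hb_unit : fw (hb tunit) = λ' X ∘ ρ X
}.

Lemma hb_unit_auto X (e : forall Y, isom (X • Y) (Y • X)) :
  (forall Y Y' (f : hom Y Y'),
    fw (e Y') ∘ (idm X ⊗ f) = (f ⊗ idm X) ∘ fw (e Y)) ->
  (forall Y Z, fw (e (Y • Z)) =
    α' Y Z X ∘ (idm Y ⊗ fw (e Z)) ∘ α Y X Z
      ∘ (fw (e Y) ⊗ idm Z) ∘ α' X Y Z) ->
  fw (e tunit) = λ' X ∘ ρ X.
Proof.
move=> nat hex; apply: (compKr (i := lunit X)); rewrite compA bwK comp1m.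
apply: tens_unit_inj; apply: (compKl (i := isom_inv (assoc X tunit tunit))) => /=.
rewrite -[in RHS]triangle -[RHS]compA bwK compm1 -tensMl.
apply: (compKr (i := e tunit)); rewrite nat hex.
rewrite !compA lunit_tens' lunit_nat -!compA; congr (_ ∘ _).
by rewrite -lunit_tens !compA.
Qed.

Record zob := ZOb { zc : C; zhb : half_braiding zc }.
Definition ze (A : zob) (Y : C) := fw (hb (zhb A) Y).

Definition zmor_prop (A B : zob) (t : hom (zc A) (zc B)) :=
  forall Z, (idm Z ⊗ t) ∘ ze A Z = ze B Z ∘ (t ⊗ idm Z).

Lemma zmor_submod A B : submod_prop (@zmor_prop A B).
Proof.
split=> [Z|a u v hu hv Z].
  have -> : idm Z ⊗ (0 : hom (zc A) (zc B)) = 0.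
    exact: lin0 (@tens_linr _ _ _ _ _ _ (idm Z)).
  have -> : (0 : hom (zc A) (zc B)) ⊗ idm Z = 0.
    exact: lin0 (@tens_linl _ _ _ _ _ _ (idm Z)).
  rewrite (lin0 (@comp_linl _ _ _ _ _ (ze A Z))).
  by rewrite (lin0 (@comp_linr _ _ _ _ _ (ze B Z))).
rewrite (@tens_linr _ _ _ _ _ _ (idm Z)) (@tens_linl _ _ _ _ _ _ (idm Z)).
rewrite (@comp_linl _ _ _ _ _ (ze A Z)) (@comp_linr _ _ _ _ _ (ze B Z)).
by rewrite hu hv.
Qed.

(* The subspace of hom (zc A) (zc B) cut out by zmor_prop, so that the
   Hom-spaces of the center are again of type vectType. *)
Definition zhom (A B : zob) : vectType F := subvs_of (solsp (zmor_submod A B)).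

Definition zval A B (t : zhom A B) : hom (zc A) (zc B) := vsval t.

Definition zmk A B (t : hom (zc A) (zc B)) (p : zmor_prop t) : zhom A B :=
  Subvs ((solspP (zmor_submod A B) t).2 p).

Lemma zvalP A B (t : zhom A B) : zmor_prop (zval t).
Proof. exact: (solspP (zmor_submod A B) _).1 (subvsP t). Qed.

Lemma zval_inj A B : injective (@zval A B).
Proof. exact: subvs_inj. Qed.

Lemma zval_lin A B : linear (@zval A B).
Proof. by []. Qed.

Lemma zid_prop A : zmor_prop (idm (zc A)).
Proof. by move=> Z; rewrite !tens11 comp1m compm1. Qed.

Lemma zcomp_prop A B D (g : zhom B D) (f : zhom A B) :
  zmor_prop (zval g ∘ zval f).
Proof.
move=> Z; rewrite -tensMr -tensMl -compA zvalP compA zvalP.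
by rewrite compA.
Qed.

Definition zid A : zhom A A := zmk (@zid_prop A).
Definition zcomp A B D (g : zhom B D) (f : zhom A B) : zhom A D :=
  zmk (zcomp_prop g f).

Program Definition Zlcat : lcat F := {|
  ob := zob; hom := zhom; idm := zid; hcomp := zcomp |}.
Next Obligation. by move=> *; apply: zval_inj; apply: compA. Qed.
Next Obligation. by move=> *; apply: zval_inj; apply: comp1m. Qed.
Next Obligation. by move=> *; apply: zval_inj; apply: compm1. Qed.
Next Obligation.
by move=> A B D f a g h; apply: zval_inj; apply: (comp_linl (zval f)).
Qed.
Next Obligation.
by move=> A B D f a g h; apply: zval_inj; apply: (comp_linr (zval f)).
Qed.

Lemma zinv_prop A B (i : isom (zc A) (zc B)) :
  zmor_prop (A := A) (B := B) (fw i) -> zmor_prop (A := B) (B := A) (bw i).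
Proof.
move=> p Z; apply: (compKl (i := tensi i (idi Z))).
apply: (compKr (i := tensi (idi Z) i)) => /=.
rewrite -!compA tensMl fwK tens11 compm1 compA -/(ze _ _) tensMr bwK tens11 comp1m.
by rewrite p.
Qed.

Definition zisom A B (i : isom (zc A) (zc B))
    (p : zmor_prop (A := A) (B := B) (fw i)) : isom (A : Zlcat) B :=
  Isom (C := Zlcat) (X := A) (Y := B) (fw := zmk p) (bw := zmk (zinv_prop p))
   (zval_inj (fwK i : zval (zcomp (zmk (zinv_prop p)) (zmk p)) = zval (zid A)))
   (zval_inj (bwK i : zval (zcomp (zmk p) (zmk (zinv_prop p))) = zval (zid B))).

Program Definition zunit_hb : half_braiding tunit := {|
  hb := fun Y => compi (isom_inv (runit Y)) (lunit Y) |}.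
Next Obligation.
move=> Y Y' f /=; rewrite -compA lunit_nat !compA; congr (_ ∘ _).
apply: (compKl (i := runit Y)); apply: (compKr (i := runit Y')).
by rewrite -!compA fwK compm1 !compA bwK comp1m runit_nat.
Qed.
Next Obligation.
move=> Y Z /=; rewrite -tensMl -tensMr.
rewrite -(compA _ _ (α Y tunit Z)).
rewrite !compA runit_tens' -!compA lunit_tens'; congr (_ ∘ _).
by rewrite (compA (α _ _ _)) triangle' compA tensMr bwK tens11 comp1m.
Qed.
Next Obligation. by rewrite /= {1}lrunit fwK -lrunit fwK. Qed.

Section ZTens.
Variables A B : zob.
Local Notation X := (zc A).
Local Notation Y := (zc B).

(* e_XY(Z) = (e_X(Z) ⊗ id_Y) (id_X ⊗ e_Y(Z)) up to associators. *)
Definition ztens_iso (Z : C) : isom (X • Y • Z) (Z • (X • Y)) :=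
  compi (assoc Z X Y)
  (compi (tensi (hb (zhb A) Z) (idi Y))
  (compi (isom_inv (assoc X Z Y))
  (compi (tensi (idi X) (hb (zhb B) Z)) (assoc X Y Z)))).

Lemma ztens_isoE Z : fw (ztens_iso Z) =
  α Z X Y ∘ (ze A Z ⊗ idm Y) ∘ α' X Z Y ∘ (idm X ⊗ ze B Z) ∘ α X Y Z.
Proof. by rewrite /= !compA. Qed.

Lemma ztens_nat Z Z' (f : hom Z Z') :
  fw (ztens_iso Z') ∘ (idm (X • Y) ⊗ f) = (f ⊗ idm (X • Y)) ∘ fw (ztens_iso Z).
Proof.
rewrite !ztens_isoE -!(tens11 X Y).
rewrite (compE (assoc_nat _ _ _)) compA.
rewrite (compE (tensMr _ _ _)) hb_nat -tensMr compA.
rewrite (compE (assoc_nat' _ _ _)) compA.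
rewrite (compE (tensMl _ _ _)) hb_nat -tensMl compA.
by rewrite assoc_nat !compA.
Qed.

Let H1 Z W :
  α (X • Z) W Y ∘ (α' X Z W ⊗ idm Y) ∘ α' X (Z • W) Y
    ∘ (idm X ⊗ ze B (Z • W)) ∘ α X Y (Z • W) =
  (idm (X • Z) ⊗ ze B W) ∘ α (X • Z) Y W ∘ (α' X Z Y ⊗ idm W)
    ∘ ((idm X ⊗ ze B Z) ⊗ idm W) ∘ (α X Y Z ⊗ idm W) ∘ α' (X • Y) Z W.
Proof.
rewrite pent7 {1}/ze hb_hex -!tensMr !compA.
rewrite (compE (tensMr _ (α Z W Y) _)) bwK tens11 compm1.
rewrite assoc_nat' tens11 (compE (pent2 _ _ _ _)) !compA.
rewrite (compE (esym (assoc_nat _ _ _))) !compA.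
by rewrite (compE3 (pent4 _ _ _ _)) !compA.
Qed.

Let H2 Z W :
  α (Z • W) X Y ∘ (ze A (Z • W) ⊗ idm Y) =
  α' Z W (X • Y) ∘ (idm Z ⊗ α W X Y) ∘ (idm Z ⊗ (ze A W ⊗ idm Y))
    ∘ (idm Z ⊗ α' X W Y) ∘ α Z X (W • Y) ∘ (ze A Z ⊗ idm (W • Y))
    ∘ (α (X • Z) W Y ∘ (α' X Z W ⊗ idm Y)).
Proof.
rewrite {1}/ze hb_hex -!tensMl !compA -pent4.
rewrite (compE (assoc_nat _ _ _)) !compA.
rewrite -(tens11 W Y) (compE (esym (assoc_nat (ze A Z) _ _))) !compA.
by rewrite (compE3 (pent6 _ _ _ _)) !compA.
Qed.

Lemma ztens_hex Z W :
  fw (ztens_iso (Z • W)) =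
    α' Z W (X • Y) ∘ (idm Z ⊗ fw (ztens_iso W)) ∘ α Z (X • Y) W
      ∘ (fw (ztens_iso Z) ⊗ idm W) ∘ α' (X • Y) Z W.
Proof.
rewrite !ztens_isoE -!tensMl -!tensMr H2 !compA.
rewrite (compE5 (H1 Z W)) !compA.
rewrite [in RHS](compE3 (esym (pentagon _ _ _ _))) !compA.
rewrite (compE (esym (assoc_nat (idm Z) (idm X) _))) !compA tens11.
rewrite (compE (assoc_nat (ze A Z) (idm Y) (idm W))) !compA tens11.
by rewrite (compE (tens_rl _ _)) (compE (tens_lr _ _)).
Qed.

Program Definition ztens_hb : half_braiding (X • Y) := {| hb := ztens_iso |}.
Next Obligation. exact: ztens_nat. Qed.
Next Obligation. exact: ztens_hex. Qed.
Next Obligation. exact: hb_unit_auto ztens_nat ztens_hex. Qed.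

End ZTens.

Definition ztens (A B : Zlcat) : Zlcat := ZOb (ztens_hb A B).
Definition zunit : Zlcat := ZOb zunit_hb.

Lemma ze_tens A B Z : ze (ztens A B) Z =
  α Z (zc A) (zc B) ∘ (ze A Z ⊗ idm (zc B)) ∘ α' (zc A) Z (zc B)
    ∘ (idm (zc A) ⊗ ze B Z) ∘ α (zc A) (zc B) Z.
Proof. exact: ztens_isoE. Qed.

Lemma ze_unit Z : ze zunit Z = ρ' Z ∘ λ Z.
Proof. by []. Qed.

Lemma ztensm_prop (A A' B B' : Zlcat) (f : hom A A') (g : hom B B') :
  zmor_prop (A := ztens A B) (B := ztens A' B') (zval f ⊗ zval g).
Proof.
move=> Z; rewrite !ze_tens !compA -assoc_nat.
have Hf : (idm Z ⊗ zval f ⊗ zval g) ∘ (ze A Z ⊗ idm (zc B)) =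
    (ze A' Z ⊗ idm (zc B')) ∘ (zval f ⊗ idm Z ⊗ zval g).
  by rewrite -!tensM compm1 comp1m zvalP.
have Hg : (zval f ⊗ (idm Z ⊗ zval g)) ∘ (idm (zc A) ⊗ ze B Z) =
    (idm (zc A') ⊗ ze B' Z) ∘ (zval f ⊗ (zval g ⊗ idm Z)).
  by rewrite -!tensM compm1 comp1m zvalP.
rewrite (compE Hf) !compA (compE (esym (assoc_nat' _ _ _))) !compA.
by rewrite (compE Hg) !compA (compE (esym (assoc_nat _ _ _))) !compA.
Qed.

Lemma zassoc_prop (A B D : Zlcat) :
  zmor_prop (A := ztens (ztens A B) D) (B := ztens A (ztens B D))
    (fw (assoc (zc A) (zc B) (zc D))).
Proof.
move=> W /=; rewrite !ze_tens -!tensMl -!tensMr !compA /=.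
set X := zc A; set Y := zc B; set Z := zc D.
rewrite -pentagon.
rewrite (compE (assoc_nat (ze A W) (idm Y) (idm Z))) !compA tens11.
rewrite (compE (esym (pent4 X W Y Z))) !compA.
rewrite (compE (assoc_nat (idm X) (ze B W) (idm Z))) !compA.
rewrite (compE3 (esym (pent2 X Y W Z))) !compA.
rewrite -(tens11 X Y) (compE (assoc_nat (idm X) (idm Y) (ze D W))) !compA.
by rewrite [in RHS](compE3 (esym (pentagon X Y Z W))) !compA.
Qed.

Lemma zlunit_prop (A : Zlcat) :
  zmor_prop (A := ztens zunit A) (B := A) (fw (lunit (zc A))).
Proof.
move=> W; rewrite ze_tens ze_unit -tensMl !compA triangle tensMl bwK tens11 comp1m.
by rewrite lunit_tens' lunit_nat -compA lunit_tens.
Qed.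

Lemma zrunit_prop (A : Zlcat) :
  zmor_prop (A := ztens A zunit) (B := A) (fw (runit (zc A))).
Proof.
move=> W; rewrite ze_tens ze_unit -tensMr !compA runit_tens runit_nat.
rewrite (compE (runit_tens' _ _)) (compE (bwK _)) compm1.
by rewrite (compE (triangle _ _)).
Qed.

Lemma zbraid_prop (A B : Zlcat) :
  zmor_prop (A := ztens A B) (B := ztens B A) (fw (hb (zhb A) (zc B))).
Proof.
move=> W; rewrite !ze_tens !compA.
have hA Y Z : α Y Z (zc A) ∘ ze A (Y • Z) ∘ α (zc A) Y Z =
    (idm Y ⊗ ze A Z) ∘ α Y (zc A) Z ∘ (ze A Y ⊗ idm Z).
  rewrite /ze hb_hex !compA bwK comp1m -[LHS]compA fwK compm1.
  by [].
rewrite -hA -(compA _ (α _ _ _) (α' _ _ _)) bwK compm1.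
rewrite (compE (hb_nat (zhb A) (ze B W))) !compA.
by rewrite (hb_hex (zhb A)) !compA -(compA _ (α' _ _ _)) fwK compm1.
Qed.

Definition ztensm (A A' B B' : Zlcat) (f : hom A A') (g : hom B B') :
  hom (ztens A B) (ztens A' B') := zmk (ztensm_prop f g).

Program Definition Ztcat : tcat F := {|
  tc_lcat := Zlcat; tens := ztens; tunit := zunit; tensm := ztensm;
  assoc := fun A B D => zisom (zassoc_prop A B D);
  lunit := fun A => zisom (zlunit_prop A);
  runit := fun A => zisom (zrunit_prop A) |}.
Next Obligation. by move=> *; apply: zval_inj; apply: tens11. Qed.
Next Obligation. by move=> *; apply: zval_inj; apply: tensM. Qed.
Next Obligation.
by move=> A A' B B' f a g h; apply: zval_inj; apply: (tens_linl (zval f)).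
Qed.
Next Obligation.
by move=> A A' B B' f a g h; apply: zval_inj; apply: (tens_linr (zval f)).
Qed.
Next Obligation. by move=> *; apply: zval_inj; apply: assoc_nat. Qed.
Next Obligation. by move=> *; apply: zval_inj; apply: lunit_nat. Qed.
Next Obligation. by move=> *; apply: zval_inj; apply: runit_nat. Qed.
Next Obligation. by move=> *; apply: zval_inj; apply: pentagon. Qed.
Next Obligation. by move=> *; apply: zval_inj; apply: triangle. Qed.

Program Definition Z1 : bcat F := {|
  bc_tcat := Ztcat; braid := fun A B => zisom (zbraid_prop A B) |}.
Next Obligation.
move=> A A' B B' f g; apply: zval_inj => /=.
rewrite -(tens_rl (zval f)) compA hb_nat -compA -/(ze _ _) -zvalP compA.
by rewrite tens_lr.
Qed.
Next Obligation. by move=> A B D; apply: zval_inj; apply: hb_hex. Qed.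
Next Obligation. by move=> A B D; apply: zval_inj; apply: ze_tens. Qed.
End Center.

Section Tilde.
Variables (F : fieldType) (C : bcat F).

Lemma bw_unique (D : lcat F) (X Y : D) (i j : isom X Y) :
  fw i = fw j -> bw i = bw j.
Proof.
by move=> e; apply: (compKl (i := i)); rewrite fwK e fwK.
Qed.

(* c~(X,Y) = c(Y,X)^-1 *)
Program Definition tilde : bcat F := {|
  bc_tcat := C; braid := fun X Y => isom_inv (braid Y X) |}.
Next Obligation.
move=> X X' Y Y' f g /=.
apply: (compKl (i := braid Y X)); apply: (compKr (i := braid Y' X')).
by rewrite -!compA fwK compm1 !compA bwK comp1m braid_nat.
Qed.
Next Obligation.
move=> X Y Z /=.
pose j := compi (assoc X Y Z) (compi (tensi (braid Y X) (idi Z))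
  (compi (isom_inv (assoc Y X Z)) (compi (tensi (idi Y) (braid Z X))
    (assoc Y Z X)))).
by rewrite (@bw_unique _ _ _ (braid (Y • Z) X) j) // braid_hexl /= !compA.
Qed.
Next Obligation.
move=> X Y Z /=.
pose j := compi (isom_inv (assoc X Y Z)) (compi (tensi (idi X) (braid Z Y))
  (compi (assoc X Z Y) (compi (tensi (braid Z X) (idi Y))
    (isom_inv (assoc Z X Y))))).
by rewrite (@bw_unique _ _ _ (braid Z (X • Y)) j) // braid_hexr /= !compA.
Qed.

(* The object (X, c(X,-)) of the center. *)
Program Definition cen (X : C) : Z1 C :=
  {| zc := X; zhb := {| hb := braid X |} |}.
Next Obligation. by move=> X Y Y' f; rewrite braid_nat. Qed.
Next Obligation. by move=> X Y Z; rewrite braid_hexr. Qed.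
Next Obligation.
move=> X; apply: (hb_unit_auto (e := braid X)) => [Y Y' f|Y Z].
  by rewrite braid_nat.
by rewrite braid_hexr.
Qed.

End Tilde.

Section Bilin.
Variable F : fieldType.

(* b1 tensor b2 on (V1 tensor V2) x (W1 tensor W2). *)
Definition tbi (V1 W1 U1 V2 W2 U2 : vectType F)
  (b1 : V1 -> W1 -> U1) (b2 : V2 -> W2 -> U2)
  (s : tprod V1 V2) (t : tprod W1 W2) : tprod U1 U2 :=
  tlift (fun v1 v2 => tlift (fun w1 w2 => pten (b1 v1 w1) (b2 v2 w2)) t) s.

Lemma tlift_comb (V W U : vectType F) (a : F) (B B' B'' : V -> W -> U) s :
  (forall v w, B v w = a *: B' v w + B'' v w) ->
  tlift B s = a *: tlift B' s + tlift B'' s.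
Proof.
move=> e; rewrite /tlift scaler_sumr -big_split; apply: eq_bigr => i _ /=.
rewrite scaler_sumr -big_split; apply: eq_bigr => j _ /=.
by rewrite e scalerDr !scalerA mulrC.
Qed.

Variables (V1 W1 U1 V2 W2 U2 : vectType F).
Variables (b1 : V1 -> W1 -> U1) (b2 : V2 -> W2 -> U2).
Hypothesis (h1 : bilinear_map b1) (h2 : bilinear_map b2).

Lemma tbi_linl t : linear ((tbi b1 b2)^~ t).
Proof. exact: tlift_linear. Qed.

Lemma tbi_linr s : linear (tbi b1 b2 s).
Proof.
by move=> a t t'; apply: tlift_comb => v w; apply: tlift_linear.
Qed.

Lemma tbiDl s s' t : tbi b1 b2 (s + s') t = tbi b1 b2 s t + tbi b1 b2 s' t.
Proof. by have := tbi_linl t 1 s s'; rewrite !scale1r. Qed.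

Lemma tbiDr s t t' : tbi b1 b2 s (t + t') = tbi b1 b2 s t + tbi b1 b2 s t'.
Proof. by have := tbi_linr s 1 t t'; rewrite !scale1r. Qed.

Lemma tbi_pten v1 v2 w1 w2 :
  tbi b1 b2 (pten v1 v2) (pten w1 w2) = pten (b1 v1 w1) (b2 v2 w2).
Proof.
have [h1l h1r] := h1; have [h2l h2r] := h2.
have [pl pr] := @pten_bilinear F U1 U2.
have inner x1 x2 : bilinear_map (fun w1 w2 => pten (b1 x1 w1) (b2 x2 w2)).
  by split=> [w|w] a u v; rewrite ?h1r ?h2r ?pl ?pr.
rewrite /tbi tlift_pten; first by rewrite tlift_pten.
split=> w a u v; apply: tlift_comb => x y; first by rewrite h1l pl.
by rewrite h2l pr.
Qed.

End Bilin.

Section Pair.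
Variables (F : fieldType) (C D : bcat F).

(* Objects X ⊠ Y and Hom (X ⊠ Y, Z ⊠ W) = Hom (X, Z) tensor Hom (Y, W); the
   finite direct sums are added below by addc. *)
Definition pob := (C * D)%type.
Definition phom (A B : pob) : vectType F :=
  tprod (hom A.1 B.1) (hom A.2 B.2).

Definition pcomp (A B E : pob) : phom B E -> phom A B -> phom A E :=
  tbi (@hcomp _ C A.1 B.1 E.1) (@hcomp _ D A.2 B.2 E.2).

Lemma comp_bil (E : lcat F) (X Y Z : E) : bilinear_map (@hcomp _ E X Y Z).
Proof. by split=> w; [exact: comp_linl|exact: comp_linr]. Qed.

Lemma tens_bil (E : tcat F) (X X' Y Y' : E) : bilinear_map (@tensm _ E X X' Y Y').
Proof. by split=> w; [exact: tens_linl|exact: tens_linr]. Qed.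

Lemma pcompE (A B E : pob) (g1 : hom B.1 E.1) (g2 : hom B.2 E.2)
    (f1 : hom A.1 B.1) (f2 : hom A.2 B.2) :
  pcomp (pten g1 g2) (pten f1 f2) = pten (g1 ∘ f1) (g2 ∘ f2).
Proof. by apply: tbi_pten; apply: comp_bil. Qed.

Lemma pcompDl (A B E : pob) (g g' : phom B E) (f : phom A B) :
  pcomp (g + g') f = pcomp g f + pcomp g' f.
Proof. exact: tbiDl. Qed.
Lemma pcompDr (A B E : pob) (g : phom B E) (f f' : phom A B) :
  pcomp g (f + f') = pcomp g f + pcomp g f'.
Proof. exact: tbiDr. Qed.

Program Definition plcat : lcat F := {|
  ob := pob; hom := phom; idm := fun A => pten (idm A.1) (idm A.2);
  hcomp := pcomp |}.
Next Obligation.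
move=> A B E G h g f.
elim/tprod_ind: h => [h1 h2|s t Hs Ht]; last by rewrite !pcompDl Hs Ht.
elim/tprod_ind: g => [g1 g2|s t Hs Ht];
  last by rewrite pcompDl !pcompDr pcompDl Hs Ht.
elim/tprod_ind: f => [f1 f2|s t Hs Ht]; last by rewrite !pcompDr Hs Ht.
by rewrite !pcompE !compA.
Qed.
Next Obligation.
move=> A B f.
elim/tprod_ind: f => [f1 f2|s t Hs Ht]; last by rewrite !pcompDr Hs Ht.
by rewrite !pcompE !comp1m.
Qed.
Next Obligation.
move=> A B f.
elim/tprod_ind: f => [f1 f2|s t Hs Ht]; last by rewrite !pcompDl Hs Ht.
by rewrite !pcompE !compm1.
Qed.
Next Obligation. by move=> A B E f; apply: tbi_linl. Qed.
Next Obligation. by move=> A B E f; apply: tbi_linr. Qed.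

Definition ptens (A B : plcat) : plcat := (A.1 • B.1, A.2 • B.2).

Definition ptensm (A A' B B' : plcat) :
    hom A A' -> hom B B' -> hom (ptens A B) (ptens A' B') :=
  tbi (@tensm _ C A.1 A'.1 B.1 B'.1) (@tensm _ D A.2 A'.2 B.2 B'.2).

Lemma ptensmE (A A' B B' : plcat) (f1 : hom A.1 A'.1) (f2 : hom A.2 A'.2)
    (g1 : hom B.1 B'.1) (g2 : hom B.2 B'.2) :
  ptensm (pten f1 f2 : hom A A') (pten g1 g2 : hom B B') =
  pten (f1 ⊗ g1) (f2 ⊗ g2).
Proof. by apply: tbi_pten; apply: tens_bil. Qed.

Lemma ptensmDl (A A' B B' : plcat) (f f' : hom A A') (g : hom B B') :
  ptensm (f + f') g = ptensm f g + ptensm f' g.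
Proof. exact: tbiDl. Qed.
Lemma ptensmDr (A A' B B' : plcat) (f : hom A A') (g g' : hom B B') :
  ptensm f (g + g') = ptensm f g + ptensm f g'.
Proof. exact: tbiDr. Qed.

Fact pisom_fwK (A B : plcat) (i : isom A.1 B.1) (j : isom A.2 B.2) :
  (pten (bw i) (bw j) : hom B A) ∘ (pten (fw i) (fw j) : hom A B) = idm A.
Proof. by rewrite /= pcompE !fwK. Qed.

Definition pisom (A B : plcat) (i : isom A.1 B.1) (j : isom A.2 B.2) : isom A B :=
  Isom (pisom_fwK i j) (pisom_fwK (isom_inv i) (isom_inv j)).

Program Definition ptcat : tcat F := {|
  tc_lcat := plcat; tens := ptens; tunit := (tunit, tunit); tensm := ptensm;
  assoc := fun A B E =>
    @pisom (ptens (ptens A B) E) (ptens A (ptens B E))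
      (assoc A.1 B.1 E.1) (assoc A.2 B.2 E.2);
  lunit := fun A => @pisom (ptens (tunit, tunit) A) A (lunit A.1) (lunit A.2);
  runit := fun A => @pisom (ptens A (tunit, tunit)) A (runit A.1) (runit A.2) |}.
Next Obligation. by move=> A B; rewrite ptensmE !tens11. Qed.
Next Obligation.
move=> A A' A'' B B' B'' f' f g' g /=.
elim/tprod_ind: f' => [f1' f2'|s t Hs Ht];
  last by rewrite !(pcompDl, pcompDr, ptensmDl, ptensmDr) Hs Ht.
elim/tprod_ind: f => [f1 f2|s t Hs Ht];
  last by rewrite !(pcompDl, pcompDr, ptensmDl, ptensmDr) Hs Ht.
elim/tprod_ind: g' => [g1' g2'|s t Hs Ht];
  last by rewrite !(pcompDl, pcompDr, ptensmDl, ptensmDr) Hs Ht.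
elim/tprod_ind: g => [g1 g2|s t Hs Ht];
  last by rewrite !(pcompDl, pcompDr, ptensmDl, ptensmDr) Hs Ht.
by rewrite !(pcompE, ptensmE) !tensM.
Qed.
Next Obligation. by move=> A A' B B' g; apply: tbi_linl. Qed.
Next Obligation. by move=> A A' B B' g; apply: tbi_linr. Qed.
Next Obligation.
move=> A A' B B' E E' f g h /=.
elim/tprod_ind: f => [f1 f2|s t Hs Ht];
  last by rewrite !(pcompDl, pcompDr, ptensmDl, ptensmDr) Hs Ht.
elim/tprod_ind: g => [g1 g2|s t Hs Ht];
  last by rewrite !(pcompDl, pcompDr, ptensmDl, ptensmDr) Hs Ht.
elim/tprod_ind: h => [h1 h2|s t Hs Ht];
  last by rewrite !(pcompDl, pcompDr, ptensmDl, ptensmDr) Hs Ht.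
by rewrite !(ptensmE) !pcompE !assoc_nat.
Qed.
Next Obligation.
move=> A A' f /=.
elim/tprod_ind: f => [f1 f2|s t Hs Ht].
  by rewrite ptensmE !pcompE !lunit_nat.
by rewrite !(pcompDl, pcompDr, ptensmDl, ptensmDr) Hs Ht.
Qed.
Next Obligation.
move=> A A' f /=.
elim/tprod_ind: f => [f1 f2|s t Hs Ht].
  by rewrite ptensmE !pcompE !runit_nat.
by rewrite !(pcompDl, pcompDr, ptensmDl, ptensmDr) Hs Ht.
Qed.
Next Obligation. by move=> A B E G /=; rewrite !ptensmE !pcompE !pentagon. Qed.
Next Obligation. by move=> A B /=; rewrite !ptensmE !pcompE !triangle. Qed.

Program Definition pairc : bcat F := {|
  bc_tcat := ptcat;
  braid := fun A B => @pisom (ptens A B) (ptens B A) (braid A.1 B.1) (braid A.2 B.2)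
|}.
Next Obligation.
move=> A A' B B' f g /=.
elim/tprod_ind: f => [f1 f2|s t Hs Ht];
  last by rewrite !(pcompDl, pcompDr, ptensmDl, ptensmDr) Hs Ht.
elim/tprod_ind: g => [g1 g2|s t Hs Ht];
  last by rewrite !(pcompDl, pcompDr, ptensmDl, ptensmDr) Hs Ht.
by rewrite !ptensmE !pcompE !braid_nat.
Qed.
Next Obligation.
by move=> A B E /=; rewrite !ptensmE !pcompE -!braid_hexr.
Qed.
Next Obligation.
by move=> A B E /=; rewrite !ptensmE !pcompE -!braid_hexl.
Qed.

End Pair.

Section DCast.
Variables (F : fieldType) (J : eqType).

(* The Kronecker delta in a dependent family: v if i = j, 0 otherwise. *)
Definition dcast (V : J -> vectType F) (i j : J) (v : V i) : V j :=
  if i =P j is ReflectT e then ecast k (V k) e v else 0.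

Lemma dcast_id (V : J -> vectType F) i (v : V i) : dcast i v = v.
Proof. by rewrite /dcast; case: eqP => // e; rewrite eq_axiomK. Qed.

Lemma dcast_neq (V : J -> vectType F) i j (v : V i) : i != j -> dcast j v = 0.
Proof. by rewrite /dcast; case: eqP. Qed.

Lemma dcast_map (V W : J -> vectType F) (f : forall j, V j -> W j) i j (v : V i) :
  (forall j, f j 0 = 0) -> f j (dcast j v) = dcast j (f i v).
Proof.
move=> f0; case: (eqVneq i j) => [<-|ne]; first by rewrite !dcast_id.
by rewrite !dcast_neq.
Qed.

End DCast.

Section Add.
Variables (F : fieldType) (C : bcat F).
Implicit Types W X Y Z : C.

(* The completion of C under finite direct sums: an object is a finite family,
   indexed by an arbitrary finType, and a morphism is a matrix of morphisms. *)
Record aob := AddOb { aix : finType; acomp : aix -> C }.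

Definition ahom (A B : aob) : vectType F :=
  dprodv (fun p : aix A * aix B => hom (acomp p.1) (acomp p.2)).

Definition ent (A B : aob) (M : ahom A B) (i : aix A) (j : aix B) :
    hom (acomp i) (acomp j) :=
  (M : dprodv _) (i, j).

Definition amx (A B : aob) (f : forall (i : aix A) (j : aix B), hom (acomp i) (acomp j)) :
    ahom A B :=
  dprodv_of (fun p : aix A * aix B => f p.1 p.2).

Lemma entP (A B : aob) (M N : ahom A B) :
  (forall i j, ent M i j = ent N i j) -> M = N.
Proof. by move=> e; apply/dprodvP=> -[i j]; apply: e. Qed.

Lemma ent_amx (A B : aob) f i j : ent (amx f : ahom A B) i j = f i j.
Proof. by rewrite /ent /amx dprodv_ofE. Qed.

Lemma entL (A B : aob) a (M N : ahom A B) i j :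
  ent (a *: M + N) i j = a *: ent M i j + ent N i j.
Proof. by rewrite /ent dprodvD dprodvZ. Qed.

(* The monomial matrix with entries f i at (i, phi i). *)
Definition amono (A B : aob) (phi : aix A -> aix B)
    (f : forall i, hom (acomp i) (acomp (phi i))) : ahom A B :=
  amx (fun i j => dcast (V := fun j => hom (acomp i) (acomp j)) j (f i)).

Definition acmp (A B D : aob) (N : ahom B D) (M : ahom A B) : ahom A D :=
  amx (fun i k => \sum_j (ent N j k ∘ ent M i j)).

Definition aidm (A : aob) : ahom A A := amono (phi := id) (fun i => idm (acomp i)).

Lemma compDl X Y Z (g g' : hom Y Z) (f : hom X Y) :
  (g + g') ∘ f = g ∘ f + g' ∘ f.
Proof. by have := comp_linl f 1 g g'; rewrite !scale1r. Qed.
Lemma compDr X Y Z (g : hom Y Z) (f f' : hom X Y) :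
  g ∘ (f + f') = g ∘ f + g ∘ f'.
Proof. by have := comp_linr g 1 f f'; rewrite !scale1r. Qed.
Lemma comp0m X Y Z (f : hom X Y) : (0 : hom Y Z) ∘ f = 0.
Proof. exact: lin0 (comp_linl f). Qed.
Lemma compm0 X Y Z (g : hom Y Z) : g ∘ (0 : hom X Y) = 0.
Proof. exact: lin0 (comp_linr g). Qed.
Lemma tens0m X X' Y Y' (g : hom Y Y') : (0 : hom X X') ⊗ g = 0.
Proof. exact: lin0 (tens_linl g). Qed.
Lemma tensm0 X X' Y Y' (f : hom X X') : f ⊗ (0 : hom Y Y') = 0.
Proof. exact: lin0 (tens_linr f). Qed.

Lemma comp_suml X Y Z (I : finType) (G : I -> hom Y Z) (f : hom X Y) :
  (\sum_i G i) ∘ f = \sum_i (G i ∘ f).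
Proof. by apply: (big_morph (fun g => g ∘ f)) => [g g'|];
  rewrite ?compDl ?comp0m. Qed.
Lemma comp_sumr X Y Z (I : finType) (g : hom Y Z) (G : I -> hom X Y) :
  g ∘ (\sum_i G i) = \sum_i (g ∘ G i).
Proof. by apply: (big_morph (fun f => g ∘ f)) => [f f'|];
  rewrite ?compDr ?compm0. Qed.
Lemma tensDl X X' Y Y' (f f' : hom X X') (g : hom Y Y') :
  (f + f') ⊗ g = f ⊗ g + f' ⊗ g.
Proof. by have := tens_linl g 1 f f'; rewrite !scale1r. Qed.
Lemma tensDr X X' Y Y' (f : hom X X') (g g' : hom Y Y') :
  f ⊗ (g + g') = f ⊗ g + f ⊗ g'.
Proof. by have := tens_linr f 1 g g'; rewrite !scale1r. Qed.
Lemma tens_suml X X' Y Y' (I : finType) (G : I -> hom X X') (g : hom Y Y') :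
  (\sum_i G i) ⊗ g = \sum_i (G i ⊗ g).
Proof. by apply: (big_morph (fun f => f ⊗ g)) => [f f'|];
  rewrite ?tensDl ?tens0m. Qed.
Lemma tens_sumr X X' Y Y' (I : finType) (f : hom X X') (G : I -> hom Y Y') :
  f ⊗ (\sum_i G i) = \sum_i (f ⊗ G i).
Proof. by apply: (big_morph (fun g => f ⊗ g)) => [g g'|];
  rewrite ?tensDr ?tensm0. Qed.

Lemma ent_comp_mono (A B D : aob) (N : ahom B D) phi (f : forall i, hom _ _) i k :
  ent (acmp N (amono (A := A) (phi := phi) f)) i k = ent N (phi i) k ∘ f i.
Proof.
rewrite ent_amx (bigD1 (phi i)) //= ent_amx dcast_id big1 ?addr0 // => j ne.
by rewrite ent_amx dcast_neq ?compm0 // eq_sym.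
Qed.

Lemma ent_mono_comp (A B D : aob) phi (f : forall i, hom _ _) (M : ahom A B) i j :
  injective phi ->
  ent (acmp (amono (A := B) (B := D) (phi := phi) f) M) i (phi j) =
    f j ∘ ent M i j.
Proof.
move=> inj; rewrite ent_amx (bigD1 j) //= ent_amx dcast_id big1 ?addr0 // => k ne.
by rewrite ent_amx dcast_neq ?comp0m // inj_eq.
Qed.

Lemma mono_mono (A B D : aob) phi psi (f : forall i, hom _ _)
    (g : forall i, hom _ _) :
  acmp (amono (A := B) (B := D) (phi := psi) g) (amono (A := A) (phi := phi) f) =
  amono (phi := fun i => psi (phi i)) (fun i => g (phi i) ∘ f i).
Proof.
apply: entP => i k; rewrite ent_comp_mono !ent_amx.
rewrite (@dcast_map F (aix D) _ (fun j => hom (acomp i) (acomp j))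
  (fun j h => h ∘ f i)) // => j; exact: comp0m.
Qed.

Lemma monoP (A B : aob) phi phi' (f f' : forall i, hom _ _) :
  (forall i j, dcast (V := fun j => hom (acomp i) (acomp j)) j (f i) =
               dcast (V := fun j => hom (acomp i) (acomp j)) j (f' i)) ->
  amono (A := A) (B := B) (phi := phi) f = amono (phi := phi') f'.
Proof. by move=> e; apply: entP => i j; rewrite !ent_amx. Qed.

Program Definition alcat : lcat F := {|
  ob := aob; hom := ahom; idm := aidm; hcomp := acmp |}.
Next Obligation.
move=> A B D E h g f; apply: entP => i k; rewrite !ent_amx.
under eq_bigr => j _ do rewrite ent_amx comp_sumr.
under [in RHS]eq_bigr => j _ do rewrite ent_amx comp_suml.
rewrite exchange_big; apply: eq_bigr => j _; apply: eq_bigr => l _.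
exact: compA.
Qed.
Next Obligation.
move=> A B f; apply: entP => i j.
by rewrite (@ent_mono_comp _ _ _ id) // comp1m.
Qed.
Next Obligation.
by move=> A B f; apply: entP => i j; rewrite (@ent_comp_mono _ _ _ _ id) compm1.
Qed.
Next Obligation.
move=> A B D f a g g'; apply: entP => i j; rewrite entL !ent_amx.
rewrite scaler_sumr -big_split; apply: eq_bigr => k _ /=.
by rewrite entL (comp_linl (ent f i k)).
Qed.
Next Obligation.
move=> A B D f a g g'; apply: entP => i j; rewrite entL !ent_amx.
rewrite scaler_sumr -big_split; apply: eq_bigr => k _ /=.
by rewrite entL (comp_linr (ent f k j)).
Qed.

Definition atens (A B : alcat) : alcat :=
  @AddOb (aix A * aix B)%type (fun p => acomp p.1 • acomp p.2).
Definition aunit : alcat := @AddOb unit (fun _ => tunit).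

Definition atensm (A A' B B' : alcat) (M : hom A A') (N : hom B B') :
    hom (atens A B) (atens A' B') :=
  amx (A := atens A B) (B := atens A' B')
    (fun p q => ent M p.1 q.1 ⊗ ent N p.2 q.2).

Lemma ent_atensm (A A' B B' : alcat) (M : hom A A') (N : hom B B') i j i' j' :
  ent (atensm M N) (i, j) (i', j') = ent M i i' ⊗ ent N j j'.
Proof. exact: ent_amx. Qed.

Lemma tens_mono (A A' B B' : alcat) phi psi (f : forall i, hom _ _)
    (g : forall i, hom _ _) :
  atensm (amono (A := A) (B := A') (phi := phi) f)
         (amono (A := B) (B := B') (phi := psi) g) =
  amono (A := atens A B) (B := atens A' B') (phi := fun p => (phi p.1, psi p.2))
    (fun p => f p.1 ⊗ g p.2).
Proof.
apply: entP => -[i j] [i' j']; rewrite ent_atensm !ent_amx /=.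
case: (eqVneq (phi i) i') => [<-|ne]; last first.
  rewrite dcast_neq // tens0m dcast_neq //.
  by apply: contra ne => /eqP [-> _].
case: (eqVneq (psi j) j') => [<-|ne]; last first.
  rewrite [X in _ ⊗ X]dcast_neq // tensm0 dcast_neq //.
  by apply: contra ne => /eqP [->].
by rewrite !dcast_id.
Qed.

Section MonoIso.
Variables (A B : alcat) (phi : aix A -> aix B) (psi : aix B -> aix A).
Variables (f : forall i, hom (acomp i) (acomp (phi i))).
Variables (g : forall j, hom (acomp j) (acomp (psi j))).
Hypothesis gf : forall i k,
  dcast (V := fun k => hom (acomp i) (acomp k)) k (g (phi i) ∘ f i) =
  dcast (V := fun k => hom (acomp i) (acomp k)) k (idm (acomp i)).
Hypothesis fg : forall i k,
  dcast (V := fun k => hom (acomp i) (acomp k)) k (f (psi i) ∘ g i) =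
  dcast (V := fun k => hom (acomp i) (acomp k)) k (idm (acomp i)).
Fact mono_iso1 : (amono g : hom B A) ∘ (amono f : hom A B) = idm A.
Proof. by rewrite /= mono_mono; apply: monoP. Qed.
Fact mono_iso2 : (amono f : hom A B) ∘ (amono g : hom B A) = idm B.
Proof. by rewrite /= mono_mono; apply: monoP. Qed.
Definition mono_iso : isom A B := Isom mono_iso1 mono_iso2.
End MonoIso.

Program Definition aassoc (A B D : alcat) :
    isom (atens (atens A B) D) (atens A (atens B D)) :=
  @mono_iso (atens (atens A B) D) (atens A (atens B D))
    (fun p => (p.1.1, (p.1.2, p.2))) (fun p => ((p.1, p.2.1), p.2.2))
    (fun p => α (acomp p.1.1) (acomp p.1.2) (acomp p.2))
    (fun p => α' (acomp p.1) (acomp p.2.1) (acomp p.2.2)) _ _.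
Next Obligation. by move=> A B D [[i j] k] l /=; rewrite fwK. Qed.
Next Obligation. by move=> A B D [i [j k]] l /=; rewrite bwK. Qed.

Program Definition alunit (A : alcat) : isom (atens aunit A) A :=
  @mono_iso (atens aunit A) A (fun p => p.2) (fun i => (tt, i))
    (fun p => λ (acomp p.2)) (fun i => λ' (acomp i)) _ _.
Next Obligation. by move=> A [[] i] l /=; rewrite fwK. Qed.
Next Obligation. by move=> A i l /=; rewrite bwK. Qed.

Program Definition arunit (A : alcat) : isom (atens A aunit) A :=
  @mono_iso (atens A aunit) A (fun p => p.1) (fun i => (i, tt))
    (fun p => ρ (acomp p.1)) (fun i => ρ' (acomp i)) _ _.
Next Obligation. by move=> A [i []] l /=; rewrite fwK. Qed.
Next Obligation. by move=> A i l /=; rewrite bwK. Qed.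

Program Definition abraid (A B : alcat) : isom (atens A B) (atens B A) :=
  @mono_iso (atens A B) (atens B A) (fun p => (p.2, p.1)) (fun p => (p.2, p.1))
    (fun p => fw (braid (acomp p.1) (acomp p.2)))
    (fun p => bw (braid (acomp p.2) (acomp p.1))) _ _.
Next Obligation. by move=> A B [i j] l /=; rewrite fwK. Qed.
Next Obligation. by move=> A B [i j] l /=; rewrite bwK. Qed.

Program Definition atcat : tcat F := {|
  tc_lcat := alcat; tens := atens; tunit := aunit; tensm := atensm;
  assoc := aassoc; lunit := alunit; runit := arunit |}.
Next Obligation.
move=> A B; rewrite /= /aidm tens_mono.
apply: (@entP (atens A B) (atens A B)) => -[i j] l.
by rewrite !ent_amx /= tens11.
Qed.
Next Obligation.
move=> A A' A'' B B' B'' f' f g' g; apply: entP => -[i j] [k l].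
rewrite ent_atensm !ent_amx tens_suml.
under eq_bigr => i' _ do rewrite tens_sumr.
by rewrite pair_big; apply: eq_bigr => -[i' j'] _; rewrite !ent_atensm tensM.
Qed.
Next Obligation.
move=> A A' B B' g a f f'; apply: entP => -[i j] [k l].
by rewrite entL !ent_atensm entL (tens_linl (ent g j l)).
Qed.
Next Obligation.
move=> A A' B B' g a f f'; apply: entP => -[i j] [k l].
by rewrite entL !ent_atensm entL (tens_linr (ent g i k)).
Qed.
Next Obligation.
move=> A A' B B' D D' f g h; apply: entP => -[[i j] k] [i' [j' k']].
rewrite /= ent_comp_mono /= !ent_atensm -assoc_nat.
rewrite (@ent_mono_comp _ (atens (atens A' B') D') (atens A' (atens B' D'))
  (fun p => (p.1.1, (p.1.2, p.2))) _ _ _ ((i', j'), k')).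
  by rewrite !ent_atensm.
by case=> [[a b] c] [[a' b'] c'] [-> -> ->].
Qed.
Next Obligation.
move=> A A' f; apply: entP => -[[] i] i'.
rewrite /= ent_comp_mono /= -lunit_nat.
rewrite (@ent_mono_comp _ (atens aunit A') A' (fun p => p.2) _ _ _ (tt, i')).
  by rewrite !ent_atensm ent_amx dcast_id.
by case=> [[] a] [[] a'] /= ->.
Qed.
Next Obligation.
move=> A A' f; apply: entP => -[i []] i'.
rewrite /= ent_comp_mono /= -runit_nat.
rewrite (@ent_mono_comp _ (atens A' aunit) A' (fun p => p.1) _ _ _ (i', tt)).
  by rewrite !ent_atensm ent_amx dcast_id.
by case=> [a []] [a' []] /= ->.
Qed.
Next Obligation.
move=> A B D E; rewrite /= /aidm !tens_mono !mono_mono.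
by apply: (@entP (atens (atens (atens A B) D) E) (atens A (atens B (atens D E))))
  => -[[[i j] k] l] m; rewrite !ent_amx /= pentagon.
Qed.
Next Obligation.
move=> A B; rewrite /= /aidm !tens_mono !mono_mono.
by apply: (@entP (atens (atens A aunit) B) (atens A B))
  => -[[i []] k] m; rewrite !ent_amx /= triangle.
Qed.

Program Definition addc : bcat F := {|
  bc_tcat := atcat; braid := abraid |}.
Next Obligation.
move=> A A' B B' f g; apply: entP => -[i j] [k l].
rewrite /= ent_comp_mono /= !ent_atensm -braid_nat.
rewrite (@ent_mono_comp _ (atens A' B') (atens B' A') (fun p => (p.2, p.1)) _ _ _ (l, k)).
  by rewrite !ent_atensm.
by case=> [a b] [a' b'] [-> ->].
Qed.
Next Obligation.
move=> A B D; rewrite /= /aidm !tens_mono !mono_mono.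
by apply: (@entP (atens A (atens B D)) (atens (atens B D) A))
  => -[i [j k]] l; rewrite !ent_amx /= braid_hexr.
Qed.
Next Obligation.
move=> A B D; rewrite /= /aidm !tens_mono !mono_mono.
by apply: (@entP (atens (atens A B) D) (atens D (atens A B)))
  => -[[i j] k] l; rewrite !ent_amx /= braid_hexl.
Qed.

End Add.

Definition deligne (F : fieldType) (C D : bcat F) : bcat F := addc (pairc C D).

Section Box.
Variables (F : fieldType) (C D : bcat F).

Definition box (X : C) (Y : D) : deligne C D :=
  @AddOb F (pairc C D) unit (fun _ => (X, Y)).

Definition boxm (X X' : C) (Y Y' : D) (f : hom X X') (g : hom Y Y') :
    hom (box X Y) (box X' Y') :=
  amx (A := box X Y) (B := box X' Y') (fun _ _ => pten f g).

(* The canonical identification (X ⊠ Y)(X' ⊠ Y') = XX' ⊠ YY'; the two sides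
   differ only in their one-element index sets. *)
Definition box_tens (X X' : C) (Y Y' : D) :
    hom (box X Y • box X' Y') (box (X • X') (Y • Y')) :=
  amx (A := box X Y • box X' Y') (B := box (X • X') (Y • Y'))
    (fun _ _ => pten (idm (X • X')) (idm (Y • Y'))).

End Box.

Section Functors.
Variable F : fieldType.

Record lfunctor (C D : lcat F) := LFunctor {
  fob :> C -> D;
  fmor : forall X Y, hom X Y -> hom (fob X) (fob Y);
  fmor1 : forall X, fmor (idm X) = idm (fob X);
  fmorM : forall X Y Z (g : hom Y Z) (f : hom X Y),
    fmor (g ∘ f) = fmor g ∘ fmor f;
  fmor_lin : forall X Y, linear (@fmor X Y)
}.

Definition equivalence (C D : lcat F) (K : lfunctor C D) : Prop :=
  exists L : lfunctor D C,
    (exists u : forall X, isom (L (K X)) X, forall X Y (f : hom X Y),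
       fw (u Y) ∘ fmor L (fmor K f) = f ∘ fw (u X)) /\
    (exists v : forall X, isom (K (L X)) X, forall X Y (f : hom X Y),
       fw (v Y) ∘ fmor K (fmor L f) = f ∘ fw (v X)).

Record bfunctor (C D : bcat F) := BFunctor {
  bf_lfunctor :> lfunctor C D;
  fmu : forall X Y, isom (bf_lfunctor X • bf_lfunctor Y) (bf_lfunctor (X • Y));
  feta : isom tunit (bf_lfunctor tunit);
  fmu_nat : forall X X' Y Y' (f : hom X X') (g : hom Y Y'),
    fw (fmu X' Y') ∘ (fmor bf_lfunctor f ⊗ fmor bf_lfunctor g) =
    fmor bf_lfunctor (f ⊗ g) ∘ fw (fmu X Y);
  fmu_assoc : forall X Y Z,
    fmor bf_lfunctor (α X Y Z) ∘ fw (fmu (X • Y) Z)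
      ∘ (fw (fmu X Y) ⊗ idm (bf_lfunctor Z)) =
    fw (fmu X (Y • Z)) ∘ (idm (bf_lfunctor X) ⊗ fw (fmu Y Z))
      ∘ α (bf_lfunctor X) (bf_lfunctor Y) (bf_lfunctor Z);
  fmu_lunit : forall X,
    fmor bf_lfunctor (λ X) ∘ fw (fmu tunit X)
      ∘ (fw feta ⊗ idm (bf_lfunctor X)) = λ (bf_lfunctor X);
  fmu_runit : forall X,
    fmor bf_lfunctor (ρ X) ∘ fw (fmu X tunit)
      ∘ (idm (bf_lfunctor X) ⊗ fw feta) = ρ (bf_lfunctor X);
  fmu_braid : forall X Y,
    fmor bf_lfunctor (fw (braid X Y)) ∘ fw (fmu X Y) =
    fw (fmu Y X) ∘ fw (braid (bf_lfunctor X) (bf_lfunctor Y))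
}.

End Functors.

Section Canonical.
Variables (F : fieldType) (C : bcat F).

(* The object (Y, c~(Y,-)) of the center; tilde C and C have the same
   underlying tensor category, hence the same center. *)
Definition cen_tilde (Y : C) : Z1 C := @cen F (tilde C) Y.

(* XYX'Y' -> XX'YY', given by c~(Y,X'). *)
Definition middle_swap (X Y X' Y' : C) :
    hom (X • Y • (X' • Y')) (X • X' • (Y • Y')) :=
  α' X X' (Y • Y')
    ∘ (idm X ⊗ (α X' Y Y' ∘ (fw (braid (b := tilde C) Y X') ⊗ idm Y')
                 ∘ α' Y X' Y'))
    ∘ α X Y (X' • Y').

(* K is the functor X ⊠ Y |-> (X, c(X,-)) (Y, c~(Y,-)), f ⊠ g |-> f ⊗ g with
   tensor structure middle_swap, up to an isomorphism theta of tensor functors.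
   The equations are those of the underlying morphisms of C. *)
Definition canonical (K : bfunctor (deligne C (tilde C)) (Z1 C)) : Prop :=
  exists theta : forall X Y : C,
      isom (K (box (D := tilde C) X Y)) (cen X • cen_tilde Y),
    [/\ forall (X X' Y Y' : C) (f : hom X X') (g : hom Y Y'),
          zval (fw (theta X' Y')) ∘ zval (fmor K (boxm (D := tilde C) f g)) =
          (f ⊗ g) ∘ zval (fw (theta X Y)),
        forall X X' Y Y' : C,
          zval (fw (theta (X • X') (Y • Y')))
            ∘ zval (fmor K (box_tens (D := tilde C) X X' Y Y'))
            ∘ zval (fw (fmu K (box (D := tilde C) X Y) (box (D := tilde C) X' Y'))) =
          middle_swap X Y X' Y'
            ∘ (zval (fw (theta X Y)) ⊗ zval (fw (theta X' Y')))
      & zval (fw (theta tunit tunit)) ∘ zval (fw (feta K)) = λ' tunit].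

End Canonical.

Section Hypotheses.
Variable F : fieldType.

Definition eqto (C : lcat F) (X Y : C) (e : X = Y) : hom X Y :=
  ecast Z (hom X Z) e (idm X).

Definition strict (C : tcat F) : Prop :=
  [/\ forall X Y Z : C, exists e : X • Y • Z = X • (Y • Z), α X Y Z = eqto e,
      forall X : C, exists e : tunit • X = X, λ X = eqto e
    & forall X : C, exists e : X • tunit = X, ρ X = eqto e].

Definition simple (C : lcat F) (X : C) : Prop :=
  bijective (fun a : F => a *: idm X).

Definition is_dsum (C : lcat F) (n : nat) (Y : 'I_n -> C) (X : C) : Prop :=
  exists (i : forall k, hom (Y k) X) (p : forall k, hom X (Y k)),
    [/\ forall k, p k ∘ i k = idm (Y k),
        forall k l, k != l -> p k ∘ i l = 0
      & \sum_k (i k ∘ p k) = idm X].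

Record semisimple (C : tcat F) : Prop := Semisimple {
  ss_dsum : forall (n : nat) (Y : 'I_n -> C), exists X, is_dsum Y X;
  ss_split : forall (X : C) (e : hom X X), e ∘ e = e ->
    exists (Y : C) (i : hom Y X) (r : hom X Y), r ∘ i = idm Y /\ i ∘ r = e;
  ss_simple : forall X : C, exists (n : nat) (Y : 'I_n -> C),
    (forall k, simple (Y k)) /\ is_dsum Y X;
  ss_unit : simple (tunit : C)
}.

(* Two-sided duals, with the same dual object on both sides. *)
Record duality (C : tcat F) := Duality {
  dob : C -> C;
  evl : forall X, hom (dob X • X) tunit;
  coevl : forall X, hom tunit (X • dob X);
  evr : forall X, hom (X • dob X) tunit;
  coevr : forall X, hom tunit (dob X • X);
  lzig : forall X, ρ X ∘ (idm X ⊗ evl X) ∘ α X (dob X) X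
    ∘ (coevl X ⊗ idm X) ∘ λ' X = idm X;
  lzag : forall X, λ (dob X) ∘ (evl X ⊗ idm (dob X)) ∘ α' (dob X) X (dob X)
    ∘ (idm (dob X) ⊗ coevl X) ∘ ρ' (dob X) = idm (dob X);
  rzig : forall X, λ X ∘ (evr X ⊗ idm X) ∘ α' X (dob X) X
    ∘ (idm X ⊗ coevr X) ∘ ρ' X = idm X;
  rzag : forall X, ρ (dob X) ∘ (idm (dob X) ⊗ evr X) ∘ α (dob X) X (dob X)
    ∘ (coevr X ⊗ idm (dob X)) ∘ λ' (dob X) = idm (dob X)
}.

Section Transposes.
Variables (C : tcat F) (P : duality C).

Definition ltransp (X Y : C) (f : hom X Y) : hom (dob P Y) (dob P X) :=
  λ (dob P X) ∘ ((evl P Y ∘ (idm (dob P Y) ⊗ f)) ⊗ idm (dob P X))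
    ∘ α' (dob P Y) X (dob P X) ∘ (idm (dob P Y) ⊗ coevl P X) ∘ ρ' (dob P Y).

Definition rtransp (X Y : C) (f : hom X Y) : hom (dob P Y) (dob P X) :=
  ρ (dob P X) ∘ (idm (dob P X) ⊗ (evr P Y ∘ (f ⊗ idm (dob P Y))))
    ∘ α (dob P X) X (dob P Y) ∘ (coevr P X ⊗ idm (dob P Y)) ∘ λ' (dob P Y).

Definition ltrace (X : C) (f : hom X X) : hom tunit tunit :=
  evl P X ∘ (idm (dob P X) ⊗ f) ∘ coevr P X.

Definition rtrace (X : C) (f : hom X X) : hom tunit tunit :=
  evr P X ∘ (f ⊗ idm (dob P X)) ∘ coevl P X.

End Transposes.

(* The left and right dual functors coincide as tensor functors: one morphism
   Y*X* -> (XY)* (and one 1 -> 1* ) is compatible with both dualities. *)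
Record pivotal (C : tcat F) := Pivotal {
  pv_duality :> duality C;
  pv_transp : forall (X Y : C) (f : hom X Y),
    ltransp pv_duality f = rtransp pv_duality f;
  pv_tens : forall X Y : C,
    exists m : hom (dob pv_duality Y • dob pv_duality X)
                   (dob pv_duality (X • Y)),
      evl pv_duality (X • Y) ∘ (m ⊗ idm (X • Y)) =
        evl pv_duality Y
          ∘ (idm (dob pv_duality Y) ⊗
              (λ Y ∘ (evl pv_duality X ⊗ idm Y) ∘ α' (dob pv_duality X) X Y))
          ∘ α (dob pv_duality Y) (dob pv_duality X) (X • Y) /\
      evr pv_duality (X • Y) ∘ (idm (X • Y) ⊗ m) =
        evr pv_duality X
          ∘ (idm X ⊗
              (λ (dob pv_duality X) ∘ (evr pv_duality Y ⊗ idm (dob pv_duality X))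
                ∘ α' Y (dob pv_duality Y) (dob pv_duality X)))
          ∘ α X Y (dob pv_duality Y • dob pv_duality X);
  pv_unit : exists m : hom tunit (dob pv_duality tunit),
      evl pv_duality tunit ∘ (m ⊗ idm tunit) = λ tunit /\
      evr pv_duality tunit ∘ (idm tunit ⊗ m) = λ tunit
}.

Definition spherical (C : tcat F) (P : pivotal C) : Prop :=
  forall (X : C) (f : hom X X), ltrace P f = rtrace P f.

(* f = scal f *: idm tunit when the unit is simple. *)
Definition scal (C : tcat F) (f : hom (tunit : C) tunit) : F :=
  coord [tuple idm (tunit : C)] ord0 f.

Definition Smatrix (C : bcat F) (P : pivotal C) (n : nat) (X : 'I_n -> C) :
    'M[F]_n :=
  \matrix_(i, j) scal (ltrace P (fw (braid (X j) (X i)) ∘ fw (braid (X i) (X j)))).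

Definition simple_reps (C : lcat F) (n : nat) (X : 'I_n -> C) : Prop :=
  [/\ forall i, simple (X i),
      forall i j, inhabited (isom (X i) (X j)) -> i = j
    & forall Y : C, simple Y -> exists i, inhabited (isom Y (X i))].

Definition modular (C : bcat F) (P : pivotal C) : Prop :=
  [/\ semisimple C, spherical P
    & exists (n : nat) (X : 'I_n -> C), simple_reps X /\ Smatrix P X \in unitmx].

End Hypotheses.

(* Main.v *)
From mathcomp Require Import all_boot all_order all_algebra.
From mathcomp Require Import boolp.
Require Import Defs.

(* The functor sends X ⊠ Y to (X, c(X,-)) (Y, c~(Y,-)).  The main tool is the
   average of a morphism g : U -> A of C over the simple objects: for objects U
   and A of the center let an X_i-strand cross U below g and A above g by their
   half braidings, close it to a loop, and sum with the weights dim X_i.  The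
   average is a morphism of the center, because a strand Y slides over the loop.

   Averaging the identity from (X_i, c(X_i,-)) to (X_i, c~(X_i,-)) shows that
   X_i is transparent or that the sum of dim X_j S(X_i,X_j) over j vanishes; as S
   is invertible only the unit is transparent, so sum_j (dim X_j)^2 <> 0, and the
   averaged loop around any object W of C factors through the unit.

   Fullness: a morphism X Y -> X' Y' of the center bends to a morphism from
   (X'*X, c) to (Y'Y*, c~), which absorbs the loop around X'*X, hence factors
   through the unit; unbending yields a sum of morphisms f ⊗ g.  Essential
   surjectivity: averaging the coevaluations A -> X_i (X_i* A), where X_i carries
   c~ and X_i* A carries c, exhibits A as a retract of the sum of these objects,
   and the corresponding idempotent is diagonal, hence splits in C ⊠ C~. *)

Set Implicit Arguments.
Unset Strict Implicit.
Unset Printing Implicit Defensive.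
Import GRing.Theory.
Local Open Scope ring_scope.
Local Open Scope cat_scope.
Local Obligation Tactic := idtac.

(** * Coherence: morphisms between tensor words, acting on a tail *)

(** The center is not known to be semisimple beforehand, so no dimension count for it is available
    and everything is extracted from loops. A morphism of the center lets a loop slide off as a
    circle, so averaging multiplies it by [gdim], the sum of the squared dimensions; once [gdim] is
    nonzero, averaging is, up to this factor, a projection onto the morphisms of the center. For an
    arbitrary morphism the average may vanish, and this is the difficulty of essential surjectivity.
    There X_i and its dual get opposite half braidings, which keeps the closed strand X_i linked
    with the loop X_j. Summing over i first kills every X_j except the unit, whose loop is a mere
    circle, and A reappears with the nonzero factor d^2 [gdim], where d is the dimension of the
    representative of the unit.

    The completed product has direct sums by construction, but not split idempotents. Taking the
    pairwise distinct simple X_i as second factors reduces the one splitting that is required to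
    splittings in C. *)

Section Coherence.
Variables (F : fieldType) (C : tcat F).

(* A morphism f : tobj t -> tobj t' is handled through the morphisms
   fam f Z : act t Z -> act t' Z, where act t Z tensors Z with the leaves of t,
   nested to the right.  This assignment is functorial and faithful, and turns all
   associators and unitors into identities. *)
Inductive tree := Leaf of C | Un | Node of tree & tree.

Fixpoint tobj (t : tree) : C :=
  match t with Leaf X => X | Un => tunit | Node a b => tobj a • tobj b end.

Fixpoint act (t : tree) (Z : C) : C :=
  match t with Leaf X => X • Z | Un => Z | Node a b => act a (act b Z) end.

Fixpoint actm (t : tree) (Z Z' : C) (k : hom Z Z') : hom (act t Z) (act t Z') :=
  match t with
  | Leaf X => idm X ⊗ k | Un => k | Node a b => actm a (actm b k)
  end.

Fixpoint nrm (t : tree) (Z : C) : isom (tobj t • Z) (act t Z) :=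
  match t with
  | Leaf X => idi (X • Z) | Un => lunit Z
  | Node a b => compi (nrm a (act b Z))
      (compi (tensi (idi (tobj a)) (nrm b Z)) (assoc (tobj a) (tobj b) Z))
  end.

(* Sealed, so that rewriting with compA does not look through it. *)
Fact fam_subproof (t t' : tree) (f : hom (tobj t) (tobj t')) (Z : C) :
  {g : hom (act t Z) (act t' Z) | g = fw (nrm t' Z) ∘ (f ⊗ idm Z) ∘ bw (nrm t Z)}.
Proof. by exists (fw (nrm t' Z) ∘ (f ⊗ idm Z) ∘ bw (nrm t Z)). Qed.

Definition fam (t t' : tree) (f : hom (tobj t) (tobj t')) (Z : C) :
    hom (act t Z) (act t' Z) := sval (fam_subproof f Z).

Lemma famE (t t' : tree) (f : hom (tobj t) (tobj t')) (Z : C) :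
  fam f Z = fw (nrm t' Z) ∘ (f ⊗ idm Z) ∘ bw (nrm t Z).
Proof. exact: svalP (fam_subproof f Z). Qed.

Lemma actm1 t Z : actm t (idm Z) = idm (act t Z).
Proof.
elim: t Z => [X|//|a IHa b IHb] Z /=; first exact: tens11.
by rewrite IHb IHa.
Qed.

Lemma actmM t Z Z' Z'' (k' : hom Z' Z'') (k : hom Z Z') :
  actm t (k' ∘ k) = actm t k' ∘ actm t k.
Proof.
elim: t Z Z' Z'' k' k => [X|//|a IHa b IHb] Z Z' Z'' k' k /=; first by rewrite tensMr.
by rewrite IHb IHa.
Qed.

Lemma nrm_nat t Z Z' (k : hom Z Z') :
  fw (nrm t Z') ∘ (idm (tobj t) ⊗ k) = actm t k ∘ fw (nrm t Z).
Proof.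
elim: t Z Z' k => [X|//|a IHa b IHb] Z Z' k /=.
- by rewrite comp1m compm1.
- exact: lunit_nat.
rewrite -(tens11 (tobj a)) -!compA assoc_nat (compA (_ ⊗ _)) tensMr IHb.
by rewrite -tensMr -!compA (compA (fw _)) IHa !compA.
Qed.

Lemma nrm_nat' t Z Z' (k : hom Z Z') :
  bw (nrm t Z') ∘ actm t k = (idm (tobj t) ⊗ k) ∘ bw (nrm t Z).
Proof.
apply: (compKl (i := nrm t Z)); apply: (compKr (i := nrm t Z')).
by rewrite !compA bwK comp1m nrm_nat -!compA fwK !compm1.
Qed.

Lemma fam_nat t t' f Z Z' (k : hom Z Z') :
  @fam t t' f Z' ∘ actm t k = actm t' k ∘ fam f Z.
Proof.
rewrite !famE (compE (nrm_nat' t k)) !compA -nrm_nat.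
by rewrite (compE (tens_lr _ _)) (compE (tens_rl _ _)).
Qed.

Lemma fam_id t Z : @fam t t (idm (tobj t)) Z = idm (act t Z).
Proof. by rewrite !famE tens11 compm1 bwK. Qed.

Lemma famM t t' t'' (g : hom (tobj t') (tobj t'')) (f : hom (tobj t) (tobj t')) Z :
  @fam t t'' (g ∘ f) Z = fam g Z ∘ fam f Z.
Proof.
by rewrite !famE -tensMl !compA (compE (fwK _)) compm1.
Qed.

Lemma famT a a' b b' (f : hom (tobj a) (tobj a')) (g : hom (tobj b) (tobj b')) Z :
  @fam (Node a b) (Node a' b') (f ⊗ g) Z = fam f (act b' Z) ∘ actm a (fam g Z).
Proof.
rewrite [fam f _]famE (compE (nrm_nat' _ _)) !compA !famE /= -!compA.
rewrite ![α _ _ _ ∘ _]compA assoc_nat -!compA ![α _ _ _ ∘ _]compA bwK comp1m.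
congr (_ ∘ _); rewrite !compA; congr (_ ∘ _).
by rewrite -!tensM !compm1 !comp1m ?compA.
Qed.

Lemma fam_nrm t t' (f : hom (tobj t) (tobj t')) Z :
  fam f Z ∘ fw (nrm t Z) = fw (nrm t' Z) ∘ (f ⊗ idm Z).
Proof. by rewrite !famE -!compA fwK compm1. Qed.

Lemma fam_inj t t' (f g : hom (tobj t) (tobj t')) :
  (forall Z, fam f Z = fam g Z) -> f = g.
Proof.
move=> e; apply: tens_unit_inj.
apply: (compKr (i := nrm t' tunit)).
by apply: (compKl (i := isom_inv (nrm t tunit))); have := e tunit; rewrite !famE.
Qed.

Lemma fam_assoc a b c Z :
  @fam (Node (Node a b) c) (Node a (Node b c)) (α (tobj a) (tobj b) (tobj c)) Z =
  idm (act a (act b (act c Z))).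
Proof.
apply: (compKl (i := nrm (Node (Node a b) c) Z)).
rewrite fam_nrm comp1m /= -!compA.
congr (_ ∘ _); rewrite -!tensMr -!compA; congr (_ ∘ _).
rewrite -(tens11 (tobj a) (tobj b)) [in RHS]compA assoc_nat -!compA.
by congr (_ ∘ _); rewrite !compA -pentagon.
Qed.

Lemma fam_assoc' a b c Z :
  @fam (Node a (Node b c)) (Node (Node a b) c) (α' (tobj a) (tobj b) (tobj c)) Z =
  idm (act a (act b (act c Z))).
Proof.
have := @famM (Node a (Node b c)) (Node (Node a b) c) (Node a (Node b c))
   (α (tobj a) (tobj b) (tobj c)) (α' _ _ _) Z.
by rewrite bwK fam_id fam_assoc comp1m => <-.
Qed.

Lemma fam_lunit a Z : @fam (Node Un a) a (λ (tobj a)) Z = idm (act a Z).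
Proof.
apply: (compKl (i := nrm (Node Un a) Z)).
by rewrite fam_nrm comp1m /= compA lunit_nat -compA lunit_tens.
Qed.

Lemma fam_lunit' a Z : @fam a (Node Un a) (λ' (tobj a)) Z = idm (act a Z).
Proof.
have := @famM a (Node Un a) a (λ (tobj a)) (λ' (tobj a)) Z.
by rewrite bwK fam_id fam_lunit comp1m => <-.
Qed.

Lemma fam_runit a Z : @fam (Node a Un) a (ρ (tobj a)) Z = idm (act a Z).
Proof.
apply: (compKl (i := nrm (Node a Un) Z)).
by rewrite fam_nrm comp1m /= triangle.
Qed.

Lemma fam_runit' a Z : @fam a (Node a Un) (ρ' (tobj a)) Z = idm (act a Z).
Proof.
have := @famM a (Node a Un) a (ρ (tobj a)) (ρ' (tobj a)) Z.
by rewrite bwK fam_id fam_runit comp1m => <-.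
Qed.

Lemma famL X Y (f : hom X Y) Z : @fam (Leaf X) (Leaf Y) f Z = f ⊗ idm Z.
Proof. by rewrite !famE /= comp1m compm1. Qed.

Lemma fam_lin a b Z : linear (fun f : hom (tobj a) (tobj b) => fam f Z).
Proof.
move=> x f g; rewrite !famE (@tens_linl _ _ _ _ _ _ (idm Z)).
by rewrite (comp_linr (fw (nrm b Z))) (comp_linl (bw (nrm a Z))).
Qed.

End Coherence.
Arguments Un {F C}.

(** * Duality and half braidings *)

(** [fam] of a composite needs a tree for the middle object, which the term carries only as an
    object. Whatever is not a tensor product, a unit or of the form [tobj t] becomes a leaf. *)
Ltac reify M :=
  lazymatch M with
  | tens ?A ?B => let a := reify A in let b := reify B in constr:(Node a b)
  | @tunit _ ?C => constr:(@Un _ C)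
  | tobj ?t => t
  | _ => constr:(Leaf M)
  end.

Ltac famx1 :=
  match goal with
  | |- context [@fam ?F ?C ?a ?b (@hcomp _ _ _ ?M _ ?g ?f) ?Z] =>
      let m := reify M in rewrite (@famM F C a m b g f Z)
  | |- context [@fam ?F ?C (Node ?a ?b) (Node ?c ?d) (tensm ?f ?g) ?Z] =>
      rewrite (@famT F C a c b d f g Z)
  | |- context [@fam ?F ?C (Node (Node ?a ?b) ?c) (Node ?a (Node ?b ?c)) (fw (assoc _ _
    _)) ?Z] =>
      rewrite (@fam_assoc F C a b c Z)
  | |- context [@fam ?F ?C (Node ?a (Node ?b ?c)) (Node (Node ?a ?b) ?c) (bw (assoc _ _
    _)) ?Z] =>
      rewrite (@fam_assoc' F C a b c Z)
  | |- context [@fam ?F ?C (Node Un ?a) ?a (fw (lunit _)) ?Z] =>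
      rewrite (@fam_lunit F C a Z)
  | |- context [@fam ?F ?C ?a (Node Un ?a) (bw (lunit _)) ?Z] =>
      rewrite (@fam_lunit' F C a Z)
  | |- context [@fam ?F ?C (Node ?a Un) ?a (fw (runit _)) ?Z] =>
      rewrite (@fam_runit F C a Z)
  | |- context [@fam ?F ?C ?a (Node ?a Un) (bw (runit _)) ?Z] =>
      rewrite (@fam_runit' F C a Z)
  | |- context [@fam ?F ?C ?a ?a (idm _) ?Z] => rewrite (@fam_id F C a Z)
  | |- context [@fam ?F ?C (Leaf ?X) (Leaf ?Y) ?f ?Z] => rewrite (@famL F C X Y f Z)
  end.
Ltac famx := repeat famx1; cbn [act actm tobj];
  rewrite ?(actm1, tens11, comp1m, compm1) ?compA.

Notation fam12 f Z := (@fam _ _ (Leaf _) (Node (Leaf _) (Leaf _)) f Z).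
Notation fam22 f Z :=
  (@fam _ _ (Node (Leaf _) (Leaf _)) (Node (Leaf _) (Leaf _)) f Z).

Section Duality.
Variables (F : fieldType) (C : tcat F) (P : duality C).
Local Notation D := (dob P).

Definition evL X Z : hom (D X • (X • Z)) Z :=
  @fam _ _ (Node (Leaf (D X)) (Leaf X)) Un (evl P X) Z.
Definition cvL X Z : hom Z (X • (D X • Z)) :=
  @fam _ _ Un (Node (Leaf X) (Leaf (D X))) (coevl P X) Z.
Definition evR X Z : hom (X • (D X • Z)) Z :=
  @fam _ _ (Node (Leaf X) (Leaf (D X))) Un (evr P X) Z.
Definition cvR X Z : hom Z (D X • (X • Z)) :=
  @fam _ _ Un (Node (Leaf (D X)) (Leaf X)) (coevr P X) Z.

Lemma evL_nat X Z Z' (k : hom Z Z') :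
  evL X Z' ∘ (idm (D X) ⊗ (idm X ⊗ k)) = k ∘ evL X Z.
Proof. exact: (@fam_nat _ _ (Node (Leaf (D X)) (Leaf X)) Un). Qed.
Lemma cvL_nat X Z Z' (k : hom Z Z') :
  cvL X Z' ∘ k = (idm X ⊗ (idm (D X) ⊗ k)) ∘ cvL X Z.
Proof. exact: (@fam_nat _ _ Un (Node (Leaf X) (Leaf (D X)))). Qed.
Lemma evR_nat X Z Z' (k : hom Z Z') :
  evR X Z' ∘ (idm X ⊗ (idm (D X) ⊗ k)) = k ∘ evR X Z.
Proof. exact: (@fam_nat _ _ (Node (Leaf X) (Leaf (D X))) Un). Qed.
Lemma cvR_nat X Z Z' (k : hom Z Z') :
  cvR X Z' ∘ k = (idm (D X) ⊗ (idm X ⊗ k)) ∘ cvR X Z.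
Proof. exact: (@fam_nat _ _ Un (Node (Leaf (D X)) (Leaf X))). Qed.

(** The zigzag [lzig] acting on a tail, which absorbs the associators and unitors; the next three
    are the other zigzags. *)
Lemma snakeL X Z : (idm X ⊗ evL X Z) ∘ cvL X (X • Z) = idm (X • Z).
Proof.
have := congr1 (fun f => @fam _ _ (Leaf X) (Leaf X) f Z) (lzig P X).
by famx.
Qed.
Lemma snakeL' X Z : evL X (D X • Z) ∘ (idm (D X) ⊗ cvL X Z) = idm (D X • Z).
Proof.
have := congr1 (fun f => @fam _ _ (Leaf (D X)) (Leaf (D X)) f Z) (lzag P X).
by famx.
Qed.
Lemma snakeR X Z : evR X (X • Z) ∘ (idm X ⊗ cvR X Z) = idm (X • Z).
Proof.
have := congr1 (fun f => @fam _ _ (Leaf X) (Leaf X) f Z) (rzig P X).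
by famx.
Qed.
Lemma snakeR' X Z : (idm (D X) ⊗ evR X Z) ∘ cvR X (D X • Z) = idm (D X • Z).
Proof.
have := congr1 (fun f => @fam _ _ (Leaf (D X)) (Leaf (D X)) f Z) (rzag P X).
by famx.
Qed.

End Duality.

Section HalfBraiding.
Variables (F : fieldType) (C : tcat F).
Implicit Types (A B : zob C) (t : tree C).

Definition fh A t Z : hom (zc A • act t Z) (act t (zc A • Z)) :=
  @fam _ _ (Node (Leaf (zc A)) t) (Node t (Leaf (zc A))) (fw (hb (zhb A) (tobj t))) Z.
Definition sh A t Z : hom (act t (zc A • Z)) (zc A • act t Z) :=
  @fam _ _ (Node t (Leaf (zc A))) (Node (Leaf (zc A)) t) (bw (hb (zhb A) (tobj t))) Z.

Lemma fhK A t Z : sh A t Z ∘ fh A t Z = idm _.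
Proof.
rewrite /sh /fh -(@famM _ _ (Node (Leaf (zc A)) t) (Node t (Leaf (zc A))) (Node (Leaf (zc
  A)) t)) fwK.
exact: (@fam_id _ _ (Node (Leaf (zc A)) t)).
Qed.
Lemma shK A t Z : fh A t Z ∘ sh A t Z = idm _.
Proof.
rewrite /sh /fh -(@famM _ _ (Node t (Leaf (zc A))) (Node (Leaf (zc A)) t) (Node t (Leaf
  (zc A)))) bwK.
exact: (@fam_id _ _ (Node t (Leaf (zc A)))).
Qed.
Definition fhi A t Z := Isom (fhK A t Z) (shK A t Z).

Lemma fh_nat A t t' (f : hom (tobj t) (tobj t')) Z :
  fh A t' Z ∘ (idm (zc A) ⊗ fam f Z) = fam f (zc A • Z) ∘ fh A t Z.
Proof.
have := congr1 (fun f => @fam _ _ (Node (Leaf (zc A)) t) (Node t' (Leaf (zc A))) f Z)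
  (hb_nat (zhb A) f).
rewrite (@famM _ _ _ (Node (Leaf (zc A)) t')) (@famM _ _ _ (Node t (Leaf (zc A)))).
by rewrite !famT !fam_id actm1 compm1 comp1m.
Qed.

Lemma sh_nat A t t' (f : hom (tobj t) (tobj t')) Z :
  (idm (zc A) ⊗ fam f Z) ∘ sh A t Z = sh A t' Z ∘ fam f (zc A • Z).
Proof.
apply: (compKl (i := fhi A t Z)); apply: (compKr (i := fhi A t' Z)) => /=.
rewrite -!compA fhK compm1 compA fh_nat -compA.
by rewrite [in RHS]compA shK comp1m.
Qed.

Lemma sh_tail A t Z Z' (k : hom Z Z') :
  sh A t Z' ∘ actm t (idm (zc A) ⊗ k) = (idm (zc A) ⊗ actm t k) ∘ sh A t Z.
Proof. exact: (@fam_nat _ _ (Node t (Leaf (zc A))) (Node (Leaf (zc A)) t)). Qed.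

Lemma fh_Node A a b Z : fh A (Node a b) Z = actm a (fh A b Z) ∘ fh A a (act b Z).
Proof. by rewrite /fh /= hb_hex /=; famx. Qed.

Lemma sh_Node A a b Z : sh A (Node a b) Z = sh A a (act b Z) ∘ actm a (sh A b Z).
Proof.
apply: (compKl (i := fhi A (Node a b) Z)) => /=.
rewrite (fhK A (Node a b) Z) fh_Node -compA (compA (actm a _)) -actmM fhK actm1.
by rewrite comp1m fhK.
Qed.

Lemma fh_Un A Z : fh A Un Z = idm (zc A • Z).
Proof. by rewrite /fh /= hb_unit; famx. Qed.

Lemma sh_Un A Z : sh A Un Z = idm (zc A • Z).
Proof. by have := fhK A Un Z; rewrite fh_Un compm1. Qed.

Lemma fh_zmor A B (z : hom (zc A) (zc B)) t Z : zmor_prop z ->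
  fh B t Z ∘ (z ⊗ idm (act t Z)) = actm t (z ⊗ idm Z) ∘ fh A t Z.
Proof.
move=> /(_ (tobj t)) e.
have := congr1 (fun f => @fam _ _ (Node (Leaf (zc A)) t) (Node t (Leaf (zc B))) f Z) e.
rewrite (@famM _ _ _ (Node t (Leaf (zc A)))) (@famM _ _ _ (Node (Leaf (zc B)) t)).
by rewrite !famT !fam_id actm1 compm1 comp1m !famL.
Qed.

Lemma sh_zmor A B (z : hom (zc A) (zc B)) t Z : zmor_prop z ->
  (z ⊗ idm (act t Z)) ∘ sh A t Z = sh B t Z ∘ actm t (z ⊗ idm Z).
Proof.
move=> e; apply: (compKl (i := fhi A t Z)); apply: (compKr (i := fhi B t Z)) => /=.
rewrite -!compA fhK compm1 (fh_zmor _ _ e).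
by rewrite [in RHS]compA shK comp1m.
Qed.

(** Half braidings are invertible, so morphisms of the center can be tested on inverse crossings. In
    this form the strand Y moves from left to right, as the strands of [ringm] do. *)
Lemma zmor_sh A B (z : hom (zc A) (zc B)) :
  (forall Y Z, (z ⊗ idm (Y • Z)) ∘ sh A (Leaf Y) Z =
    sh B (Leaf Y) Z ∘ (idm Y ⊗ (z ⊗ idm Z))) -> zmor_prop z.
Proof.
move=> e Y; apply: (@fam_inj _ _ (Node (Leaf (zc A)) (Leaf Y)) (Node (Leaf Y) (Leaf (zc
  B)))) => Z.
apply: (compKl (i := isom_inv (fhi A (Leaf Y) Z))).
apply: (compKr (i := isom_inv (fhi B (Leaf Y) Z))) => /=.
rewrite (@famM _ _ _ (Node (Leaf Y) (Leaf (zc A)))) (@famM _ _ _ (Node (Leaf (zc B))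
  (Leaf Y))).
rewrite !famT !fam_id !actm1 !compm1 !comp1m !famL.
rewrite -!/(fh A (Leaf Y) Z) -!/(fh B (Leaf Y) Z) /= -!compA (shK A (Leaf Y) Z) compm1.
by rewrite -e !compA (fhK B (Leaf Y) Z) comp1m.
Qed.

(* The loop: create X and its dual to the left of U, move the dual to the
   right, apply g between the two strands, and close the loop on the right of A. *)
Definition ringm (P : duality C) (U A : zob C) (X : C) (g : hom (zc U) (zc A)) :
    hom (zc U) (zc A) :=
  ρ (zc A) ∘ (idm (zc A) ⊗ evr P X) ∘ α (zc A) X (dob P X)
    ∘ (bw (hb (zhb A) X) ⊗ idm (dob P X)) ∘ α' X (zc A) (dob P X)
    ∘ (idm X ⊗ (g ⊗ idm (dob P X))) ∘ (idm X ⊗ bw (hb (zhb U) (dob P X)))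
    ∘ α X (dob P X) (zc U) ∘ (coevl P X ⊗ idm (zc U)) ∘ λ' (zc U).

Lemma ringmE (P : duality C) (U A : zob C) (X : C) (g : hom (zc U) (zc A)) Z :
  ringm P X g ⊗ idm Z =
  (idm (zc A) ⊗ evR P X Z) ∘ sh A (Leaf X) (dob P X • Z)
    ∘ (idm X ⊗ (g ⊗ idm (dob P X • Z))) ∘ (idm X ⊗ sh U (Leaf (dob P X)) Z)
    ∘ cvL P X (zc U • Z).
Proof.
rewrite -famL /ringm; famx.
rewrite /sh /evR /cvL.
by [].
Qed.

End HalfBraiding.

(** * Linear algebra of Hom-spaces and rotation of morphisms *)

Section Linear.
Variables (F : fieldType).

Lemma lin_sum (V W : vectType F) (f : V -> W) (I : Type) (r : seq I) (Q : pred I)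
    (G : I -> V) : linear f -> f (\sum_(i <- r | Q i) G i) = \sum_(i <- r | Q i) f (G i).
Proof.
move=> lf; apply: (big_morph f) => [u v|]; last exact: lin0 lf.
by have := lf 1 u v; rewrite !scale1r.
Qed.

Lemma linZ (V W : vectType F) (f : V -> W) a v : linear f -> f (a *: v) = a *: f v.
Proof. by move=> lf; have := lf a v 0; rewrite (lin0 lf) !addr0. Qed.

Lemma linB (V W : vectType F) (f : V -> W) u v : linear f -> f (u - v) = f u - f v.
Proof. by move=> lf; rewrite addrC -scaleN1r lf scaleN1r addrC. Qed.

Variable C : tcat F.
Implicit Types X Y Z : C.

Lemma compZl X Y Z a (g : hom Y Z) (f : hom X Y) : (a *: g) ∘ f = a *: (g ∘ f).
Proof. exact: linZ (comp_linl f). Qed.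
Lemma compZr X Y Z a (g : hom Y Z) (f : hom X Y) : g ∘ (a *: f) = a *: (g ∘ f).
Proof. exact: linZ (comp_linr g). Qed.
Lemma tensZl X X' Y Y' a (f : hom X X') (g : hom Y Y') : (a *: f) ⊗ g = a *: (f ⊗ g).
Proof. exact: linZ (tens_linl g). Qed.
Lemma tensZr X X' Y Y' a (f : hom X X') (g : hom Y Y') : f ⊗ (a *: g) = a *: (f ⊗ g).
Proof. exact: linZ (tens_linr f). Qed.

Lemma famZ (t t' : tree C) a (f : hom (tobj t) (tobj t')) Z :
  fam (a *: f) Z = a *: fam f Z.
Proof. exact: linZ (fam_lin Z). Qed.
Lemma fam_sum (t t' : tree C) (I : finType) (f : I -> hom (tobj t) (tobj t')) Z :
  fam (\sum_i f i) Z = \sum_i fam (f i) Z.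
Proof. exact: lin_sum (@fam_lin _ _ t t' Z). Qed.

Definition coef X (f : hom X X) : F := coord [tuple idm X] ord0 f.

Lemma simple_neq0 X : simple X -> idm X != 0.
Proof.
case=> h hK _; apply/eqP => e.
have := hK 1; have := hK 0; rewrite e !scaler0 => -> /esym /eqP.
by rewrite oner_eq0.
Qed.

Lemma coefE X (f : hom X X) : simple X -> f = coef f *: idm X.
Proof.
move=> sX; have [h _ hK] := sX.
have fr : free [tuple idm X] by rewrite seq1_free // simple_neq0.
have := hK f; set a := h f => <-.
rewrite /coef linearZ /= -[X in coord _ _ X]/([tuple idm X]`_(ord0 : 'I_1)).
by rewrite (coord_free (ord0 : 'I_1)) // mulr1.
Qed.

Lemma coefZ X a : simple X -> coef (a *: idm X) = a.
Proof.
move=> sX; have := coefE (a *: idm X) sX => /esym /eqP.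
rewrite -subr_eq0 -scalerBl scaler_eq0 (negbTE (simple_neq0 sX)) orbF subr_eq0.
by move/eqP.
Qed.

End Linear.

Section Whisker.
Variables (F : fieldType) (C : tcat F).
Implicit Types X Y Z : C.

Lemma whisk W X Y Z (g : hom Y Z) (f : hom X Y) h :
  g ∘ f = h -> (idm W ⊗ g) ∘ (idm W ⊗ f) = idm W ⊗ h.
Proof. by move=> <-; rewrite tensMr. Qed.

Lemma whisk2 W X Y Y' Z (g : hom Y Z) (f : hom X Y) (g' : hom Y' Z) f' :
  g ∘ f = g' ∘ f' ->
  (idm W ⊗ g) ∘ (idm W ⊗ f) = (idm W ⊗ g') ∘ (idm W ⊗ f').
Proof. by rewrite !tensMr => ->. Qed.

Lemma fam12_nat A Y B (f : hom A (Y • B)) Z Z' (k : hom Z Z') :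
  @fam _ _ (Leaf A) (Node (Leaf Y) (Leaf B)) f Z' ∘ (idm A ⊗ k) =
  (idm Y ⊗ (idm B ⊗ k)) ∘ @fam _ _ (Leaf A) (Node (Leaf Y) (Leaf B)) f Z.
Proof. exact: (@fam_nat _ _ (Leaf A) (Node (Leaf Y) (Leaf B))). Qed.

Lemma fam21_nat A Y B (g : hom (Y • B) A) Z Z' (k : hom Z Z') :
  @fam _ _ (Node (Leaf Y) (Leaf B)) (Leaf A) g Z' ∘ (idm Y ⊗ (idm B ⊗ k)) =
  (idm A ⊗ k) ∘ @fam _ _ (Node (Leaf Y) (Leaf B)) (Leaf A) g Z.
Proof. exact: (@fam_nat _ _ (Node (Leaf Y) (Leaf B)) (Leaf A)). Qed.

End Whisker.

Section Rotation.
Variables (F : fieldType) (C : tcat F) (P : duality C).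
Local Notation D := (dob P).
Implicit Types X Y Z : C.

(** [rotF] bends with [evr] and [coevr], [rotG] with [evl] and [coevl]: the first then fits the cap
    [evr] of a loop, the second its cup [coevl]. *)
Definition rotF A B Y (f : hom A (Y • B)) : hom (D B) (D A • Y) :=
  (idm (D A) ⊗ (ρ Y ∘ (idm Y ⊗ evr P B) ∘ α Y B (D B) ∘ (f ⊗ idm (D B))))
    ∘ α (D A) A (D B) ∘ (coevr P A ⊗ idm (D B)) ∘ λ' (D B).

Lemma rotFE A B Y (f : hom A (Y • B)) Z :
  @fam _ _ (Leaf (D B)) (Node (Leaf (D A)) (Leaf Y)) (rotF f) Z =
  (idm (D A) ⊗ ((idm Y ⊗ evR P B Z)
    ∘ @fam _ _ (Leaf A) (Node (Leaf Y) (Leaf B)) f (D B • Z))) ∘ cvR P A (D B • Z).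
Proof. by rewrite /rotF; famx. Qed.

Definition rotG A B Y (g : hom (Y • B) A) : hom (D A • Y) (D B) :=
  λ (D B) ∘ (evl P A ⊗ idm (D B)) ∘ α' (D A) A (D B)
    ∘ (idm (D A) ⊗ ((g ⊗ idm (D B)) ∘ α' Y B (D B) ∘ (idm Y ⊗ coevl P B) ∘ ρ' Y)).

Lemma rotGE A B Y (g : hom (Y • B) A) Z :
  @fam _ _ (Node (Leaf (D A)) (Leaf Y)) (Leaf (D B)) (rotG g) Z =
  evL P A (D B • Z) ∘ (idm (D A) ⊗
   (@fam _ _ (Node (Leaf Y) (Leaf B)) (Leaf A) g (D B • Z) ∘ (idm Y ⊗ cvL P B Z))).
Proof. by rewrite /rotG; famx. Qed.

(* This is what forces the weights qdim in the average over the simple objects. *)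
Lemma rot_trace A B Y (f : hom A (Y • B)) (g : hom (Y • B) A) :
  evl P B ∘ ((rotG g ∘ rotF f) ⊗ idm B) ∘ coevr P B = ltrace P (g ∘ f).
Proof.
apply: (@fam_inj _ _ Un Un) => Z; rewrite /ltrace.
rewrite -tensMl -tensMr; famx.
rewrite -!/(evL P _ Z) -!/(cvR P _ Z) rotGE rotFE -!tensMr !compA.
rewrite -evL_nat (compE (whisk2 _ (esym (fam21_nat g _)))) !compA.
rewrite (compE (whisk _ (whisk _ (snakeL P B Z)))) !tens11 compm1.
rewrite (compE (cvR_nat P A _)) !compA.
rewrite (compE (whisk2 _ (fam12_nat f _))) !compA.
by rewrite (compE (whisk _ (whisk _ (snakeR P B Z)))) !tens11 compm1.
Qed.

Lemma rotF_lin A B Y : linear (@rotF A B Y).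
Proof.
move=> a f g; rewrite /rotF.
rewrite (@tens_linl _ _ _ _ _ _ (idm (D B))) (comp_linr (_ ∘ α Y B (D B))).
rewrite (@tens_linr _ _ _ _ _ _ (idm (D A))).
by rewrite !(comp_linl _).
Qed.

Lemma rotF_slide A B Y (f : hom A (Y • B)) Z :
  (idm Y ⊗ evR P B Z) ∘ @fam _ _ (Leaf A) (Node (Leaf Y) (Leaf B)) f (D B • Z) =
  evR P A (Y • Z)
    ∘ (idm A ⊗ @fam _ _ (Leaf (D B)) (Node (Leaf (D A)) (Leaf Y)) (rotF f) Z).
Proof.
rewrite rotFE -!tensMr !compA evR_nat (compE (evR_nat P A _)) !compA.
by rewrite (compE (snakeR P A _)) compm1.
Qed.

Lemma rotG_slide A B Y (g : hom (Y • B) A) Z :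
  @fam _ _ (Node (Leaf Y) (Leaf B)) (Leaf A) g (D B • Z) ∘ (idm Y ⊗ cvL P B Z) =
  (idm A ⊗ @fam _ _ (Node (Leaf (D A)) (Leaf Y)) (Leaf (D B)) (rotG g) Z)
    ∘ cvL P A (Y • Z).
Proof.
rewrite rotGE -!tensMr !compA (compE (esym (cvL_nat P A _))) !compA.
by rewrite (compE (esym (cvL_nat P A _))) !compA snakeL comp1m.
Qed.

Definition unrot A B Y (h : hom (D B) (D A • Y)) : hom A (Y • B) :=
  λ (Y • B) ∘ (evr P A ⊗ idm (Y • B)) ∘ α' A (D A) (Y • B)
   ∘ (idm A ⊗ (α (D A) Y B ∘ (h ⊗ idm B) ∘ coevr P B)) ∘ ρ' A.

Lemma unrotE A B Y (h : hom (D B) (D A • Y)) Z :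
  @fam _ _ (Leaf A) (Node (Leaf Y) (Leaf B)) (unrot h) Z =
  evR P A (Y • (B • Z)) ∘ (idm A ⊗
    (@fam _ _ (Leaf (D B)) (Node (Leaf (D A)) (Leaf Y)) h (B • Z) ∘ cvR P B Z)).
Proof. by rewrite /unrot; famx. Qed.

Lemma unrotK A B Y : cancel (@unrot A B Y) (@rotF A B Y).
Proof.
move=> h; apply: (@fam_inj _ _ (Leaf (D B)) (Node (Leaf (D A)) (Leaf Y))) => Z.
rewrite rotFE unrotE [(idm Y ⊗ _) ∘ _]compA -evR_nat -!tensMr !compA.
do 3!rewrite (compE (esym (cvR_nat P A _))) compA.
rewrite (snakeR' P A (Y • Z)) comp1m.
rewrite -(fam12_nat h) -compA.
by rewrite (snakeR' P B Z) compm1.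
Qed.

(** The morphism whose left transpose is [h]; it transfers Schur's lemma from the [X i] to their
    duals. *)
Definition mate A B (h : hom (D A) (D B)) : hom B A :=
  ρ A ∘ (idm A ⊗ evl P B) ∘ (idm A ⊗ (h ⊗ idm B)) ∘ α A (D A) B
    ∘ (coevl P A ⊗ idm B) ∘ λ' B.

Lemma mateE A B (h : hom (D A) (D B)) Z :
  mate h ⊗ idm Z = (idm A ⊗ (evL P B Z ∘ (h ⊗ idm (B • Z)))) ∘ cvL P A (B • Z).
Proof. by rewrite -famL /mate; famx; rewrite -tensMr. Qed.

Lemma mate_lin A B : linear (@mate A B).
Proof.
move=> a f g; rewrite /mate.
rewrite (@tens_linl _ _ _ _ _ _ (idm B)) (@tens_linr _ _ _ _ _ _ (idm A)).
by rewrite (comp_linr _) !(comp_linl _).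
Qed.

Lemma mate_id A : mate (idm (D A)) = idm A.
Proof.
apply: (@fam_inj _ _ (Leaf A) (Leaf A)) => Z.
by rewrite !famL mateE !tens11 compm1 snakeL.
Qed.

Lemma mate_inj A B : injective (@mate A B).
Proof.
pose back (m : hom B A) Z := evL P A (D B • Z)
  ∘ (idm (D A) ⊗ ((m ⊗ idm (D B • Z)) ∘ cvL P B Z)).
have backK (h : hom (D A) (D B)) Z : back (mate h) Z = h ⊗ idm Z.
  rewrite /back mateE -!tensMr !compA.
  rewrite evL_nat (compE (evL_nat P A _)) !compA.
  rewrite (compE (snakeL' P A _)) compm1 (compE (tens_lr _ _)) -tens_rl !compA.
  by rewrite snakeL' comp1m.
move=> f g e; apply: (@fam_inj _ _ (Leaf (D A)) (Leaf (D B))) => Z.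
by rewrite !famL -!backK e.
Qed.

Definition dualF V A (q : hom (D V) A) : hom (D A) V :=
  λ V ∘ (evl P A ⊗ idm V) ∘ α' (D A) A V ∘ (idm (D A) ⊗ (q ⊗ idm V))
    ∘ (idm (D A) ⊗ coevr P V) ∘ ρ' (D A).

Definition dualG V A (p : hom A (D V)) : hom V (D A) :=
  λ (D A) ∘ (evr P V ⊗ idm (D A)) ∘ α' V (D V) (D A) ∘ (idm V ⊗ (p ⊗ idm (D A)))
    ∘ (idm V ⊗ coevl P A) ∘ ρ' V.

(** The right-hand side is linear in [p ∘ q] and becomes a zigzag at the identity. Hence a
    factorization of the identity of [D V] through objects A yields one of the identity of V through
    their duals. *)
Lemma dualFG V A (p : hom A (D V)) (q : hom (D V) A) Z :
  (dualF q ∘ dualG p) ⊗ idm Z =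
  evR P V (V • Z) ∘ (idm V ⊗ (((p ∘ q) ⊗ idm (V • Z)) ∘ cvR P V Z)).
Proof.
rewrite -famL /dualF /dualG; famx; rewrite -/(evL P _ _) -/(evR P _ _).
rewrite -/(cvL P _ _) -/(cvR P _ _).
pose x := evL P A (V • Z) ∘ (idm (D A) ⊗ (q ⊗ idm (V • Z))) ∘ (idm (D A) ⊗ cvR P V Z).
rewrite -/x -evR_nat -!compA !tensMr; congr (_ ∘ (idm V ⊗ _)).
rewrite !compA tens_rl -tens_lr -compA.
have -> : (idm A ⊗ x) ∘ cvL P A Z = (q ⊗ idm (V • Z)) ∘ cvR P V Z.
  rewrite /x -!tensMr.
  do 2!rewrite (compE (esym (cvL_nat P A _))) !compA.
  by rewrite snakeL comp1m.
by rewrite !compA tensMl.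
Qed.

End Rotation.

(** * Resolutions by simple objects and their rotation *)

Section Slide.
Variables (F : fieldType) (C : bcat F) (P : duality C) (n : nat) (X : 'I_n -> C).
Local Notation D := (dob P).
Hypothesis simX : forall i, simple (X i).
Hypothesis sim1 : simple (tunit : C).
Hypothesis schur : forall i j (f : hom (X i) (X j)), i != j -> f = 0.

(* A factorization of the identity of W through the X j; m bounds the
   multiplicities. *)
Record resol (W : C) := Resol {
  rnum : nat;
  rinj : forall j, 'I_rnum -> hom (X j) W;
  rprj : forall j, 'I_rnum -> hom W (X j);
  rid : \sum_j \sum_k (rinj j k ∘ rprj j k) = idm W
}.
Arguments rinj {W} r j k.
Arguments rprj {W} r j k.
Hypothesis res : forall W, resol W.

Definition qdim (Y : C) : F := coef (ltrace P (idm Y)).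

Lemma qdimE Y : evl P Y ∘ coevr P Y = qdim Y *: idm tunit.
Proof. by rewrite -coefE // /ltrace tens11 compm1. Qed.

Lemma dual_schur i j (h : hom (D (X i)) (D (X j))) : i != j -> h = 0.
Proof.
move=> ne; apply: (@mate_inj _ _ P); rewrite (lin0 (@mate_lin _ _ P _ _)).
by apply: schur; rewrite eq_sym.
Qed.

Lemma dual_scalar i (h : hom (D (X i)) (D (X i))) :
  h = coef (mate h) *: idm (D (X i)).
Proof.
apply: (@mate_inj _ _ P).
by rewrite (linZ _ _ (@mate_lin _ _ P _ _)) mate_id -coefE.
Qed.

(** A resolution of [D V] by the [X j] dualizes, by [dualFG], to a resolution of V by the [D (X j)];
    V is never compared with its double dual. *)
Lemma dual_ext V W (f g : hom V W) :
  (forall i (h : hom (D (X i)) V), f ∘ h = g ∘ h) -> f = g.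
Proof.
move=> e; pose r := res (D V).
have E : \sum_j \sum_k (dualF (rprj r j k) ∘ dualG (rinj r j k)) = idm V.
  apply: (@fam_inj _ _ (Leaf V) (Leaf V)) => Z; rewrite fam_sum fam_id.
  under eq_bigr => j _ do (rewrite fam_sum; under eq_bigr => k _ do
    rewrite famL dualFG).
  pose T (m : hom (D V) (D V)) :=
    evR P V (V • Z) ∘ (idm V ⊗ ((m ⊗ idm (V • Z)) ∘ cvR P V Z)).
  have linT : linear T.
    move=> a u v; rewrite /T (@tens_linl _ _ _ _ _ _ (idm (V • Z))).
    by rewrite (comp_linl _) (@tens_linr _ _ _ _ _ _ (idm V)) (comp_linr _).
  transitivity (T (idm (D V))); last by rewrite /T tens11 comp1m snakeR.
  rewrite -(rid r) (lin_sum _ _ _ linT); apply: eq_bigr => j _.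
  by rewrite (lin_sum _ _ _ linT).
rewrite -[f]compm1 -[g]compm1 -E !comp_sumr; apply: eq_bigr => j _.
by rewrite !comp_sumr; apply: eq_bigr => k _; rewrite (compA f) (compA g) e.
Qed.

(** By [unrotK] every test morphism is some [rotF f] with f from [X j] to [Y • X i], and only the
    terms of this i survive on it. The weights balance the two circles [X i] and [X j] that appear
    when [rot_trace] is evaluated. *)
Lemma rot_resolution Y j :
  \sum_i \sum_k qdim (X i) *: (rotF P (rinj (res (Y • X i)) j k)
                               ∘ rotG P (rprj (res (Y • X i)) j k)) =
  qdim (X j) *: idm (D (X j) • Y).
Proof.
apply: dual_ext => i h; rewrite -(unrotK h); set f := unrot h.
rewrite comp_suml (bigD1 i) //= [X in _ + X]big1 ?addr0 => [|i' ne]; last first.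
  rewrite comp_suml big1 // => k _.
  by rewrite compZl -compA (dual_schur (_ ∘ _)) 1?eq_sym // compm0 scaler0.
set r := res _.
have df : f = \sum_k coef (rprj r j k ∘ f) *: rinj r j k.
  rewrite -[LHS]comp1m -(rid r) comp_suml (bigD1 j) //= [X in _ + X]big1 ?addr0.
    rewrite comp_suml; apply: eq_bigr => k _.
    by rewrite -compA {1}(coefE (_ ∘ f) (simX j)) compZr compm1.
  move=> j' ne; rewrite comp_suml big1 // => k _.
  by rewrite -compA (schur (_ ∘ f)) 1?eq_sym // compm0.
rewrite compZl comp1m {2}df (lin_sum _ _ _ (@rotF_lin _ _ P _ _ _)).
rewrite comp_suml scaler_sumr; apply: eq_bigr => k _.
rewrite (linZ _ _ (@rotF_lin _ _ P _ _ _)) compZl -compA.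
set h' := _ ∘ rotF P f.
have eh : h' = coef (mate h') *: idm _ := dual_scalar h'.
have ea : rprj r j k ∘ f = coef (rprj r j k ∘ f) *: idm _ := coefE _ (simX j).
(* In coefficients of the unit, with p = [rprj r j k]: the scalar of [rotG p ∘ rotF f] times the
   dimension of [X i] equals the scalar of [p ∘ f] times the dimension of [X j]. *)
have := rot_trace P f (rprj r j k); rewrite -/h' eh ea /ltrace.
rewrite !(tensZl, tensZr, tens11, compZl, compZr, compm1) !qdimE !scalerA.
move/(congr1 (@coef _ _ _)); rewrite !coefZ // => e.
by rewrite mulrC e mulrC.
Qed.

End Slide.

Arguments rinj {F C n X W} r j k.
Arguments rprj {F C n X W} r j k.

(** * Averaging over the simple objects *)

Section Slide2.
Variables (F : fieldType) (C : bcat F) (P : duality C) (n : nat) (X : 'I_n -> C).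
Local Notation D := (dob P).
Hypothesis simX : forall i, simple (X i).
Hypothesis sim1 : simple (tunit : C).
Hypothesis schur : forall i j (f : hom (X i) (X j)), i != j -> f = 0.
Hypothesis res : forall W, resol X W.
Variables (U A : zob C).

Definition avg (g : hom (zc U) (zc A)) : hom (zc U) (zc A) :=
  \sum_i qdim P (X i) *: ringm P (X i) g.

Variable g : hom (zc U) (zc A).

(* The loop X_j with a morphism e inserted next to its dual strand and Y: fusing Y
   into the loops X_i produces these terms with e = rotF f ∘ rotG p, and by
   rot_resolution they add up to the case e = id, where Y has passed the loop. *)
Definition slide_term Y Z j (e : hom (D (X j) • Y) (D (X j) • Y)) :
    hom (Y • (zc U • Z)) (zc A • (Y • Z)) :=
  (idm (zc A) ⊗ evR P (X j) (Y • Z)) ∘ sh A (Leaf (X j)) (D (X j) • (Y • Z))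
  ∘ (idm (X j) ⊗ ((g ⊗ idm _) ∘ sh U (Node (Leaf (D (X j))) (Leaf Y)) Z
       ∘ @fam _ _ (Node (Leaf (D (X j))) (Leaf Y)) (Node (Leaf (D (X j))) (Leaf Y))
           e (zc U • Z)))
  ∘ cvL P (X j) (Y • (zc U • Z)).

Lemma slide_term_lin Y Z j : linear (@slide_term Y Z j).
Proof.
move=> a u v; rewrite /slide_term fam_lin (comp_linr _) (@tens_linr _ _ _ _ _ _ (idm (X
  j))).
by rewrite (comp_linr _) (comp_linl _).
Qed.

Lemma slide_term_id Y Z j :
  slide_term Z (idm (D (X j) • Y)) =
  (ringm P (X j) g ⊗ idm (Y • Z)) ∘ sh U (Leaf Y) Z.
Proof.
rewrite ringmE -!compA cvL_nat !compA /slide_term fam_id compm1 sh_Node.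
by rewrite -!tensMr !compA.
Qed.

(** The factors of [f ∘ p] leave along the loop in opposite directions: f passes the crossing with A
    and the cap, p passes the cup. Both arrive rotated on the dual strand, where they meet as
    [rotF f ∘ rotG p]. *)
Lemma slide_term_slide Y Z i j (f : hom (X j) (Y • X i)) (p : hom (Y • X i) (X j)) :
  (idm (zc A) ⊗ (idm Y ⊗ evR P (X i) Z))
    ∘ sh A (Node (Leaf Y) (Leaf (X i))) (D (X i) • Z)
    ∘ @fam _ _ (Node (Leaf Y) (Leaf (X i))) (Node (Leaf Y) (Leaf (X i)))
        (f ∘ p) (zc A • (D (X i) • Z))
    ∘ (idm Y ⊗ (idm (X i) ⊗ ((g ⊗ idm (D (X i) • Z)) ∘ sh U (Leaf (D (X i))) Z)))
    ∘ (idm Y ⊗ cvL P (X i) (zc U • Z)) =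
  slide_term Z (rotF P f ∘ rotG P p).
Proof.
rewrite (@famM _ _ _ (Leaf (X j))) /slide_term.
rewrite (@famM _ _ (Node (Leaf (D (X j))) (Leaf Y)) (Leaf (D (X i)))
  (Node (Leaf (D (X j))) (Leaf Y)) (rotF P f)) !compA.
have e1 : sh A (Node (Leaf Y) (Leaf (X i))) (D (X i) • Z)
    ∘ fam12 f (zc A • (D (X i) • Z)) =
  (idm (zc A) ⊗ fam12 f (D (X i) • Z)) ∘ sh A (Leaf (X j)) (D (X i) • Z).
  exact: (esym (@sh_nat _ _ A (Leaf (X j)) (Node (Leaf Y) (Leaf (X i))) f _)).
have e2 : (idm (zc A) ⊗ (idm (X j) ⊗ fam12 (rotF P f) Z))
    ∘ sh A (Leaf (X j)) (D (X i) • Z) =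
   sh A (Leaf (X j)) (D (X j) • (Y • Z))
    ∘ (idm (X j) ⊗ (idm (zc A) ⊗ fam12 (rotF P f) Z)).
  exact: (esym (@sh_tail _ _ A (Leaf (X j)) _ _ _)).
have e3 : (idm (zc U) ⊗ fam12 (rotF P f) Z) ∘ sh U (Leaf (D (X i))) Z =
    sh U (Node (Leaf (D (X j))) (Leaf Y)) Z ∘ fam12 (rotF P f) (zc U • Z).
  exact: (@sh_nat _ _ U (Leaf (D (X i))) (Node (Leaf (D (X j))) (Leaf Y))).
rewrite (compE e1) !compA (whisk2 _ (rotF_slide P f Z)).
rewrite (compE e2) !compA (compE (fam21_nat p _)) !compA.
rewrite (compE (rotG_slide P p _)) !compA; congr (_ ∘ _).
rewrite -!tensMr !compA (compE (whisk _ (tens_rl _ _))).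
rewrite -(tens_lr g) -!tensMr !compA.
rewrite (compE (whisk2 _ e3)).
by rewrite !compA.
Qed.

Lemma avg_zmor : zmor_prop (A := U) (B := A) (avg g).
Proof.
apply: zmor_sh => Y Z.
have lhs : (avg g ⊗ idm (Y • Z)) ∘ sh U (Leaf Y) Z =
    \sum_j qdim P (X j) *: slide_term Z (idm (D (X j) • Y)).
  rewrite /avg tens_suml comp_suml; apply: eq_bigr => j _.
  by rewrite tensZl compZl slide_term_id.
rewrite lhs; symmetry.
(* The identity of [Y • X i] is resolved; j is the colour of the loop after Y has been fused into
   it. *)
transitivity (\sum_i \sum_j \sum_k qdim P (X i) *:
  slide_term Z (rotF P (rinj (res (Y • X i)) j k) ∘ rotG P (rprj (res (Y • X i)) j k))).
  rewrite /avg tens_suml tens_sumr comp_sumr; apply: eq_bigr => i _.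
  rewrite tensZl tensZr compZr.
  under eq_bigr => j _ do rewrite -scaler_sumr.
  rewrite -scaler_sumr; congr (_ *: _); rewrite ringmE.
  under eq_bigr => j _ do under eq_bigr => k _ do rewrite -slide_term_slide.
  set L := (_ ⊗ _) ∘ sh A (Node _ _) _; set R := _ ⊗ cvL _ _ _.
  set M := idm Y ⊗ (_ ⊗ (_ ∘ _)).
  pose T (m : hom (Y • X i) (Y • X i)) := L ∘ fam22 m _ ∘ M ∘ R.
  have linT : linear T.
    move=> a u v; rewrite /T fam_lin (comp_linr L) (comp_linl M).
    by rewrite (comp_linl R).
  transitivity (T (idm (Y • X i))).
    rewrite /T fam_id compm1 /L /M /R sh_Node -!tensMr !compA.
    congr (_ ∘ _ ∘ _ ∘ _ ∘ _).
    exact: (@sh_tail _ _ A (Leaf Y)).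
  rewrite -(rid (res (Y • X i))) (lin_sum _ _ _ linT); apply: eq_bigr => j _.
  by rewrite (lin_sum _ _ _ linT).
(* For a fixed colour j, the sum over i is the one evaluated by [rot_resolution]. *)
rewrite exchange_big; apply: eq_bigr => j _ /=.
have := slide_term_lin Z (j := j) => lp.
rewrite -(linZ _ _ (lp Y)) -(rot_resolution P simX sim1 schur res) (lin_sum _ _ _ (lp Y)).
apply: eq_bigr => i _; rewrite (lin_sum _ _ _ (lp Y)).
by apply: eq_bigr => k _; rewrite (linZ _ _ (lp Y)).
Qed.
End Slide2.

(** * Loops around morphisms of the center *)

Section Ring.
Variables (F : fieldType) (C : tcat F) (P : duality C).
Implicit Types U A B : zob C.
Local Notation D := (dob P).

Lemma ringm_lin U A X : linear (fun g : hom (zc U) (zc A) => ringm P X g).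
Proof.
move=> a f g; rewrite /ringm.
rewrite (@tens_linl _ _ _ _ _ _ (idm (D X))) (@tens_linr _ _ _ _ _ _ (idm X)).
by rewrite (comp_linr _) !(comp_linl _).
Qed.

Lemma ringm_comp U U' A A' X (z : hom (zc A) (zc A')) (g : hom (zc U) (zc A))
    (w : hom (zc U') (zc U)) :
  zmor_prop (A := A) (B := A') z -> zmor_prop (A := U') (B := U) w ->
  ringm P X (z ∘ g ∘ w) = z ∘ ringm P X g ∘ w.
Proof.
move=> zz zw; apply: (@fam_inj _ _ (Leaf (zc U')) (Leaf (zc A'))) => Z.
rewrite !famL ringmE.
have -> : (z ∘ ringm P X g ∘ w) ⊗ idm Z =
    (z ⊗ idm Z) ∘ (ringm P X g ⊗ idm Z) ∘ (w ⊗ idm Z) by rewrite !tensMl.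
rewrite ringmE.
have -> : (z ∘ g ∘ w) ⊗ idm (D X • Z) =
    (z ⊗ idm _) ∘ (g ⊗ idm _) ∘ (w ⊗ idm _) by rewrite !tensMl.
have e1 : (w ⊗ idm (D X • Z)) ∘ sh U' (Leaf (D X)) Z =
    sh U (Leaf (D X)) Z ∘ (idm (D X) ⊗ (w ⊗ idm Z)) := sh_zmor (Leaf (D X)) Z zw.
have e2 : (z ⊗ idm (X • (D X • Z))) ∘ sh A (Leaf X) (D X • Z) =
    sh A' (Leaf X) (D X • Z) ∘ (idm X ⊗ (z ⊗ idm (D X • Z))).
  exact: sh_zmor (Leaf X) (D X • Z) zz.
rewrite -!tensMr !compA (compE (whisk2 _ e1)) !compA.
rewrite [in RHS]tens_lr -[in RHS]tens_rl.
rewrite [in RHS](compE e2) !compA.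
by rewrite (compE (cvL_nat P X (w ⊗ idm Z))) !compA.
Qed.

(** Once z has moved below both crossings, these form a single crossing of A with X and its dual,
    which naturality along [evr] contracts. An unlinked circle remains beside the strand. *)
Lemma ringm_zmor U A X (z : hom (zc U) (zc A)) : zmor_prop (A := U) (B := A) z ->
  forall Z, ringm P X z ⊗ idm Z = (z ⊗ idm Z) ∘ (evR P X (zc U • Z) ∘ cvL P X (zc U • Z)).
Proof.
move=> zz Z; rewrite ringmE.
have e1 : (z ⊗ idm (D X • Z)) ∘ sh U (Leaf (D X)) Z =
   sh A (Leaf (D X)) Z ∘ (idm (D X) ⊗ (z ⊗ idm Z)) := sh_zmor (Leaf (D X)) Z zz.
have e2 : (idm (zc A) ⊗ evR P X Z) ∘ sh A (Node (Leaf X) (Leaf (D X))) Z =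
    sh A Un Z ∘ evR P X (zc A • Z).
  exact: (@sh_nat _ _ A (Node (Leaf X) (Leaf (D X))) Un (evr P X) Z).
rewrite (compE (whisk2 _ e1)) !compA.
move: e2; rewrite sh_Node sh_Un comp1m /= !compA => ->.
by rewrite evR_nat.
Qed.

End Ring.

Section TensorTrace.
Variables (F : fieldType) (C : tcat F) (P : pivotal C).
Local Notation D := (dob P).

(** A right trace uses [evr] and [coevl], whereas [pv_tens] describes [evl] and [evr] of a product
    by one morphism m. The missing [coevl] is recovered from [evl], because the zigzags determine
    it. *)
Lemma rtrace_tens (X Y : C) (h : hom (X • Y) (X • Y)) Z :
  @fam _ _ Un Un (rtrace P h) Z =
  evR P X Z ∘ (idm X ⊗ (evR P Y (D X • Z))) ∘ fam22 h (D Y • (D X • Z))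
    ∘ (idm X ⊗ cvL P Y (D X • Z)) ∘ cvL P X Z.
Proof.
have [m [ml mr]] := pv_tens P X Y.
pose M Z := @fam _ _ (Node (Leaf (D Y)) (Leaf (D X))) (Leaf (D (X • Y))) m Z.
pose el Z : hom ((D (X • Y)) • (X • (Y • Z))) Z :=
  @fam _ _ (Node (Leaf (D (X • Y))) (Node (Leaf X) (Leaf Y))) Un (evl P (X • Y)) Z.
pose er Z : hom (X • (Y • ((D (X • Y)) • Z))) Z :=
  @fam _ _ (Node (Node (Leaf X) (Leaf Y)) (Leaf (D (X • Y)))) Un (evr P (X • Y)) Z.
pose cl Z : hom Z (X • (Y • ((D (X • Y)) • Z))) :=
  @fam _ _ Un (Node (Node (Leaf X) (Leaf Y)) (Leaf (D (X • Y)))) (coevl P (X • Y)) Z.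
have M_nat Z1 Z2 (k : hom Z1 Z2) :
    M Z2 ∘ (idm (D Y) ⊗ (idm (D X) ⊗ k)) = (idm (D (X • Y)) ⊗ k) ∘ M Z1.
  exact: (@fam_nat _ _ (Node (Leaf (D Y)) (Leaf (D X))) (Leaf (D (X • Y)))).
have mlE Z' : el Z' ∘ M (X • (Y • Z')) = evL P Y Z' ∘ (idm (D Y) ⊗ evL P X (Y • Z')).
  have := congr1 (fun f => @fam _ _ (Node (Node (Leaf (D Y)) (Leaf (D X)))
    (Node (Leaf X) (Leaf Y))) Un f Z') ml.
  by famx.
have mrE Z' : er Z' ∘ (idm X ⊗ (idm Y ⊗ M Z')) = evR P X Z' ∘ (idm X ⊗ evR P Y (D X • Z')).
  have := congr1 (fun f => @fam _ _ (Node (Node (Leaf X) (Leaf Y))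
    (Node (Leaf (D Y)) (Leaf (D X)))) Un f Z') mr.
  by famx.
have zagE Z' : el ((D (X • Y)) • Z') ∘ (idm (D (X • Y)) ⊗ cl Z') = idm ((D (X • Y)) • Z').
  have := congr1 (fun f => @fam _ _ (Leaf (D (X • Y))) (Leaf (D (X • Y))) f Z') (lzag P
    (X • Y)).
  by famx.
(* The nested coevaluation [c2] satisfies one zigzag with [el], and [cl] the other; together they
   force equality. *)
have clE Z' : cl Z' = (idm X ⊗ (idm Y ⊗ M Z')) ∘ (idm X ⊗ cvL P Y (D X • Z')) ∘ cvL P X Z'.
  pose c2 Z0 := (idm X ⊗ (idm Y ⊗ M Z0)) ∘ (idm X ⊗ cvL P Y (D X • Z0)) ∘ cvL P X Z0.
  have zigE Z0 : (idm X ⊗ (idm Y ⊗ el Z0)) ∘ c2 (X • (Y • Z0)) = idm _.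
    rewrite /c2 !compA tensMr (whisk _ (mlE Z0)).
    rewrite -!tensMr.
    rewrite (compE (whisk2 _ (esym (cvL_nat P Y _)))) !compA.
    by rewrite (whisk _ (snakeL P Y _)) tens11 comp1m snakeL.
  have c2_nat Z1 Z2 (k : hom Z1 Z2) : c2 Z2 ∘ k =
     (idm X ⊗ (idm Y ⊗ (idm (D (X • Y)) ⊗ k))) ∘ c2 Z1.
    rewrite /c2 (compE (cvL_nat P X k)) !compA.
    rewrite (compE (whisk2 _ (cvL_nat P Y _))) !compA.
    rewrite (whisk2 _ (whisk2 _ (M_nat _ _ k))).
    by [].
  rewrite -/(c2 Z') -[LHS]comp1m -(zigE ((D (X • Y)) • Z')) -compA c2_nat compA !tensMr
    zagE.
  by rewrite !tens11 comp1m.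
have -> : @fam _ _ Un Un (rtrace P h) Z = er Z ∘ fam22 h ((D (X • Y)) • Z) ∘ cl Z.
  rewrite /rtrace. famx1. famx1. famx1. famx.
  by [].
have h_nat Z1 Z2 (k : hom Z1 Z2) :
    fam22 h Z2 ∘ (idm X ⊗ (idm Y ⊗ k)) = (idm X ⊗ (idm Y ⊗ k)) ∘ fam22 h Z1.
  exact: (@fam_nat _ _ (Node (Leaf X) (Leaf Y)) (Node (Leaf X) (Leaf Y))).
by rewrite clE !compA (compE (h_nat _ _ _)) !compA mrE.
Qed.
End TensorTrace.

(** * Double braidings and the S-matrix *)

Section DoubleBraidRing.
Variables (F : fieldType) (C : bcat F) (P : pivotal C).
Local Notation D := (dob P).

(** With c below and c~ above, the loop is linked with W instead of sliding off: by [dringE] this is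
    the partial trace over X of the double braiding. *)
Definition dring (X W : C) : hom W W :=
  @ringm _ C P (cen W : zob C) (cen_tilde W : zob C) X (idm W).

(** Naturality along [coevl] trades the inverse crossing of W with the dual of X for the crossing
    with X. *)
Lemma dringE X W Z : dring X W ⊗ idm Z =
  (idm W ⊗ evR P X Z) ∘ fam22 (fw (braid X W) ∘ fw (braid W X)) (D X • Z)
    ∘ (idm W ⊗ cvL P X Z).
Proof.
rewrite /dring (@ringmE _ C P (cen W : zob C) (cen_tilde W : zob C)) /= tens11 tens11
  compm1.
have e : (idm X ⊗ sh (cen W) (Leaf (D X)) Z) ∘ cvL P X (W • Z) =
    fh (cen W) (Leaf X) (D X • Z) ∘ (idm W ⊗ cvL P X Z).
  have := @fh_nat _ _ (cen W : zob C) Un (Node (Leaf X) (Leaf (D X))) (coevl P X) Z.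
  rewrite fh_Un compm1 fh_Node => /(congr1 (fun f => (idm X ⊗ sh (cen W) (Leaf (D X)) Z)
    ∘ f)).
  move=> <-; rewrite compA compA tensMr.
  by rewrite (fhK (cen W : zob C) (Leaf (D X)) Z) tens11 comp1m.
rewrite -compA [X in _ ∘ X]e (@famM _ _ _ (Node (Leaf X) (Leaf W))) !compA.
by [].
Qed.

(** As f is a morphism of the center both for c and for c~, it can enter the loop from below and
    leave it above. *)
Lemma dring_nat X W W' (f : hom W W') : f ∘ dring X W = dring X W' ∘ f.
Proof.
have z1 : @zmor_prop _ C (cen W) (cen W') f by move=> Z; rewrite /ze /= braid_nat.
have z2 : @zmor_prop _ C (cen_tilde W) (cen_tilde W') f.
  by move=> Z; rewrite /ze /= (@braid_nat _ (tilde C)).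
transitivity (@ringm _ C P (cen W : zob C) (cen_tilde W' : zob C) X f).
  have := @ringm_comp _ C P (cen W : zob C) (cen W : zob C) (cen_tilde W : zob C)
    (cen_tilde W' : zob C) X f (idm W) (idm W) z2 (@zid_prop _ _ (cen W)).
  by rewrite !compm1.
have := @ringm_comp _ C P (cen W' : zob C) (cen W : zob C) (cen_tilde W' : zob C)
  (cen_tilde W' : zob C) X (idm W') (idm W') f (@zid_prop _ _ (cen_tilde W')) z1.
by rewrite !comp1m.
Qed.

Lemma rtrace_braid X W (Z : C) :
  @fam _ _ Un Un (rtrace P (fw (braid X W) ∘ fw (braid W X))) Z =
  evR P W Z ∘ (dring X W ⊗ idm (D W • Z)) ∘ cvL P W Z.
Proof. by rewrite rtrace_tens dringE !compA. Qed.

End DoubleBraidRing.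

Lemma inhabited_elim (T : Type) : inhabited T -> T.
Proof.
by move=> i; suff /cid [x _] : exists x : T, True by []; case: i => x; exists x.
Qed.

(** * Transparent objects and the Kirby loop *)

Section ModularData.
Variables (F : fieldType) (C : bcat F) (P : pivotal C) (n : nat) (X : 'I_n -> C).
Local Notation D := (dob P).
Hypothesis ssC : semisimple C.
Hypothesis sphC : spherical P.
Hypothesis repX : simple_reps X.
Hypothesis unitS : Smatrix P X \in unitmx.

Let sim1 : simple (tunit : C) := ss_unit ssC.
Let simX i : simple (X i). Proof. by have [] := repX. Qed.

Definition dring_coef (i j : 'I_n) : F := coef (dring P (X j) (X i)).

Lemma dring_simple i j : dring P (X j) (X i) = dring_coef i j *: idm (X i).
Proof. exact: coefE. Qed.

(** Loops close with [evr] and [coevl], while [qdim] is a left trace; sphericity identifies the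
    two. *)
Lemma evR_cvL Y Z : evR P Y Z ∘ cvL P Y Z = qdim P Y *: idm Z.
Proof.
have e : evr P Y ∘ coevl P Y = qdim P Y *: idm tunit.
  by rewrite /qdim sphC -(coefE _ sim1) /rtrace tens11 compm1.
rewrite /evR /cvL -(@famM _ _ Un (Node (Leaf Y) (Leaf (D Y))) Un) e famZ.
by rewrite fam_id.
Qed.

(** Closing the strand [X j] first turns the double braiding into the loop [dring], a scalar on
    [X i]; closing [X i] then gives its dimension. *)
Lemma SmatrixE i j : Smatrix P X i j = dring_coef i j * qdim P (X i).
Proof.
rewrite mxE /scal -/(coef _) sphC.
set f := rtrace P _; suff -> : f = (dring_coef i j * qdim P (X i)) *: idm tunit.
  by rewrite coefZ.
apply: (@fam_inj _ _ Un Un) => Z; rewrite /f rtrace_braid dring_simple tensZl.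
by rewrite compZr compZl tens11 compm1 evR_cvL scalerA famZ fam_id.
Qed.

Lemma Smatrix_rows i k a b : i != k -> a != 0 ->
  (forall j, a * Smatrix P X i j = b * Smatrix P X k j) -> False.
Proof.
move=> ne a0 e.
pose v : 'rV[F]_n := a *: delta_mx 0 i - b *: delta_mx 0 k.
have v0 : v *m Smatrix P X = 0.
  rewrite mulmxBl -!scalemxAl -!rowE; apply/rowP => j.
  by rewrite mxE [X in _ + X]mxE ![(_ *: row _ _) _ _]mxE ![row _ _ _ _]mxE e subrr mxE.
have : v 0 i = 0 by rewrite -[v](mulmxK unitS) v0 mul0mx mxE.
rewrite !mxE !eqxx (negbTE ne) mulr0 oppr0 addr0 mulr1 => /eqP.
by rewrite (negbTE a0).
Qed.

Lemma qdim_neq0 i : qdim P (X i) != 0.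
Proof.
apply/eqP => d0.
have : (row i (Smatrix P X)) *m invmx (Smatrix P X) = 0.
  suff -> : row i (Smatrix P X) = 0 by rewrite mul0mx.
  by apply/rowP => j; rewrite mxE SmatrixE d0 mulr0 mxE.
rewrite rowE -mulmxA mulmxV // mulmx1 => /rowP /(_ i).
by rewrite !mxE !eqxx => /eqP; rewrite oner_eq0.
Qed.

(* simple only says End (X i) = F; a nonzero f would intertwine the loops X j and
   make two rows of S proportional. *)
Lemma schur i k (f : hom (X i) (X k)) : i != k -> f = 0.
Proof.
move=> ne; apply: contrapT => /eqP f0.
apply: (Smatrix_rows ne (qdim_neq0 k) (b := qdim P (X i))) => j.
have : dring_coef i j *: f = dring_coef k j *: f.
  have := dring_nat P (X j) f; rewrite !dring_simple compZr compZl compm1 comp1m.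
  by [].
move/eqP; rewrite -subr_eq0 -scalerBl scaler_eq0 (negbTE f0) orbF subr_eq0.
by move=> /eqP e; rewrite !SmatrixE e mulrCA [in RHS]mulrCA; congr (_ * _); rewrite mulrC.
Qed.

Lemma resolution W : resol X W.
Proof.
apply: inhabited_elim.
have [m [Y [simY [p [q [_ _ e]]]]]] := ss_simple ssC W.
have [_ uniqX compX] := repX.
have t k : {i & isom (Y k) (X i)}.
  have [i ti] := cid (compX _ (simY k)); exists i.
  exact: inhabited_elim.
pose V j : vectType F := hom (X j) W; pose V' j : vectType F := hom W (X j).
(* All m summands serve as multiplicity index for every j; [dcast] makes the k-th one zero unless
   its simple representative is [X j]. *)
exists; apply: (@Resol _ _ _ _ _ m
  (fun j k => dcast (V := V) j (p k ∘ bw (projT2 (t k))))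
  (fun j k => dcast (V := V') j (fw (projT2 (t k)) ∘ q k))).
rewrite exchange_big -e; apply: eq_bigr => k _ /=.
rewrite (bigD1 (projT1 (t k))) //= !dcast_id big1 ?addr0 => [|j ne].
  by rewrite compA (compE (fwK _)) compm1.
by rewrite dcast_neq 1?eq_sym // comp0m.
Qed.

(** Equality of the half braidings c and c~ on W means that W has trivial double braiding with every
    object. *)
Definition transparent (W : C) : Prop :=
  @zmor_prop _ C (cen W) (cen_tilde W) (idm W).

Lemma dring_transparent Y W : transparent W -> dring P Y W = qdim P Y *: idm W.
Proof.
move=> tW; apply: (@fam_inj _ _ (Leaf W) (Leaf W)) => Z.
rewrite famL (ringm_zmor P Y tW) evR_cvL compZr compm1.
by rewrite famZ fam_id tens11.
Qed.

(** At a copy of the unit a half braiding is forced by naturality and [hb_unit]; this applies to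
    [cen Z] and [cen_tilde Z] at W. *)
Lemma transparent_unit W : inhabited (isom W tunit) -> transparent W.
Proof.
case=> t.
have e Z : fw (braid Z W) = bw (braid W Z).
  apply: (compKl (i := tensi (idi Z) (isom_inv t))) => /=.
  have e1 := hb_nat (zhb (cen Z)) (bw t).
  have e2 := hb_nat (zhb (cen_tilde Z)) (bw t).
  have e3 := hb_unit (zhb (cen Z)).
  have e4 := hb_unit (zhb (cen_tilde Z)).
  by move: e1 e2 e3 e4 => /= -> -> -> ->.
move=> Z; rewrite /ze /= !tens11 comp1m compm1.
by apply: (compKr (i := braid Z W)); rewrite bwK e fwK.
Qed.

(** A loop in the Kirby colour linked with W. It unfolds to the average of the identity from [cen W]
    to [cen_tilde W], which is how [kirby_zmor] reads it. *)
Definition kirby (W : C) : hom W W := \sum_j qdim P (X j) *: dring P (X j) W.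
Definition kirby_coef i : F := \sum_j qdim P (X j) * dring_coef i j.

Lemma kirby_nat W W' (f : hom W W') : f ∘ kirby W = kirby W' ∘ f.
Proof.
rewrite comp_sumr comp_suml; apply: eq_bigr => j _.
by rewrite compZr compZl dring_nat.
Qed.

Lemma kirby_simple i : kirby (X i) = kirby_coef i *: idm (X i).
Proof.
by rewrite /kirby /kirby_coef scaler_suml; apply: eq_bigr => j _;
  rewrite dring_simple scalerA.
Qed.

Lemma kirby_zmor W : @zmor_prop _ C (cen W) (cen_tilde W) (kirby W).
Proof.
exact: (@avg_zmor _ C P n X simX sim1 schur resolution (cen W) (cen_tilde W)).
Qed.

Lemma kirby_coef_transparent i : kirby_coef i != 0 -> transparent (X i).
Proof.
move=> r0; have [_ L] := @zmor_submod _ C (cen (X i)) (cen_tilde (X i)).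
have := L (kirby_coef i)^-1 _ _ (kirby_zmor (X i)) (zmor_submod _ _).1.
by rewrite addr0 kirby_simple scalerA mulVf // scale1r.
Qed.

Lemma Smatrix_transparent i : transparent (X i) ->
  forall j, Smatrix P X i j = qdim P (X j) * qdim P (X i).
Proof.
by move=> tX j; rewrite SmatrixE /dring_coef dring_transparent // coefZ.
Qed.

Lemma unit_rep : exists i, inhabited (isom (X i) tunit).
Proof.
have [_ _ /(_ _ sim1) [i [t]]] := repX.
by exists i; exists; apply: isom_inv t.
Qed.

(** The rows of S at [X i] and at the unit are both multiples of the vector of dimensions, but
    distinct rows of an invertible matrix are not proportional. *)
Lemma transparent_is_unit i : transparent (X i) -> inhabited (isom (X i) tunit).
Proof.
move=> tX; have [i0 t0] := unit_rep.
have [->//|ne] := eqVneq i i0; exfalso.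
apply: (Smatrix_rows ne (qdim_neq0 i0) (b := qdim P (X i))) => j.
rewrite !Smatrix_transparent //; first by rewrite mulrCA [LHS]mulrA mulrC.
exact: transparent_unit.
Qed.

Definition gdim : F := \sum_j qdim P (X j) ^+ 2.

Lemma kirby_coef_unit i : inhabited (isom (X i) tunit) -> kirby_coef i = gdim.
Proof.
move=> t; apply: eq_bigr => j _.
by rewrite /dring_coef dring_transparent ?coefZ //; exact: transparent_unit.
Qed.

Lemma kirby_coef_nonunit i : ~ inhabited (isom (X i) tunit) -> kirby_coef i = 0.
Proof.
move=> t; apply/eqP; apply/negPn/negP => r0.
by apply: t; apply/transparent_is_unit/kirby_coef_transparent.
Qed.

(** S sends the vector of dimensions to the products of [qdim P (X i)] and [kirby_coef i]. If [gdim]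
    vanished, so would all of these, and then the dimensions themselves. *)
Lemma gdim_neq0 : gdim != 0.
Proof.
apply/eqP => D0; have r0 i : kirby_coef i = 0.
  have [t|t] := pselect (inhabited (isom (X i) tunit)).
    by rewrite kirby_coef_unit.
  exact: kirby_coef_nonunit.
have [i0 _] := unit_rep.
have : Smatrix P X *m (\col_j qdim P (X j)) = 0.
  apply/colP => i; rewrite !mxE.
  transitivity (qdim P (X i) * kirby_coef i); last by rewrite r0 mulr0.
  rewrite /kirby_coef mulr_sumr; apply: eq_bigr => j _.
  by rewrite SmatrixE mxE mulrAC mulrC [dring_coef _ _ * _]mulrC.
move/(congr1 (mulmx (invmx (Smatrix P X)))); rewrite mulmxA mulVmx // mul1mx mulmx0.
move=> /colP /(_ i0); rewrite !mxE => /eqP.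
by rewrite (negbTE (qdim_neq0 i0)).
Qed.

Lemma kirby_factor W : exists (m : nat) (u : 'I_m -> hom tunit W) (v : 'I_m -> hom W tunit),
  kirby W = \sum_k (u k ∘ v k).
Proof.
have [i0 [t]] := unit_rep; pose r := resolution W.
(* The loop kills all summands of W except the copies of the unit, on which it acts by [gdim]. *)
exists (rnum r), (fun k => gdim *: (rinj r i0 k ∘ bw t)), (fun k => fw t ∘ rprj r i0 k).
rewrite -[kirby W]compm1 -(rid r) comp_sumr (bigD1 i0) //= [X in _ + X]big1 ?addr0.
  rewrite comp_sumr; apply: eq_bigr => k _.
  rewrite compA -kirby_nat kirby_simple kirby_coef_unit; last by exists.
  by rewrite compZr compm1 !compZl compA (compE (fwK _)) compm1.
move=> j ne; rewrite comp_sumr big1 // => k _.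
rewrite compA -kirby_nat kirby_simple kirby_coef_nonunit ?scale0r ?compm0 ?comp0m //.
case=> t'; have [_ uniqX _] := repX; move/eqP: ne; apply; apply: uniqX.
by exists; apply: compi (isom_inv t) t'.
Qed.

End ModularData.

(** * Fullness and faithfulness on products *)

Section Crossing.
Variables (F : fieldType) (C : bcat F).
Implicit Types a b : tree C.

Definition bx a b Z : hom (act a (act b Z)) (act b (act a Z)) :=
  @fam _ _ (Node a b) (Node b a) (fw (braid (tobj a) (tobj b))) Z.
Definition bi a b Z : hom (act b (act a Z)) (act a (act b Z)) :=
  @fam _ _ (Node b a) (Node a b) (bw (braid (tobj a) (tobj b))) Z.

Lemma bxK a b Z : bi a b Z ∘ bx a b Z = idm (act a (act b Z)).
Proof.
rewrite /bx /bi -(@famM _ _ (Node a b) (Node b a) (Node a b)) fwK.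
exact: (@fam_id _ _ (Node a b)).
Qed.
Lemma biK a b Z : bx a b Z ∘ bi a b Z = idm (act b (act a Z)).
Proof.
rewrite /bx /bi -(@famM _ _ (Node b a) (Node a b) (Node b a)) bwK.
exact: (@fam_id _ _ (Node b a)).
Qed.
Definition bxi a b Z := Isom (bxK a b Z) (biK a b Z).

Lemma bx_nat a a' b b' (f : hom (tobj a) (tobj a')) (g : hom (tobj b) (tobj b')) Z :
  bx a' b' Z ∘ (fam f (act b' Z) ∘ actm a (fam g Z)) =
  fam g (act a' Z) ∘ actm b (fam f Z) ∘ bx a b Z.
Proof.
have := congr1 (fun f => @fam _ _ (Node a b) (Node b' a') f Z) (braid_nat f g).
rewrite (@famM _ _ _ (Node a' b')) (@famM _ _ _ (Node b a)).
by rewrite !famT.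
Qed.

Lemma bx_natl a a' b (f : hom (tobj a) (tobj a')) Z :
  bx a' b Z ∘ fam f (act b Z) = actm b (fam f Z) ∘ bx a b Z.
Proof. by have := bx_nat f (idm (tobj b)) Z; rewrite !fam_id actm1 compm1 comp1m. Qed.

Lemma bx_natr a b b' (g : hom (tobj b) (tobj b')) Z :
  bx a b' Z ∘ actm a (fam g Z) = fam g (act a Z) ∘ bx a b Z.
Proof. by have := bx_nat (idm (tobj a)) g Z; rewrite !fam_id actm1 compm1 comp1m. Qed.

Lemma bx_tail a b Z Z' (k : hom Z Z') :
  bx a b Z' ∘ actm a (actm b k) = actm b (actm a k) ∘ bx a b Z.
Proof. exact: (@fam_nat _ _ (Node a b) (Node b a)). Qed.
Lemma bi_tail a b Z Z' (k : hom Z Z') :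
  bi a b Z' ∘ actm b (actm a k) = actm a (actm b k) ∘ bi a b Z.
Proof. exact: (@fam_nat _ _ (Node b a) (Node a b)). Qed.

Lemma bx_Nodel a a' b Z :
  bx (Node a a') b Z = bx a b (act a' Z) ∘ actm a (bx a' b Z).
Proof. by rewrite /bx /= braid_hexl; famx. Qed.

Lemma bx_Noder a b b' Z :
  bx a (Node b b') Z = actm b (bx a b' Z) ∘ bx a b (act b' Z).
Proof. by rewrite /bx /= braid_hexr; famx. Qed.

Lemma bx_Unl b Z : bx Un b Z = idm (act b Z).
Proof.
have e := hb_unit (zhb (cen_tilde (tobj b))).
have e2 : bi Un b Z = idm (act b Z) by rewrite /bi; move: e => /= ->; famx.
by have := biK Un b Z; rewrite e2 => e3; exact: etrans (esym (compm1 _)) e3.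
Qed.

Lemma bx_Unr a Z : bx a Un Z = idm (act a Z).
Proof. by have := hb_unit (zhb (cen (tobj a))); rewrite /bx /= => ->; famx. Qed.

End Crossing.

Notation cross V W Z := (bx (Leaf V) (Leaf W) Z).
Notation crossi V W Z := (bi (Leaf V) (Leaf W) Z).

Section LeafCrossing.
Variables (F : fieldType) (C : bcat F) (P : duality C).
Implicit Types V W Z : C.

Lemma cK V W Z : crossi V W Z ∘ cross V W Z = idm (V • (W • Z)).
Proof. exact: bxK. Qed.
Lemma ciK V W Z : cross V W Z ∘ crossi V W Z = idm (W • (V • Z)).
Proof. exact: biK. Qed.
Lemma c_tail V W Z Z' (k : hom Z Z') :
  cross V W Z' ∘ (idm V ⊗ (idm W ⊗ k)) = (idm W ⊗ (idm V ⊗ k)) ∘ cross V W Z.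
Proof. exact: (@bx_tail _ _ (Leaf V) (Leaf W)). Qed.
Lemma ci_tail V W Z Z' (k : hom Z Z') :
  crossi V W Z' ∘ (idm W ⊗ (idm V ⊗ k)) = (idm V ⊗ (idm W ⊗ k)) ∘ crossi V W Z.
Proof. exact: (@bi_tail _ _ (Leaf V) (Leaf W)). Qed.

(** The evaluated pair crosses W like the unit, that is trivially, so the crossing of W with the
    dual of V is the inverse of the one with V. *)
Lemma c_evL V W Z :
  (idm W ⊗ evL P V Z) ∘ cross (dob P V) W (V • Z) =
  evL P V (W • Z) ∘ (idm (dob P V) ⊗ crossi V W Z).
Proof.
have := @bx_natl _ _ (Node (Leaf (dob P V)) (Leaf V)) Un (Leaf W) (evl P V) Z.
rewrite bx_Unl comp1m bx_Nodel /= -/(evL P V _) => ->.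
by rewrite compA (compE (whisk _ (ciK V W Z))) tens11 compm1.
Qed.

Lemma c_cvL V W Z :
  cross W V (dob P V • Z) ∘ (idm W ⊗ cvL P V Z) =
  (idm V ⊗ crossi W (dob P V) Z) ∘ cvL P V (W • Z).
Proof.
have := @bx_natr _ _ (Leaf W) Un (Node (Leaf V) (Leaf (dob P V))) (coevl P V) Z.
rewrite bx_Unr compm1 bx_Noder => e.
have {}e : (idm V ⊗ cross W (dob P V) Z) ∘ cross W V (dob P V • Z) ∘ (idm W ⊗ cvL P V Z) =
  cvL P V (W • Z) by exact: e.
by rewrite -e !compA (whisk _ (cK W (dob P V) Z)) tens11 comp1m.
Qed.
End LeafCrossing.

Section Bend.
Variables (F : fieldType) (C : bcat F) (P : pivotal C).
Local Notation D := (dob P).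
Variables (X X' Y Y' : C) (t : hom (X • Y) (X' • Y')).

Definition bend : hom (D X' • X) (Y' • D Y) :=
  λ (Y' • D Y) ∘ (evl P X' ⊗ idm (Y' • D Y)) ∘ α' (D X') X' (Y' • D Y)
    ∘ (idm (D X') ⊗ (α X' Y' (D Y) ∘ (t ⊗ idm (D Y)) ∘ α' X Y (D Y)
                      ∘ (idm X ⊗ coevl P Y) ∘ ρ' X)).

Lemma bendE Z : fam22 bend Z =
  evL P X' (Y' • (D Y • Z)) ∘ (idm (D X') ⊗ (fam22 t (D Y • Z) ∘ (idm X ⊗ cvL P Y Z))).
Proof. by rewrite /bend; famx. Qed.

Lemma unbend Z : fam22 t Z =
  (idm X' ⊗ (idm Y' ⊗ evL P Y Z)) ∘ (idm X' ⊗ fam22 bend (Y • Z))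
    ∘ cvL P X' (X • (Y • Z)).
Proof.
rewrite bendE -!tensMr !compA.
rewrite (whisk2 _ (esym (evL_nat P X' (idm Y' ⊗ evL P Y Z)))).
have T_nat Z1 Z2 (k : hom Z1 Z2) :
    fam22 t Z2 ∘ (idm X ⊗ (idm Y ⊗ k)) = (idm X' ⊗ (idm Y' ⊗ k)) ∘ fam22 t Z1.
  exact: (@fam_nat _ _ (Node (Leaf X) (Leaf Y)) (Node (Leaf X') (Leaf Y'))).
rewrite (compE (whisk2 _ (whisk2 _ (esym (T_nat _ _ (evL P Y Z)))))) !compA.
rewrite (compE (whisk _ (whisk _ (whisk _ (snakeL P Y Z))))) !tens11 compm1.
by rewrite (compE (esym (cvL_nat P X' (fam22 t Z)))) !compA snakeL comp1m.
Qed.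

Hypothesis zt : @zmor_prop _ C (ztens (cen X) (cen_tilde Y)) (ztens (cen X') (cen_tilde
  Y')) t.

Lemma zmor_fam W Z :
  (idm W ⊗ fam22 t Z) ∘ (cross X W (Y • Z) ∘ (idm X ⊗ crossi W Y Z)) =
  cross X' W (Y' • Z) ∘ (idm X' ⊗ crossi W Y' Z) ∘ fam22 t (W • Z).
Proof.
have := congr1 (fun f => @fam _ _ (Node (Node (Leaf X) (Leaf Y)) (Leaf W))
  (Node (Leaf W) (Node (Leaf X') (Leaf Y'))) f Z) (zt W).
rewrite !ze_tens /ze /=; famx.
by [].
Qed.

(** Bending a strand by [evl] or [coevl] inverts its crossing with W and also moves it to the other
    end of t. So the dual of X' joins X on the side of c, and the dual of Y joins Y' on the side of
    c~. *)
Lemma bend_zmor : @zmor_prop _ C (cen (D X' • X)) (cen_tilde (Y' • D Y)) bend.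
Proof.
move=> W; apply: (@fam_inj _ _ (Node (Node (Leaf (D X')) (Leaf X)) (Leaf W))
  (Node (Leaf W) (Node (Leaf Y') (Leaf (D Y))))) => Z.
set DX := D X'; set DY := D Y.
rewrite (@famM _ _ _ (Node (Leaf W) (Node (Leaf DX) (Leaf X)))).
rewrite (@famM _ _ _ (Node (Node (Leaf Y') (Leaf DY)) (Leaf W))).
rewrite !famT !fam_id !actm1 compm1 comp1m.
(* The inverse crossings of the target move to the other side; it remains to see that W can be
   pulled around [bend]. *)
apply: (compKr (i := bxi (Leaf W) (Node (Leaf Y') (Leaf DY)) Z)).
rewrite [RHS]compA [X in _ = X ∘ _](biK (Leaf W) (Node (Leaf Y') (Leaf DY)) Z) comp1m.
transitivity (bx (Leaf W) (Node (Leaf Y') (Leaf DY)) Z ∘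
  ((idm W ⊗ fam22 bend Z) ∘ bx (Node (Leaf DX) (Leaf X)) (Leaf W) Z)); first by [].
transitivity (fam22 bend (W • Z)); last by [].
rewrite bx_Noder bx_Nodel !bendE /= -!tensMr !compA.
rewrite (compE (esym (c_tail DX W (idm X ⊗ cvL P Y Z)))) !compA.
rewrite (compE (esym (c_tail DX W (fam22 t (DY • Z))))) !compA.
rewrite (compE (c_evL P X' W _)) !compA.
rewrite -(evL_nat P X' (_ ∘ _)).
rewrite -!compA !tensMr; congr (_ ∘ (idm DX ⊗ _)); rewrite !compA.
have T_nat Z1 Z2 (k : hom Z1 Z2) :
    fam22 t Z2 ∘ (idm X ⊗ (idm Y ⊗ k)) = (idm X' ⊗ (idm Y' ⊗ k)) ∘ fam22 t Z1.
  exact: (@fam_nat _ _ (Node (Leaf X) (Leaf Y)) (Node (Leaf X') (Leaf Y'))).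
have zT : (idm W ⊗ fam22 t (DY • Z)) ∘ cross X W (Y • (DY • Z)) =
    cross X' W (Y' • (DY • Z)) ∘ (idm X' ⊗ crossi W Y' (DY • Z)) ∘ fam22 t (W • (DY • Z))
      ∘ (idm X ⊗ cross W Y (DY • Z)).
  rewrite -zmor_fam !compA -!compA tensMr.
  by rewrite (cK W Y (DY • Z)) tens11 compm1.
rewrite -(compA _ (_ ⊗ (_ ⊗ cvL _ _ _))) -(c_tail X W (cvL P Y Z)) !compA.
rewrite (compE zT) !compA (compE (cK X' W _)) compm1 tensMr.
rewrite (compE (ciK W Y' _)) compm1 -/DY.
rewrite (compE (whisk2 _ (c_cvL P Y W Z))) !compA.
rewrite (compE (T_nat _ _ _)) !compA (whisk _ (whisk _ (ciK W DY Z))).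
by rewrite !tens11 comp1m.
Qed.

End Bend.

(** * Morphisms between products in the center *)

Section FullFaithful.
Variables (F : fieldType) (C : bcat F) (P : pivotal C) (n : nat) (X : 'I_n -> C).
Local Notation D := (dob P).
Hypothesis ssC : semisimple C.
Hypothesis sphC : spherical P.
Hypothesis repX : simple_reps X.
Hypothesis unitS : Smatrix P X \in unitmx.

(** Naturality of c~ moves the upper crossing of each loop above b, and [ringm_zmor] lets the loop
    slide off. The circle [X j], times its weight, contributes a squared dimension. *)
Lemma kirby_absorb U V (b : hom U V) :
  @zmor_prop _ C (cen U) (cen_tilde V) b -> b ∘ kirby P X U = gdim P X *: b.
Proof.
move=> zb; rewrite /kirby comp_sumr /gdim scaler_suml; apply: eq_bigr => j _.
rewrite compZr expr2 -scalerA; congr (_ *: _).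
have z2 : @zmor_prop _ C (cen_tilde U) (cen_tilde V) b.
  by move=> Z; rewrite /ze /= (@braid_nat _ (tilde C)).
transitivity (@ringm _ C P (cen U : zob C) (cen_tilde V : zob C) (X j) b).
  have := @ringm_comp _ C P (cen U : zob C) (cen U : zob C) (cen_tilde U : zob C)
    (cen_tilde V : zob C) (X j) b (idm U) (idm U) z2 (@zid_prop _ _ (cen U)).
  by rewrite !compm1 => ->.
apply: (@fam_inj _ _ (Leaf U) (Leaf V)) => Z.
rewrite famL (ringm_zmor P (X j) zb) (evR_cvL ssC sphC) compZr compm1.
by rewrite famZ famL.
Qed.

Lemma cen_tens_full A A' B B' (t : hom (A • B) (A' • B')) :
  @zmor_prop _ C (ztens (cen A) (cen_tilde B)) (ztens (cen A') (cen_tilde B')) t ->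
  exists (m : nat) (f : 'I_m -> hom A A') (g : 'I_m -> hom B B'),
    t = \sum_k (f k ⊗ g k).
Proof.
move=> zt; have [m [u [v e]]] := kirby_factor ssC sphC repX unitS (D A' • A).
(* The loop below [bend P t] multiplies it by [gdim] and also factors through the unit; dividing by
   [gdim] factors [bend P t] itself. *)
pose p k : hom tunit (B' • D B) := (gdim P X)^-1 *: (bend P t ∘ u k).
have ebend : bend P t = \sum_k (p k ∘ v k).
  have := kirby_absorb (bend_zmor P zt); rewrite e comp_sumr.
  move=> /(congr1 (fun f => (gdim P X)^-1 *: f)).
  rewrite scalerA mulVf ?gdim_neq0 // scale1r => <-.
  rewrite scaler_sumr; apply: eq_bigr => k _.
  by rewrite /p compZl compA.
(* The two halves are unbent separately: [v k] by a cup at A', [p k] by a cap at B. *)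
exists m, (fun k => ρ A' ∘ (idm A' ⊗ v k) ∘ α A' (D A') A ∘ (coevl P A' ⊗ idm A) ∘ λ' A),
  (fun k => ρ B' ∘ (idm B' ⊗ evl P B) ∘ α B' (D B) B ∘ (p k ⊗ idm B) ∘ λ' B).
apply: (@fam_inj _ _ (Node (Leaf A) (Leaf B)) (Node (Leaf A') (Leaf B'))) => Z.
rewrite fam_sum (unbend P) ebend fam_sum tens_sumr comp_sumr comp_suml.
apply: eq_bigr => k _; rewrite (@famM _ _ _ Un).
famx; rewrite -/(cvL P A' _) -/(evL P B _).
pose q := (idm B' ⊗ evL P B Z) ∘ @fam _ _ Un (Node (Leaf B') (Leaf (D B))) (p k) (B • Z).
rewrite -/q.
have v_nat : @fam _ _ (Node (Leaf (D A')) (Leaf A)) Un (v k) (B' • Z)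
    ∘ (idm (D A') ⊗ (idm A ⊗ q)) =
  q ∘ @fam _ _ (Node (Leaf (D A')) (Leaf A)) Un (v k) (B • Z).
  exact: (@fam_nat _ _ (Node (Leaf (D A')) (Leaf A)) Un).
rewrite (compE (cvL_nat P A' _)) !compA (whisk _ v_nat).
by rewrite /q -!tensMr !compA.
Qed.

Lemma tens_simple_inj A A' j (w : hom A A') : w ⊗ idm (X j) = 0 -> w = 0.
Proof.
move=> w0; suff /eqP : qdim P (X j) *: w = 0.
  by rewrite scaler_eq0 (negbTE (qdim_neq0 ssC sphC repX unitS j)) => /eqP.
apply: (@fam_inj _ _ (Leaf A) (Leaf A')) => Z.
rewrite famZ famL -[_ ⊗ _]compm1 -tens11 -compZr -tensZr -(evR_cvL ssC sphC).
rewrite -tensMr compA tens_lr -tens_rl.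
have : fam22 (w ⊗ idm (X j)) (D (X j) • Z) = 0.
  by rewrite w0 (lin0 (@fam_lin _ _ _ _ _)).
rewrite famT !fam_id actm1 compm1 famL /= -compA => ->.
by rewrite comp0m compm0 famL tens0m.
Qed.

(* The isotypic components of Y and Y' separate the morphisms Y -> Y', and closing
   the strand X j turns a tensor product into a scalar multiple of its left factor. *)
Lemma tens_faithful A A' B B' (t : tprod (hom A A') (hom B B')) :
  tlift (@tensm _ C A A' B B') t = 0 -> t = 0.
Proof.
move=> t0.
pose y (m : 'I_(\dim {:hom A A'})) : hom B B' := \sum_l t m l *: (vbasis {:hom B B'})`_l.
have ey : \sum_(m < \dim {:hom A A'}) ((vbasis {:hom A A'})`_m ⊗ y m) = 0.
  rewrite -[RHS]t0 /tlift; apply: eq_bigr => m _.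
  by rewrite tens_sumr; apply: eq_bigr => l _; rewrite tensZr.
suff y0 (m : 'I_(\dim {:hom A A'})) : y m = 0.
  apply/matrixP => m l; rewrite mxE.
  have /freeP fr := basis_free (vbasisP {:hom B B'}).
  exact: (fr (fun l => t m l) (y0 m)).
pose r := resolution ssC repX B; pose r' := resolution ssC repX B'.
have simX i : simple (X i) by have [] := repX.
(* The matrix entries of f between copies of [X j]; entries between different simple objects vanish
   by [schur]. *)
pose c j k k' f := coef (rprj r' j k' ∘ f ∘ rinj r j k).
have c0 j k k' : c j k k' (y m) = 0.
  have e : \sum_(m < \dim {:hom A A'}) c j k k' (y m) *: (vbasis {:hom A A'})`_m = 0.
    apply: (@tens_simple_inj _ _ j).
    transitivity ((idm A' ⊗ rprj r' j k') ∘ \sum_(m < \dim {:hom A A'}) ((vbasis {:hom A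
      A'})`_m ⊗ y m)
      ∘ (idm A ⊗ rinj r j k)); last by rewrite ey compm0 comp0m.
    rewrite tens_suml comp_sumr comp_suml; apply: eq_bigr => m' _.
    rewrite -!tensM comp1m compm1 (coefE (rprj r' j k' ∘ _ ∘ _) (simX j)).
    by rewrite tensZl tensZr.
  have /freeP fr := basis_free (vbasisP {:hom A A'}).
  exact: (fr (fun m => c j k k' (y m)) e m).
rewrite -[y m]comp1m -(rid r') -[X in _ ∘ X]compm1 -(rid r).
rewrite comp_suml big1 // => j _; rewrite comp_suml big1 // => k' _.
rewrite 2!comp_sumr big1 // => i _; rewrite 2!comp_sumr big1 // => k _.
have -> : rinj r' j k' ∘ rprj r' j k' ∘ (y m ∘ (rinj r i k ∘ rprj r i k)) =
  rinj r' j k' ∘ (rprj r' j k' ∘ y m ∘ rinj r i k) ∘ rprj r i k by rewrite !compA.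
have [<-|ne] := eqVneq i j.
  rewrite (coefE (_ ∘ _ ∘ rinj r i k) (simX i)) -/(c i k k' (y m)) c0 scale0r.
  by rewrite compm0 comp0m.
by rewrite (schur ssC sphC repX unitS (_ ∘ rinj r i k) ne) ?compm0 ?comp0m.
Qed.

End FullFaithful.

(** * Finite direct sums *)

(** A functor out of the completion needs chosen direct sums as data, over the same index types as
    the objects of [addc]. *)
Record sums (F : fieldType) (E : lcat F) := Sums {
  sm : forall (I : finType), (I -> E) -> E;
  sin : forall (I : finType) (Y : I -> E) i, hom (Y i) (sm Y);
  spr : forall (I : finType) (Y : I -> E) i, hom (sm Y) (Y i);
  spr_sin : forall (I : finType) (Y : I -> E) i, spr Y i ∘ sin Y i = idm (Y i);
  spr_sin0 : forall (I : finType) (Y : I -> E) i j, i != j -> spr Y i ∘ sin Y j = 0;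
  sin_spr : forall (I : finType) (Y : I -> E), \sum_i (sin Y i ∘ spr Y i) = idm (sm Y)
}.

Section Additive.
Variables (F : fieldType) (B E : bcat F) (S : sums E) (K0 : bfunctor B E).
Local Notation aB := (addc B).

Definition kob (A : aB) : E := sm S (fun i : aix A => K0 (acomp i)).
Definition kin (A : aB) (i : aix A) : hom (K0 (acomp i)) (kob A) := sin S _ i.
Definition kpr (A : aB) (i : aix A) : hom (kob A) (K0 (acomp i)) := spr S _ i.

Lemma kprin (A : aB) (i : aix A) : kpr i ∘ kin i = idm _.
Proof. exact: (spr_sin S (fun i : aix A => K0 (acomp i))). Qed.
Lemma kprin0 (A : aB) (i j : aix A) : i != j -> kpr i ∘ kin j = 0.
Proof. exact: (spr_sin0 S). Qed.
Lemma kinpr (A : aB) : \sum_(i : aix A) (kin i ∘ kpr i) = idm (kob A).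
Proof. exact: (sin_spr S). Qed.

Lemma kinP (A : aB) (Z : E) (f g : hom (kob A) Z) :
  (forall i : aix A, f ∘ kin i = g ∘ kin i) -> f = g.
Proof.
move=> e; rewrite -[f]compm1 -[g]compm1 -kinpr !comp_sumr.
by apply: eq_bigr => i _; rewrite !compA e.
Qed.

Lemma kprP (A : aB) (Z : E) (f g : hom Z (kob A)) :
  (forall i : aix A, kpr i ∘ f = kpr i ∘ g) -> f = g.
Proof.
move=> e; rewrite -[f]comp1m -[g]comp1m -kinpr !comp_suml.
by apply: eq_bigr => i _; rewrite -!compA e.
Qed.

Lemma kinP2 (A A' : aB) (Z : E) (f g : hom (kob A • kob A') Z) :
  (forall (i : aix A) (j : aix A'), f ∘ (kin i ⊗ kin j) = g ∘ (kin i ⊗ kin j)) ->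
  f = g.
Proof.
move=> e; rewrite -[f]compm1 -[g]compm1 -tens11 -!kinpr !tens_suml !comp_sumr.
apply: eq_bigr => i _; rewrite !tens_sumr !comp_sumr; apply: eq_bigr => j _.
by rewrite tensM !compA e.
Qed.

Lemma kinP3 (A A' A'' : aB) (Z : E) (f g : hom (kob A • kob A' • kob A'') Z) :
  (forall (i : aix A) (j : aix A') (k : aix A''),
     f ∘ (kin i ⊗ kin j ⊗ kin k) = g ∘ (kin i ⊗ kin j ⊗ kin k)) -> f = g.
Proof.
move=> e; rewrite -[f]compm1 -[g]compm1 -!tens11 -!kinpr !tens_suml !comp_sumr.
apply: eq_bigr => i _; rewrite !(tens_sumr, tens_suml) !comp_sumr.
apply: eq_bigr => j _; rewrite ?(tens_sumr, tens_suml) ?comp_sumr.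
by apply: eq_bigr => k _; rewrite !tensM !compA e.
Qed.

Lemma kinPr (A : aB) (W Z : E) (f g : hom (W • kob A) Z) :
  (forall i : aix A, f ∘ (idm W ⊗ kin i) = g ∘ (idm W ⊗ kin i)) -> f = g.
Proof.
move=> e; rewrite -[f]compm1 -[g]compm1 -tens11 -kinpr tens_sumr !comp_sumr.
by apply: eq_bigr => i _; rewrite -tensMr !compA e.
Qed.

Lemma kinPl (A : aB) (W Z : E) (f g : hom (kob A • W) Z) :
  (forall i : aix A, f ∘ (kin i ⊗ idm W) = g ∘ (kin i ⊗ idm W)) -> f = g.
Proof.
move=> e; rewrite -[f]compm1 -[g]compm1 -tens11 -kinpr tens_suml !comp_sumr.
by apply: eq_bigr => i _; rewrite -tensMl !compA e.
Qed.

Definition kmor (A A' : aB) (M : hom A A') : hom (kob A) (kob A') :=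
  \sum_(i : aix A) \sum_(j : aix A') (kin j ∘ fmor K0 (ent M i j) ∘ kpr i).

Lemma kmor_in (A A' : aB) (M : hom A A') (i : aix A) :
  kmor M ∘ kin i = \sum_(j : aix A') (kin j ∘ fmor K0 (ent M i j)).
Proof.
rewrite comp_suml (bigD1 i) //= [X in _ + X]big1 ?addr0 => [|i' ne].
  by rewrite comp_suml; apply: eq_bigr => j _; rewrite -compA kprin compm1.
by rewrite comp_suml big1 // => j _; rewrite -compA kprin0 ?compm0.
Qed.

Lemma kpr_kmor_in (A A' : aB) (M : hom A A') (i : aix A) (j : aix A') :
  kpr j ∘ kmor M ∘ kin i = fmor K0 (ent M i j).
Proof.
rewrite -compA kmor_in comp_sumr (bigD1 j) //= big1 ?addr0 => [|j' ne].
  by rewrite compA kprin comp1m.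
by rewrite compA kprin0 ?comp0m // eq_sym.
Qed.

Lemma kmor_mono (A A' : aB) (phi : aix A -> aix A') f (i : aix A) :
  kmor (amono (phi := phi) f : hom A A') ∘ kin i = kin (phi i) ∘ fmor K0 (f i).
Proof.
rewrite kmor_in (bigD1 (phi i)) //= ent_amx dcast_id big1 ?addr0 // => j ne.
by rewrite ent_amx dcast_neq ?(lin0 (@fmor_lin _ _ _ K0 _ _)) ?compm0 // eq_sym.
Qed.

Program Definition additive_lfunctor : lfunctor aB E := {| fob := kob; fmor := kmor |}.
Next Obligation.
move=> A; apply: kinP => i; rewrite comp1m.
by rewrite /= (@kmor_mono _ _ id) fmor1 compm1.
Qed.
Next Obligation.
move=> A A' A'' N M; apply: kinP => i; rewrite -compA !kmor_in comp_sumr.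
under [RHS]eq_bigr => j _ do rewrite compA kmor_in comp_suml.
rewrite exchange_big; apply: eq_bigr => k _ /=.
rewrite ent_amx (lin_sum _ _ _ (@fmor_lin _ _ _ K0 _ _)) comp_sumr.
by apply: eq_bigr => j _; rewrite fmorM !compA.
Qed.
Next Obligation.
move=> A A' a M N; apply: kinP => i.
rewrite (comp_linl (kin i)) !kmor_in scaler_sumr -big_split; apply: eq_bigr => j _ /=.
by rewrite entL fmor_lin (comp_linr (kin j)).
Qed.

Local Notation mu0 X Y := (fw (fmu K0 X Y)).
Local Notation mu0' X Y := (bw (fmu K0 X Y)).

(** The injection at a pair, retyped with the tensor product of the components, which is its source
    only up to conversion. *)
Definition kin2 (A A' : aB) (i : aix A) (j : aix A') :
  hom (K0 (acomp i • acomp j)) (kob (A • A')) := @kin (A • A') (i, j).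
Definition kpr2 (A A' : aB) (i : aix A) (j : aix A') :
  hom (kob (A • A')) (K0 (acomp i • acomp j)) := @kpr (A • A') (i, j).

Lemma kprin2 (A A' : aB) (i : aix A) (j : aix A') :
  kpr2 i j ∘ kin2 i j = idm (K0 (acomp i • acomp j)).
Proof. exact: (@kprin (A • A') (i, j)). Qed.
Lemma kprin20 (A A' : aB) (i i' : aix A) (j j' : aix A') :
  (i, j) != (i', j') -> kpr2 i j ∘ kin2 i' j' = 0.
Proof. exact: (@kprin0 (A • A') (i, j) (i', j')). Qed.
Lemma kin2P (A A' : aB) (Z : E) (f g : hom (kob (A • A')) Z) :
  (forall i j, f ∘ kin2 i j = g ∘ kin2 i j) -> f = g.
Proof. by move=> e; apply: (@kinP (A • A')) => -[i j]; apply: e. Qed.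

Definition kmuf (A A' : aB) : hom (kob A • kob A') (kob (A • A')) :=
  \sum_(i : aix A) \sum_(j : aix A')
    (kin2 i j ∘ mu0 (acomp i) (acomp j) ∘ (kpr i ⊗ kpr j)).
Definition kmub (A A' : aB) : hom (kob (A • A')) (kob A • kob A') :=
  \sum_(i : aix A) \sum_(j : aix A')
    ((kin i ⊗ kin j) ∘ mu0' (acomp i) (acomp j) ∘ kpr2 i j).

Lemma kmuf_in (A A' : aB) (i : aix A) (j : aix A') :
  kmuf A A' ∘ (kin i ⊗ kin j) = kin2 i j ∘ mu0 (acomp i) (acomp j).
Proof.
rewrite comp_suml (bigD1 i) //= [X in _ + X]big1 ?addr0 => [|i' ne].
  rewrite comp_suml (bigD1 j) //= [X in _ + X]big1 ?addr0 => [|j' ne].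
    by rewrite -compA -tensM !kprin tens11 compm1.
  by rewrite -compA -tensM (kprin0 ne) tensm0 compm0.
by rewrite comp_suml big1 // => j' _; rewrite -compA -tensM (kprin0 ne) tens0m compm0.
Qed.

Lemma kmub_in (A A' : aB) (i : aix A) (j : aix A') :
  kmub A A' ∘ kin2 i j = (kin i ⊗ kin j) ∘ mu0' (acomp i) (acomp j).
Proof.
rewrite comp_suml (bigD1 i) //= [X in _ + X]big1 ?addr0 => [|i' ne].
  rewrite comp_suml (bigD1 j) //= [X in _ + X]big1 ?addr0 => [|j' ne].
    by rewrite -compA kprin2 compm1.
  by rewrite -compA kprin20 ?compm0 // xpair_eqE negb_and ne orbT.
rewrite comp_suml big1 // => j' _.
by rewrite -compA kprin20 ?compm0 // xpair_eqE negb_and ne.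
Qed.

Fact kmuK (A A' : aB) : kmub A A' ∘ kmuf A A' = idm _.
Proof.
apply: kinP2 => i j.
by rewrite -compA kmuf_in compA kmub_in (compE (fwK _)) compm1 comp1m.
Qed.
Fact kmuK' (A A' : aB) : kmuf A A' ∘ kmub A A' = idm _.
Proof.
apply: kin2P => i j.
by rewrite -compA kmub_in compA kmuf_in (compE (bwK _)) compm1 comp1m.
Qed.
Definition kmu (A A' : aB) := Isom (kmuK A A') (kmuK' A A').

Let u0 : aix (tunit : aB) := tt.
Definition keta : isom tunit (kob tunit).
Proof.
exists (kin u0 ∘ fw (feta K0)) (bw (feta K0) ∘ kpr u0).
  by rewrite !compA (compE (kprin u0)) compm1 fwK.
rewrite !compA (compE (bwK _)) compm1 -kinpr (bigD1 u0) //= big1 ?addr0 // => -[].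
Defined.

Program Definition additive_functor : bfunctor aB E := {|
  bf_lfunctor := additive_lfunctor; fmu := kmu; feta := keta |}.
Next Obligation.
move=> A A' D D' M N; apply: kinP2 => i j.
rewrite -!compA -tensM /= !kmor_in kmuf_in.
rewrite (compA (kmor _)) (@kmor_in (A • D) (A' • D') _ (i, j)) [in RHS]comp_suml.
rewrite tens_suml comp_sumr.
under eq_bigr => i' _ do (rewrite tens_sumr comp_sumr;
  under eq_bigr => j' _ do rewrite tensM compA kmuf_in).
rewrite pair_big; apply: eq_bigr => -[i' j'] _ /=.
by rewrite -!compA fmu_nat ent_atensm.
Qed.
Next Obligation.
move=> A A' A''; apply: kinP3 => i j k /=.
have aE : kmor (α A A' A'') ∘ @kin2 (A • A') A'' (i, j) k =
    @kin2 A (A' • A'') i (j, k) ∘ fmor K0 (α (acomp i) (acomp j) (acomp k)).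
  exact: (@kmor_mono (A • A' • A'') (A • (A' • A''))
    (fun p => (p.1.1, (p.1.2, p.2)))
    (fun p => α (acomp p.1.1) (acomp p.1.2) (acomp p.2)) ((i, j), k)).
rewrite -!compA -tensM comp1m kmuf_in assoc_nat -[kin k]compm1 tensM.
rewrite [in LHS](compA (kmuf _ _)) (@kmuf_in (A • A') A'' (i, j) k) /=.
rewrite [in LHS]compA [in LHS]compA aE.
rewrite compm1 [in RHS](compA (_ ⊗ kmuf _ _)) -tensM comp1m kmuf_in.
rewrite -[kin i]compm1 tensM !compA (@kmuf_in A (A' • A'') i (j, k)).
by rewrite -!compA; congr (_ ∘ _); rewrite !compA fmu_assoc.
Qed.
Next Obligation.
move=> A; apply: kinPr => i.
have lE : kmor (λ A) ∘ @kin2 tunit A u0 i = kin i ∘ fmor K0 (λ (acomp i)).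
  exact: (@kmor_mono (tunit • A) A (fun p => p.2) (fun p => λ (acomp p.2)) (u0, i)).
rewrite lunit_nat -!compA -tensM comp1m compm1 /=.
rewrite -[kin i in LHS]compm1 tensM (compA (kmuf _ _)) (@kmuf_in tunit A u0 i) /=.
by rewrite compA compA lE -!compA; congr (_ ∘ _); rewrite compA fmu_lunit.
Qed.
Next Obligation.
move=> A; apply: kinPl => i.
have rE : kmor (ρ A) ∘ @kin2 A tunit i u0 = kin i ∘ fmor K0 (ρ (acomp i)).
  exact: (@kmor_mono (A • tunit) A (fun p => p.1) (fun p => ρ (acomp p.1)) (i, u0)).
rewrite runit_nat -!compA -tensM comp1m compm1 /=.
rewrite -[kin i in LHS]compm1 tensM (compA (kmuf _ _)) (@kmuf_in A tunit i u0) /=.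
by rewrite compA compA rE -!compA; congr (_ ∘ _); rewrite compA fmu_runit.
Qed.
Next Obligation.
move=> A A'; apply: kinP2 => i j /=.
have bE : kmor (fw (braid A A')) ∘ kin2 i j =
    kin2 j i ∘ fmor K0 (fw (braid (acomp i) (acomp j))).
  exact: (@kmor_mono (A • A') (A' • A) (fun p => (p.2, p.1))
    (fun p => fw (braid (acomp p.1) (acomp p.2))) (i, j)).
rewrite -!compA kmuf_in braid_nat (compA (kmuf _ _)) kmuf_in.
by rewrite compA bE -!compA; congr (_ ∘ _); rewrite fmu_braid.
Qed.

Lemma kmor_faithful (A A' : aB) :
  (forall X Y, injective (@fmor _ _ _ K0 X Y)) -> injective (@kmor A A').
Proof.
move=> inj M N e; apply: entP => i j; apply: inj.
by rewrite -!kpr_kmor_in e.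
Qed.

Lemma kmor_full (A A' : aB) (f : hom (kob A) (kob A')) :
  (forall (i : aix A) (j : aix A'), exists g, fmor K0 g = kpr j ∘ f ∘ kin i) ->
  exists M : hom A A', kmor M = f.
Proof.
move=> full; have h i j := cid (full i j).
exists (amx (fun i j => sval (h i j))); apply: kinP => i; apply: kprP => j.
by rewrite !compA kpr_kmor_in ent_amx (svalP (h i j)).
Qed.

Definition single (X : B) : aB := @AddOb F B unit (fun _ => X).

Lemma kpr_kmor_single (X Y : B) (M : hom (single X) (single Y)) :
  kpr (A := single Y) tt ∘ kmor M =
  fmor K0 (ent M tt tt) ∘ kpr (A := single X) tt.
Proof.
apply: kinP => -[]; rewrite (@kpr_kmor_in (single X) (single Y)) -compA kprin.
by rewrite compm1.
Qed.

Lemma kpr_kmuf_single (X Y Z : B) (M : hom (single X • single Y) (single Z)) :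
  kpr (A := single Z) tt ∘ kmor M ∘ kmuf (single X) (single Y) =
  fmor K0 (ent M (tt, tt) tt) ∘ mu0 X Y
    ∘ (kpr (A := single X) tt ⊗ kpr (A := single Y) tt).
Proof.
apply: kinP2 => -[] []; rewrite -compA kmuf_in -[RHS]compA -tensM !kprin tens11.
rewrite compm1 compA; congr (_ ∘ _).
exact: (@kpr_kmor_in (single X • single Y) (single Z) M (tt, tt) tt).
Qed.

End Additive.

Lemma equivalence_ff_eso (F : fieldType) (C D : lcat F) (K : lfunctor C D) :
  (forall X Y, injective (@fmor _ _ _ K X Y)) ->
  (forall X Y (f : hom (K X) (K Y)), exists g, fmor K g = f) ->
  (forall Y : D, exists X : C, inhabited (isom (K X) Y)) -> equivalence K.
Proof.
move=> inj full eso.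
have t Y : {X : C & isom (K X) Y}.
  have [X tX] := cid (eso Y); exists X.
  by suff /cid [t _] : exists t : isom (K X) Y, True by []; case: tX => t; exists t.
pose pre X Y f := cid (full X Y f); pose pm X Y f := sval (pre X Y f).
have pmE X Y f : fmor K (pm X Y f) = f by exact: svalP (pre X Y f).
pose v Y : isom (K (projT1 (t Y))) Y := projT2 (t Y).
pose lm X Y (f : hom X Y) := pm _ _ (bw (v Y) ∘ f ∘ fw (v X)).
have lm1 X : lm X X (idm X) = idm (projT1 (t X)).
  by apply: inj; rewrite pmE compm1 fwK fmor1.
have lmM X Y Z (g : hom Y Z) (f : hom X Y) : lm X Z (g ∘ f) = lm Y Z g ∘ lm X Y f.
  by apply: inj; rewrite fmorM !pmE !compA (compE (bwK _)) compm1.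
have lmL X Y : linear (lm X Y).
  move=> a f g; apply: inj; rewrite fmor_lin !pmE.
  by rewrite (comp_linr (bw (v Y))) (comp_linl (fw (v X))).
pose L := LFunctor lm1 lmM lmL.
exists L; split; last first.
  by exists v => X Y f; rewrite pmE !compA bwK comp1m.
have uK X : pm _ _ (bw (v (K X))) ∘ pm _ _ (fw (v (K X))) = idm (L (K X)).
  by apply: inj; rewrite fmorM !pmE fwK fmor1.
have uK' X : pm _ _ (fw (v (K X))) ∘ pm _ _ (bw (v (K X))) = idm X.
  by apply: inj; rewrite fmorM !pmE bwK fmor1.
exists (fun X => Isom (uK X) (uK' X)) => X Y f /=.
by apply: inj; rewrite !fmorM !pmE !compA bwK comp1m.
Qed.

Lemma dsum_fin (F : fieldType) (C : tcat F) (I : finType) (Y : I -> C) :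
  semisimple C -> exists (S : C) (p : forall i, hom (Y i) S) (q : forall i, hom S (Y i)),
  [/\ forall i, q i ∘ p i = idm (Y i), forall i j, i != j -> q i ∘ p j = 0
    & \sum_i (p i ∘ q i) = idm S].
Proof.
move=> ss; have [S [p [q [pq pq0 s]]]] := ss_dsum ss (fun k : 'I_#|I| => Y (enum_val k)).
pose p' i := ecast z (hom (Y z) S) (enum_rankK i) (p (enum_rank i)).
pose q' i := ecast z (hom S (Y z)) (enum_rankK i) (q (enum_rank i)).
have E1 k i (e : enum_val k = i) :
    ecast z (hom S (Y z)) e (q k) ∘ ecast z (hom (Y z) S) e (p k) = idm (Y i).
  by case: i / e; apply: pq.
have E2 k l i j (e : enum_val k = i) (e' : enum_val l = j) : k != l ->
    ecast z (hom S (Y z)) e (q k) ∘ ecast z (hom (Y z) S) e' (p l) = 0.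
  by case: i / e; case: j / e'; apply: pq0.
have E3 k i (e : enum_val k = i) :
    ecast z (hom (Y z) S) e (p k) ∘ ecast z (hom S (Y z)) e (q k) = p k ∘ q k.
  by case: i / e.
exists S, p', q'; split=> [i|i j ne|]; first exact: E1.
  by apply: E2; rewrite (inj_eq enum_rank_inj).
rewrite -s (reindex (@enum_rank I)) /=; last by apply: onW_bij; apply: enum_rank_bij.
by apply: eq_bigr => i _; apply: E3.
Qed.

(** * Direct sums in the center *)

Section CenterSums.
Variables (F : fieldType) (C : bcat F) (I : finType) (Y : I -> zob C).
Variables (S : C) (p : forall i, hom (zc (Y i)) S) (q : forall i, hom S (zc (Y i))).
Hypothesis qp : forall i, q i ∘ p i = idm (zc (Y i)).
Hypothesis qp0 : forall i j, i != j -> q i ∘ p j = 0.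
Hypothesis pq : \sum_i (p i ∘ q i) = idm S.

(** The block diagonal half braiding: its axioms hold because they hold on each summand. *)
Let hf Z := \sum_i ((idm Z ⊗ p i) ∘ ze (Y i) Z ∘ (q i ⊗ idm Z)).
Let hg Z := \sum_i ((p i ⊗ idm Z) ∘ bw (hb (zhb (Y i)) Z) ∘ (idm Z ⊗ q i)).

Lemma hf_in Z i : hf Z ∘ (p i ⊗ idm Z) = (idm Z ⊗ p i) ∘ ze (Y i) Z.
Proof.
rewrite comp_suml (bigD1 i) //= big1 ?addr0 => [|j ne].
  by rewrite -!compA tensMl qp tens11 compm1.
by rewrite -compA tensMl qp0 // tens0m compm0.
Qed.

Lemma hg_in Z i : hg Z ∘ (idm Z ⊗ p i) = (p i ⊗ idm Z) ∘ bw (hb (zhb (Y i)) Z).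
Proof.
rewrite comp_suml (bigD1 i) //= big1 ?addr0 => [|j ne].
  by rewrite -!compA tensMr qp tens11 compm1.
by rewrite -compA tensMr qp0 // tensm0 compm0.
Qed.

Lemma extl V W (f g : hom (S • V) W) :
  (forall i, f ∘ (p i ⊗ idm V) = g ∘ (p i ⊗ idm V)) -> f = g.
Proof.
move=> e; rewrite -[f]compm1 -[g]compm1 -tens11 -pq tens_suml !comp_sumr.
by apply: eq_bigr => i _; rewrite -tensMl !compA e.
Qed.
Lemma extr V W (f g : hom (V • S) W) :
  (forall i, f ∘ (idm V ⊗ p i) = g ∘ (idm V ⊗ p i)) -> f = g.
Proof.
move=> e; rewrite -[f]compm1 -[g]compm1 -tens11 -pq tens_sumr !comp_sumr.
by apply: eq_bigr => i _; rewrite -tensMr !compA e.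
Qed.

Fact hfK Z : hg Z ∘ hf Z = idm (S • Z).
Proof.
apply: extl => i; rewrite comp1m -compA hf_in compA hg_in.
by rewrite (compE (fwK _)) compm1.
Qed.
Fact hgK Z : hf Z ∘ hg Z = idm (Z • S).
Proof.
apply: extr => i; rewrite comp1m -compA hg_in compA hf_in.
by rewrite (compE (bwK _)) compm1.
Qed.

Lemma hf_nat Z Z' (f : hom Z Z') :
  hf Z' ∘ (idm S ⊗ f) = (f ⊗ idm S) ∘ hf Z.
Proof.
apply: extl => i; rewrite -!compA hf_in tens_rl -tens_lr compA hf_in -compA hb_nat.
by rewrite !compA tens_rl tens_lr.
Qed.

Lemma hf_hex Z W : hf (Z • W) =
  α' Z W S ∘ (idm Z ⊗ hf W) ∘ α Z S W ∘ (hf Z ⊗ idm W) ∘ α' S Z W.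
Proof.
apply: extl => i; rewrite hf_in {1}/ze hb_hex.
rewrite -(tens11 Z W) [in RHS](compE (assoc_nat' (p i) (idm Z) (idm W))) !compA.
rewrite [in RHS](compE (tensMl _ (hf Z) _)) hf_in -(tensMl _ _ (ze _ _)) !compA.
rewrite [in RHS](compE (assoc_nat (idm Z) (p i) (idm W))) !compA.
rewrite [in RHS](compE (tensMr _ (hf W) _)) hf_in -(tensMr _ _ (ze _ _)) !compA.
by rewrite assoc_nat'.
Qed.

Program Definition sum_hb : half_braiding S := {| hb := fun Z => Isom (hfK Z) (hgK Z) |}.
Next Obligation. by move=> Z Z' f; apply: hf_nat. Qed.
Next Obligation. by move=> Z W; apply: hf_hex. Qed.
Next Obligation.
exact: (hb_unit_auto (e := fun Z => Isom (hfK Z) (hgK Z)) hf_nat hf_hex).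
Qed.

Definition zsum : zob C := ZOb sum_hb.

Lemma zsum_in i : @zmor_prop _ C (Y i) zsum (p i).
Proof. by move=> Z; rewrite [ze zsum Z]/(hf Z) hf_in. Qed.

Lemma zsum_pr i : @zmor_prop _ C zsum (Y i) (q i).
Proof.
move=> Z; rewrite [ze zsum Z]/(hf Z); apply: extl => j.
rewrite -[LHS]compA hf_in -[RHS]compA [LHS]compA tensMr tensMl.
have [->|ne] := eqVneq i j; first by rewrite qp !tens11 comp1m compm1.
by rewrite qp0 // tens0m tensm0 comp0m compm0.
Qed.

End CenterSums.

Lemma center_sums (F : fieldType) (C : bcat F) : semisimple C -> sums (Z1 C).
Proof.
move=> ss.
have h (I : finType) (Y : I -> Z1 C) : exists (S : Z1 C)
   (p : forall i, hom (Y i) S) (q : forall i, hom S (Y i)),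
   [/\ forall i, q i ∘ p i = idm (Y i), forall i j, i != j -> q i ∘ p j = 0
    & \sum_i (p i ∘ q i) = idm S].
  have [S [p [q [qp qp0 pq]]]] := dsum_fin (fun i => zc (Y i)) ss.
  exists (zsum qp qp0 pq), (fun i => zmk (zsum_in qp qp0 pq i)),
    (fun i => zmk (zsum_pr qp qp0 pq i)); split=> [i|i j ne|].
  - by apply: zval_inj; apply: qp.
  - by apply: zval_inj; apply: qp0.
  apply: zval_inj; rewrite (lin_sum _ _ _ (@zval_lin _ _ _ _)).
  exact: pq.
pose S I Y := cid (h I Y).
pose P I Y := cid (svalP (S I Y)).
pose Q I Y := cid (svalP (P I Y)).
apply: (@Sums _ _ (fun I Y => sval (S I Y)) (fun I Y => sval (P I Y))
  (fun I Y => sval (Q I Y))) => I Y.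
- by have [] := svalP (Q I Y).
- by have [] := svalP (Q I Y).
- by have [] := svalP (Q I Y).
Qed.

(** * The functor on products *)

Section InverseCrossing.
Variables (F : fieldType) (C : bcat F).
Implicit Types a b : tree C.

Lemma bi_natl a a' b (f : hom (tobj a) (tobj a')) Z :
  fam f (act b Z) ∘ bi a b Z = bi a' b Z ∘ actm b (fam f Z).
Proof.
apply: (compKr (i := bxi a' b Z)); apply: (compKl (i := bxi a b Z)) => /=.
rewrite -!compA (bxK a b Z) compm1 bx_natl.
by rewrite [RHS]compA (biK a' b Z) comp1m.
Qed.

Lemma bi_Nodel a a' b Z :
  bi (Node a a') b Z = actm a (bi a' b Z) ∘ bi a b (act a' Z).
Proof.
apply: (compKr (i := bxi (Node a a') b Z)); rewrite [LHS](biK (Node a a') b Z).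
rewrite [fw _]bx_Nodel -!compA (compA (actm a _)) -actmM biK actm1 comp1m.
by rewrite (biK a b (act a' Z)).
Qed.

Lemma bi_Noder a b b' Z :
  bi a (Node b b') Z = bi a b (act b' Z) ∘ actm b (bi a b' Z).
Proof.
apply: (compKl (i := bxi a (Node b b') Z)); rewrite [LHS](bxK a (Node b b') Z).
rewrite [fw _]bx_Noder -!compA (compA (actm b _) (actm b _)) -actmM bxK actm1 comp1m.
by rewrite (bxK a b (act b' Z)).
Qed.

Lemma bi_Unl b Z : bi Un b Z = idm (act b Z).
Proof.
by have := biK Un b Z; rewrite bx_Unl => e; exact: etrans (esym (comp1m _)) e.
Qed.

Lemma bi_Unr a Z : bi a Un Z = idm (act a Z).
Proof.
by have := bxK a Un Z; rewrite bx_Unr => e; exact: etrans (esym (compm1 _)) e.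
Qed.

End InverseCrossing.

Section Product.
Variables (F : fieldType) (C : bcat F).
Implicit Types X Y W Z : C.

Definition middle_swap_iso X Y X' Y' : isom (X • Y • (X' • Y')) (X • X' • (Y • Y')) :=
  compi (compi (isom_inv (assoc X X' (Y • Y')))
    (tensi (idi X) (compi (compi (assoc X' Y Y')
       (tensi (isom_inv (braid X' Y)) (idi Y'))) (isom_inv (assoc Y X' Y')))))
    (assoc X Y (X' • Y')).

Lemma middle_swap_isoE X Y X' Y' : fw (middle_swap_iso X Y X' Y') = middle_swap X Y X' Y'.
Proof. by []. Qed.

Notation T4 X Y X' Y' := (Node (Node (Leaf X) (Leaf Y)) (Node (Leaf X') (Leaf Y'))).

Lemma fam_middle_swap_tree (a b a' b' : tree C) Z :
  @fam _ _ (Node (Node a b) (Node a' b')) (Node (Node a a') (Node b b'))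
    (middle_swap (tobj a) (tobj b) (tobj a') (tobj b')) Z =
  actm a (bi a' b (act b' Z)).
Proof. by rewrite /middle_swap; famx. Qed.

Lemma fam_middle_swap X Y X' Y' Z :
  @fam _ _ (T4 X Y X' Y') (T4 X X' Y Y') (middle_swap X Y X' Y') Z =
  idm X ⊗ crossi X' Y (Y' • Z).
Proof. exact: (fam_middle_swap_tree (Leaf X) (Leaf Y) (Leaf X') (Leaf Y')). Qed.

(** This is naturality of the inverse crossing with Y, applied to the braiding of X and W. *)
Lemma yang_baxter X Y W Z :
  (idm W ⊗ crossi X Y Z) ∘ crossi W Y (X • Z) ∘ (idm Y ⊗ cross X W Z) =
  cross X W (Y • Z) ∘ (idm X ⊗ crossi W Y Z) ∘ crossi X Y (W • Z).
Proof.
have := @bi_natl _ _ (Node (Leaf X) (Leaf W)) (Node (Leaf W) (Leaf X)) (Leaf Y)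
  (fw (braid X W)) Z.
by rewrite !bi_Nodel /= !compA => ->.
Qed.

Lemma ci_nat X X' Y Y' (f : hom X X') (g : hom Y Y') Z :
  crossi X' Y' Z ∘ (g ⊗ idm (X' • Z)) ∘ (idm Y ⊗ (f ⊗ idm Z)) =
  (f ⊗ idm (Y' • Z)) ∘ (idm X ⊗ (g ⊗ idm Z)) ∘ crossi X Y Z.
Proof.
have := @bx_nat _ _ (Leaf X) (Leaf X') (Leaf Y) (Leaf Y') f g Z; rewrite !famL => e.
apply: (compKl (i := bxi (Leaf X) (Leaf Y) Z)).
apply: (compKr (i := bxi (Leaf X') (Leaf Y') Z)) => /=.
rewrite -!compA (cK X Y Z) compm1 [RHS]e.
by rewrite compA (ciK X' Y' _) comp1m !compA.
Qed.

Definition cen_prod X Y : Z1 C := ztens (cen X) (cen_tilde Y).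

(** The swap is the half braiding c~ of Y at X', so moving it past W is a Yang-Baxter move of Y, X'
    and W; the strands X and Y' only pass along. *)
Lemma middle_swap_zmor X Y X' Y' :
  @zmor_prop _ C (ztens (cen_prod X Y) (cen_prod X' Y')) (cen_prod (X • X') (Y • Y'))
    (fw (middle_swap_iso X Y X' Y')).
Proof.
move=> W; apply: (@fam_inj _ _ (Node (T4 X Y X' Y') (Leaf W))
   (Node (Leaf W) (T4 X X' Y Y'))) => Z.
rewrite middle_swap_isoE !ze_tens /ze /=.
famx; rewrite !fam_middle_swap.
have -> : @fam _ _ (Node (Node (Leaf X) (Leaf X')) (Leaf W)) (Node (Leaf W) (Node (Leaf
  X) (Leaf X')))
   (fw (braid (X • X') W)) (Y • (Y' • Z)) = cross X W (X' • (Y • (Y' • Z))) ∘ (idm X ⊗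
     cross X' W (Y • (Y' • Z))).
  exact: (@bx_Nodel _ _ (Leaf X) (Leaf X') (Leaf W) (Y • (Y' • Z))).
have -> : @fam _ _ (Node (Node (Leaf Y) (Leaf Y')) (Leaf W)) (Node (Leaf W) (Node (Leaf
  Y) (Leaf Y')))
   (bw (braid W (Y • Y'))) Z = crossi W Y (Y' • Z) ∘ (idm Y ⊗ crossi W Y' Z).
  exact: (@bi_Noder _ _ (Leaf W) (Leaf Y) (Leaf Y') Z).
rewrite -/(cross X W _) -/(crossi W Y _) -/(cross X' W _) -/(crossi W Y' _) -c_tail.
rewrite -!compA !tensMr; congr (_ ∘ (idm X ⊗ _)); rewrite -!tensMr !compA.
by rewrite yang_baxter -!compA ci_tail.
Qed.

Definition cen_mu X Y X' Y' : isom (ztens (cen_prod X Y) (cen_prod X' Y') : Z1 C)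
  (cen_prod (X • X') (Y • Y')) :=
  zisom (middle_swap_zmor X Y X' Y').

Lemma cen_zmor X X' (f : hom X X') : @zmor_prop _ C (cen X) (cen X') f.
Proof. by move=> Z; rewrite /ze /= braid_nat. Qed.
Lemma cen_tilde_zmor X X' (f : hom X X') :
  @zmor_prop _ C (cen_tilde X) (cen_tilde X') f.
Proof. by move=> Z; rewrite /ze /= (@braid_nat _ (tilde C)). Qed.

Lemma cen_prod_zmor X X' Y Y' (f : hom X X') (g : hom Y Y') :
  @zmor_prop _ C (cen_prod X Y) (cen_prod X' Y') (f ⊗ g).
Proof.
exact: (@ztensm_prop _ C (cen X) (cen X') (cen_tilde Y) (cen_tilde Y')
  (zmk (cen_zmor f)) (zmk (cen_tilde_zmor g))).
Qed.

Local Notation PC := (pairc C (tilde C)).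
Local Notation PT A B := (@ptens _ C (tilde C) A B).

Definition tens_pair (A B : PC) (t : hom A B) : hom (A.1 • A.2) (B.1 • B.2) :=
  tlift (@tensm _ C A.1 B.1 A.2 B.2) t.

Lemma tens_pair_pten (A B : PC) (f : hom A.1 B.1) (g : hom (A.2 : C) B.2) :
  tens_pair (pten f g : hom A B) = f ⊗ g.
Proof. exact: (tlift_pten _ _ (tens_bil _ _ _ _)). Qed.

Lemma tens_pair_lin (A B : PC) : linear (@tens_pair A B).
Proof. exact: tlift_linear. Qed.

Lemma tens_pairD (A B : PC) (s t : hom A B) : tens_pair (s + t) = tens_pair s + tens_pair t.
Proof. by have := tens_pair_lin 1 s t; rewrite !scale1r. Qed.

Lemma tens_pairM (A B E : PC) (g : hom B E) (f : hom A B) :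
  tens_pair (pcomp g f : hom A E) = tens_pair g ∘ tens_pair f.
Proof.
elim/tprod_ind: g => [g1 g2|s t Hs Ht]; last by rewrite pcompDl !tens_pairD compDl Hs Ht.
elim/tprod_ind: f => [f1 f2|s t Hs Ht]; last by rewrite pcompDr !tens_pairD compDr Hs Ht.
by rewrite pcompE !tens_pair_pten tensM.
Qed.

Lemma tens_pair_zmor (A B : PC) (t : hom A B) :
  @zmor_prop _ C (cen_prod A.1 A.2) (cen_prod B.1 B.2) (tens_pair t).
Proof.
elim/tprod_ind: t => [f g|s t Hs Ht].
  by rewrite (tens_pair_pten f g); exact: cen_prod_zmor.
rewrite tens_pairD -[tens_pair s]scale1r.
exact: (zmor_submod (cen_prod A.1 A.2) (cen_prod B.1 B.2)).2 Hs Ht.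
Qed.

Program Definition cen_lfunctor : lfunctor PC (Z1 C) := {|
  fob := fun A => cen_prod A.1 A.2; fmor := fun A B t => zmk (tens_pair_zmor t) |}.
Next Obligation.
move=> A; apply: zval_inj; rewrite [LHS](tens_pair_pten (idm A.1) (idm A.2)).
exact: tens11.
Qed.
Next Obligation.
move=> A B D g f; apply: zval_inj.
exact: tens_pairM.
Qed.
Next Obligation.
by move=> A B a s t; apply: zval_inj; apply: tens_pair_lin.
Qed.

Lemma cen_eta_zmor : @zmor_prop _ C (zunit C) (cen_prod tunit tunit) (fw (isom_inv (lunit
  tunit))).
Proof.
move=> W; apply: (@fam_inj _ _ (Node Un (Leaf W)) (Node (Leaf W) (Node Un Un))) => Z.
rewrite ze_tens ze_unit /ze /=; famx.
rewrite -/(bx Un (Leaf W) _) -/(bi (Leaf W) Un _) bx_Unl.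
by rewrite bi_Unr comp1m.
Qed.

Definition cen_eta : isom (tunit : Z1 C) (cen_lfunctor tunit) := zisom cen_eta_zmor.

Lemma middle_swap_nat X Y X' Y' V U V' U' (f : hom X V) (g : hom Y U)
    (f' : hom X' V') (g' : hom Y' U') :
  middle_swap V U V' U' ∘ ((f ⊗ g) ⊗ (f' ⊗ g')) =
  ((f ⊗ f') ⊗ (g ⊗ g')) ∘ middle_swap X Y X' Y'.
Proof.
apply: (@fam_inj _ _ (T4 X Y X' Y') (T4 V V' U U')) => Z.
rewrite (@famM _ _ _ (T4 V U V' U')) (@famM _ _ _ (T4 X X' Y Y')) !fam_middle_swap.
famx; rewrite tens_rl -tens_lr -!compA; congr (_ ∘ _); rewrite !tensMr.
congr (idm X ⊗ _); rewrite -!tensMr !compA ci_nat.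
by rewrite (compE (ci_tail X' Y _)) !compA.
Qed.

(** The braiding of the center has four crossings. That of A with B' is undone by the swap of the
    target, that of A' with B is the swap of the source, and the other two form the componentwise
    braiding. *)
Lemma middle_swap_braid A A' B B' :
  (fw (braid A B) ⊗ bw (braid B' A')) ∘ middle_swap A A' B B' =
  middle_swap B B' A A' ∘ ze (cen_prod A A') (B • B').
Proof.
rewrite ze_tens /ze /=.
apply: (@fam_inj _ _ (T4 A A' B B') (T4 B A B' A')) => Z.
rewrite (@famM _ _ _ (T4 A B A' B')) fam_middle_swap.
rewrite (@famM _ _ _ (T4 B B' A A')) fam_middle_swap.
famx.
have -> : @fam _ _ (Node (Leaf A) (Node (Leaf B) (Leaf B'))) (Node (Node (Leaf B) (Leaf
  B')) (Leaf A))
    (fw (braid A (B • B'))) (A' • Z) =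
    (idm B ⊗ cross A B' (A' • Z)) ∘ cross A B (B' • (A' • Z)).
  exact: (@bx_Noder _ _ (Leaf A) (Leaf B) (Leaf B') (A' • Z)).
have -> : @fam _ _ (Node (Leaf A') (Node (Leaf B) (Leaf B'))) (Node (Node (Leaf B) (Leaf
  B')) (Leaf A'))
    (bw (braid (B • B') A')) Z =
    (idm B ⊗ crossi B' A' Z) ∘ crossi B A' (B' • Z).
  exact: (@bi_Nodel _ _ (Leaf B) (Leaf B') (Leaf A') Z).
rewrite compA (whisk _ (cK A B' (A' • Z))) tens11 comp1m.
by rewrite -tensMr compA.
Qed.

Program Definition cen_functor : bfunctor PC (Z1 C) := {|
  bf_lfunctor := cen_lfunctor;
  fmu := fun A B => cen_mu A.1 A.2 B.1 B.2; feta := cen_eta |}.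
Next Obligation.
move=> A A' B B' f g; apply: zval_inj.
transitivity (middle_swap A'.1 A'.2 B'.1 B'.2 ∘ (tens_pair f ⊗ tens_pair g)); first by [].
transitivity (tens_pair (ptensm f g) ∘ middle_swap A.1 A.2 B.1 B.2); last by [].
elim/tprod_ind: f => [f1 f2|s t Hs Ht]; last first.
  by rewrite ptensmDl !tens_pairD tensDl compDr compDl Hs Ht.
elim/tprod_ind: g => [g1 g2|s t Hs Ht]; last first.
  by rewrite ptensmDr !tens_pairD tensDr compDr compDl Hs Ht.
by rewrite ptensmE !tens_pair_pten; exact: middle_swap_nat.
Qed.
Next Obligation.
case=> [A A'] [B B'] [D D']; apply: zval_inj.
transitivity ((α A B D ⊗ α (A' : C) B' D') ∘ middle_swap (A • B) (A' • B') D D'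
  ∘ (middle_swap A A' B B' ⊗ idm (D • D'))).
  by rewrite -(@tens_pair_pten (PT (PT (A, A') (B, B')) (D, D')) (PT (A, A') (PT (B, B')
    (D, D')))).
transitivity (middle_swap A A' (B • D) (B' • D')
  ∘ (idm (A • A') ⊗ middle_swap B B' D D') ∘ α (A • A') (B • B') (D • D')); last by [].
apply: (@fam_inj _ _ (Node (T4 A A' B B') (Node (Leaf D) (Leaf D')))
 (Node (Node (Leaf A) (Node (Leaf B) (Leaf D))) (Node (Leaf A') (Node (Leaf B') (Leaf
   D'))))) => Z.
famx; rewrite !fam_middle_swap.
rewrite (@fam_middle_swap_tree (Node (Leaf A) (Leaf B)) (Node (Leaf A') (Leaf B')) (Leaf
  D) (Leaf D')).
rewrite (@fam_middle_swap_tree (Leaf A) (Leaf A') (Node (Leaf B) (Leaf D)) (Node (Leaf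
  B') (Leaf D'))).
rewrite bi_Nodel bi_Noder /= !tensMr; congr (_ ⊗ _); rewrite -!tensMr -!compA.
by rewrite ci_tail.
Qed.
Next Obligation.
case=> [A A']; apply: zval_inj.
transitivity ((λ A ⊗ λ (A' : C)) ∘ middle_swap tunit tunit A A'
  ∘ (λ' tunit ⊗ idm (A • A'))).
  by rewrite -(@tens_pair_pten (PT (tunit, tunit) (A, A')) (A, A')).
transitivity (λ (A • A')); last by [].
apply: (@fam_inj _ _ (Node Un (Node (Leaf A) (Leaf A'))) (Node (Leaf A) (Leaf A'))) => Z.
rewrite (@famM _ _ _ (Node (Node Un Un) (Node (Leaf A) (Leaf A')))).
rewrite (@famM _ _ _ (Node (Node Un (Leaf A)) (Node Un (Leaf A')))).
rewrite (@fam_middle_swap_tree Un Un (Leaf A) (Leaf A')).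
by famx; exact: (bi_Unr (Leaf A) (A' • Z)).
Qed.
Next Obligation.
case=> [A A']; apply: zval_inj.
transitivity ((ρ A ⊗ ρ (A' : C)) ∘ middle_swap A A' tunit tunit
  ∘ (idm (A • A') ⊗ λ' tunit)).
  by rewrite -(@tens_pair_pten (PT (A, A') (tunit, tunit)) (A, A')).
transitivity (ρ (A • A')); last by [].
apply: (@fam_inj _ _ (Node (Node (Leaf A) (Leaf A')) Un) (Node (Leaf A) (Leaf A'))) => Z.
rewrite (@famM _ _ _ (Node (Node (Leaf A) (Leaf A')) (Node Un Un))).
rewrite (@famM _ _ _ (Node (Node (Leaf A) Un) (Node (Leaf A') Un))).
rewrite (@fam_middle_swap_tree (Leaf A) (Leaf A') Un Un).
by famx; rewrite bi_Unl tens11.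
Qed.
Next Obligation.
case=> [A A'] [B B']; apply: zval_inj.
transitivity ((fw (braid A B) ⊗ bw (@braid _ C B' A')) ∘ middle_swap A A' B B').
  rewrite -(@tens_pair_pten (PT (A, A') (B, B')) (PT (B, B') (A, A'))).
  by [].
transitivity (middle_swap B B' A A' ∘ ze (cen_prod A A') (B • B')); last by [].
exact: middle_swap_braid.
Qed.

End Product.

(** * Essential surjectivity *)

Section Retract.
Variables (F : fieldType) (C : bcat F) (P : pivotal C) (n : nat) (X : 'I_n -> C).
Local Notation D := (dob P).
Hypothesis ssC : semisimple C.
Hypothesis sphC : spherical P.
Hypothesis repX : simple_reps X.
Hypothesis unitS : Smatrix P X \in unitmx.
Variable A : Z1 C.

Lemma c_evR (Q : duality C) V W Z :
  (idm W ⊗ evR Q V Z) ∘ cross V W (dob Q V • Z) =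
  evR Q V (W • Z) ∘ (idm V ⊗ crossi (dob Q V) W Z).
Proof.
have := @bx_natl _ _ (Node (Leaf V) (Leaf (dob Q V))) Un (Leaf W) (evr Q V) Z.
rewrite bx_Unl comp1m bx_Nodel /= -/(evR Q V _) => ->.
by rewrite compA (compE (whisk _ (ciK (dob Q V) W Z))) tens11 compm1.
Qed.

(** With opposite half braidings on [X i] and its dual, the crossings of a loop [X j] with the two
    combine to a double braiding when the strand is closed; with equal ones they would cancel. *)
Let N i : Z1 C := ztens (cen_tilde (X i)) (cen (D (X i) • zc A)).

Let cv i : hom (zc A) (zc (N i)) :=
  α (X i) (D (X i)) (zc A) ∘ (coevl P (X i) ⊗ idm (zc A)) ∘ λ' (zc A).
Let ev i : hom (zc (N i)) (zc A) :=
  λ (zc A) ∘ (evr P (X i) ⊗ idm (zc A)) ∘ α' (X i) (D (X i)) (zc A).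

Local Notation T3 i := (Node (Leaf (X i)) (Node (Leaf (D (X i))) (Leaf (zc A)))).

Lemma cvE i Z : @fam _ _ (Leaf (zc A)) (T3 i) (cv i) Z = cvL P (X i) (zc A • Z).
Proof. by rewrite /cv; famx. Qed.
Lemma evE i Z : @fam _ _ (T3 i) (Leaf (zc A)) (ev i) Z = evR P (X i) (zc A • Z).
Proof. by rewrite /ev; famx. Qed.

Lemma sh_N i Y Z :
  @fam _ _ (Node (Leaf Y) (T3 i)) (Node (T3 i) (Leaf Y)) (bw (hb (zhb (N i)) Y)) Z =
  (idm (X i) ⊗ (idm (D (X i)) ⊗ crossi (zc A) Y Z))
    ∘ (idm (X i) ⊗ crossi (D (X i)) Y (zc A • Z)) ∘ cross Y (X i) (D (X i) • (zc A • Z)).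
Proof.
rewrite /=; famx; rewrite -/(cross Y (X i) _); congr (_ ∘ _).
rewrite tensMr; congr (_ ⊗ _).
exact: (@bi_Nodel _ _ (Leaf (D (X i))) (Leaf (zc A)) (Leaf Y) Z).
Qed.

Lemma ringm_tree (U : zob C) (t : tree C) (h : half_braiding (tobj t)) Y
    (g : hom (zc U) (tobj t)) Z :
  @fam _ _ (Leaf (zc U)) t (@ringm _ C P U (ZOb h) Y g) Z =
  actm t (evR P Y Z) ∘ @fam _ _ (Node (Leaf Y) t) (Node t (Leaf Y)) (bw (hb h Y)) (D Y • Z)
    ∘ (idm Y ⊗ @fam _ _ (Leaf (zc U)) t g (D Y • Z)) ∘ (idm Y ⊗ sh U (Leaf (D Y)) Z)
    ∘ cvL P Y (zc U • Z).
Proof. by rewrite /ringm /=; famx. Qed.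

(** Capping with [ev i] closes the strand [X i] to a circle linked with [X j], hence to the loop
    [dring P (X i) (X j)] on that strand. *)
Lemma ring_cv_ev i j Z :
  (ev i ∘ @ringm _ C P A (N i) (X j) (cv i)) ⊗ idm Z =
  (idm (zc A) ⊗ evR P (X j) Z) ∘ crossi (zc A) (X j) (D (X j) • Z)
    ∘ (dring P (X i) (X j) ⊗ idm (zc A • (D (X j) • Z)))
    ∘ (idm (X j) ⊗ sh A (Leaf (D (X j))) Z) ∘ cvL P (X j) (zc A • Z).
Proof.
rewrite -famL (@famM _ _ _ (T3 i)) evE.
rewrite (@ringm_tree A (T3 i) (ztens_hb (cen_tilde (X i)) (cen (D (X i) • zc A))) (X j)
  (cv i) Z).
rewrite cvE [fam (bw _) _](sh_N i (X j)) dringE /= !compA.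
rewrite evR_nat (compE (evR_nat P (X i) _)) !compA.
rewrite (compE (esym (c_evR P (X i) (X j) _))) !compA.
by rewrite (@famM _ _ _ (Node (Leaf (X i)) (Leaf (X j)))) !compA.
Qed.

Lemma ring_forget j Z :
  @ringm _ C P A (cen (zc A)) (X j) (idm (zc A)) ⊗ idm Z =
  (idm (zc A) ⊗ evR P (X j) Z) ∘ crossi (zc A) (X j) (D (X j) • Z)
    ∘ (idm (X j) ⊗ sh A (Leaf (D (X j))) Z) ∘ cvL P (X j) (zc A • Z).
Proof.
by rewrite (@ringmE _ C P (A : zob C) (cen (zc A) : zob C)) !tens11 compm1.
Qed.

(** At a copy of the unit the half braidings of [cen (zc A)] and A agree, so the identity becomes a
    morphism of the center and the loop slides off. *)
Lemma ring_unit_rep j : inhabited (isom (X j) tunit) ->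
  @ringm _ C P A (cen (zc A)) (X j) (idm (zc A)) = qdim P (X j) *: idm (zc A).
Proof.
case=> t.
have e : bw (hb (zhb (cen (zc A))) (X j)) = bw (hb (zhb A) (X j)).
  apply: bw_unique.
  apply: (compKl (i := tensi (idi (zc A)) (isom_inv t))) => /=.
  have e1 := hb_nat (zhb (cen (zc A))) (bw t); have e2 := hb_nat (zhb A) (bw t).
  have e3 := hb_unit (zhb (cen (zc A))); have e4 := hb_unit (zhb A).
  by move: e1 e2 e3 e4 => /= -> -> -> ->.
transitivity (@ringm _ C P A A (X j) (idm (zc A))).
  by rewrite /ringm e.
apply: (@fam_inj _ _ (Leaf (zc A)) (Leaf (zc A))) => Z.
rewrite famL (ringm_zmor P (X j) (@zid_prop _ C A)) (evR_cvL ssC sphC).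
by rewrite compZr compm1 famZ fam_id tens11.
Qed.

Let fm i := @avg _ C P n X A (N i) (cv i).

(** For fixed j, the circles [X i] summed with their weights form the Kirby loop on the strand
    [X j], which vanishes unless [X j] is the unit. *)
Lemma retract_total : exists2 k : F, k != 0 &
  \sum_i qdim P (X i) *: (ev i ∘ fm i) = k *: idm (zc A).
Proof.
have [i0 t0] := unit_rep ssC repX.
(* The weight of [X i0] in the average, the Kirby loop on it, and the circle that it leaves. *)
exists (qdim P (X i0) * (gdim P X * qdim P (X i0))).
  by rewrite !mulf_neq0 ?qdim_neq0 ?gdim_neq0.
transitivity (\sum_j (qdim P (X j) * kirby_coef P X j) *:
    @ringm _ C P A (cen (zc A)) (X j) (idm (zc A))); last first.
  rewrite (bigD1 i0) //= [X in _ + X]big1 ?addr0 => [|j ne].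
    by rewrite kirby_coef_unit // ring_unit_rep // scalerA mulrA.
  rewrite kirby_coef_nonunit ?mulr0 ?scale0r // => -[t].
  have [_ uniqX _] := repX; case: t0 => t'; move/eqP: ne; apply; apply: uniqX.
  by exists; apply: compi (isom_inv t') t.
apply: (@fam_inj _ _ (Leaf (zc A)) (Leaf (zc A))) => Z; rewrite !fam_sum.
transitivity (\sum_i \sum_j (qdim P (X i) * qdim P (X j)) *:
   ((ev i ∘ @ringm _ C P A (N i) (X j) (cv i)) ⊗ idm Z)).
  apply: eq_bigr => i _; rewrite famZ famL /fm /avg comp_sumr tens_suml scaler_sumr.
  by apply: eq_bigr => j _; rewrite compZr tensZl scalerA.
rewrite exchange_big; apply: eq_bigr => j _ /=.
rewrite famZ famL ring_forget.
pose T (h : hom (X j) (X j)) := (idm (zc A) ⊗ evR P (X j) Z)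
  ∘ crossi (zc A) (X j) (D (X j) • Z) ∘ (h ⊗ idm (zc A • (D (X j) • Z)))
  ∘ (idm (X j) ⊗ sh A (Leaf (D (X j))) Z) ∘ cvL P (X j) (zc A • Z).
have linT : linear T.
  move=> a u v; rewrite /T (@tens_linl _ _ _ _ _ _ (idm _)) (comp_linr _).
  by rewrite !(comp_linl _).
transitivity (qdim P (X j) *: T (kirby P X (X j))).
  rewrite /kirby (lin_sum _ _ _ linT) scaler_sumr; apply: eq_bigr => i _.
  by rewrite (linZ _ _ linT) scalerA mulrC ring_cv_ev.
rewrite (kirby_simple P repX) (linZ _ _ linT) scalerA; congr (_ *: _).
by rewrite /T tens11 compm1.
Qed.

Lemma center_retract :
  exists (f : forall i, hom A (N i)) (g : forall i, hom (N i) A),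
    \sum_i (g i ∘ f i) = idm A.
Proof.
have [k cen_functor e] := retract_total.
have simX i : simple (X i) by have [] := repX.
have az (U V : zob C) g := @avg_zmor _ C P n X simX (ss_unit ssC) 
  (schur ssC sphC repX unitS) (resolution ssC repX) U V g.
have fmz i : @zmor_prop _ C A (N i) (fm i) := az A (N i) (cv i).
(* [ev i] has to be averaged as well. As [fm i] lies in the center it can be pulled into this
   average, which then acts on k times the identity and multiplies it by [gdim]. *)
pose G i := (gdim P X * k)^-1 *: @avg _ C P n X (N i) A (qdim P (X i) *: ev i).
have Gz i : @zmor_prop _ C (N i) A (G i).
  rewrite -[G i]addr0; apply: (zmor_submod (N i) A).2; first exact: az.
  exact: (zmor_submod (N i) A).1.
exists (fun i => zmk (fmz i)), (fun i => zmk (Gz i)).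
apply: zval_inj; rewrite (lin_sum _ _ _ (@zval_lin _ _ _ _)).
transitivity (\sum_i (G i ∘ fm i)); first by [].
transitivity ((gdim P X * k)^-1 *: @avg _ C P n X A A (k *: idm (zc A))).
  rewrite -e /avg.
  under [in RHS]eq_bigr => j _ do rewrite (lin_sum _ _ _ (@ringm_lin _ _ P A A (X j)))
    scaler_sumr.
  rewrite exchange_big scaler_sumr; apply: eq_bigr => i _ /=.
  rewrite /G compZl /avg comp_suml; congr (_ *: _); apply: eq_bigr => j _.
  rewrite compZl; congr (_ *: _).
  have := @ringm_comp _ C P (N i) A A A (X j) (idm _) (qdim P (X i) *: ev i) (fm i)
    (@zid_prop _ C A) (fmz i).
  by rewrite !comp1m compZl => ->.
rewrite /avg.
transitivity ((gdim P X * k)^-1 *: \sum_j (qdim P (X j) ^+ 2 * k) *: idm (zc A)).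
  congr (_ *: _); apply: eq_bigr => j _.
  rewrite (linZ _ _ (@ringm_lin _ _ P A A (X j))) expr2 -mulrA [_ * k]mulrC -!scalerA.
  congr (_ *: _); congr (_ *: _).
  apply: (@fam_inj _ _ (Leaf (zc A)) (Leaf (zc A))) => Z.
  rewrite famL (ringm_zmor P (X j) (@zid_prop _ C A)) (evR_cvL ssC sphC).
  by rewrite compZr compm1 famZ fam_id tens11.
rewrite -scaler_suml -mulr_suml scalerA mulVf ?scale1r // mulf_neq0 //.
exact: gdim_neq0.
Qed.
End Retract.

(** * Splitting the idempotent and the equivalence *)

Section Equivalence.
Variables (F : fieldType) (C : bcat F) (P : pivotal C) (n : nat) (X : 'I_n -> C).
Local Notation D := (dob P).
Hypothesis ssC : semisimple C.
Hypothesis sphC : spherical P.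
Hypothesis repX : simple_reps X.
Hypothesis unitS : Smatrix P X \in unitmx.
Local Notation PC := (pairc C (tilde C)).

Lemma cen_functor_faithful (A B : PC) : injective (@fmor _ _ _ (cen_functor C) A B).
Proof.
move=> s t /(congr1 (@zval _ _ _ _)) e.
apply/eqP; rewrite -subr_eq0; apply/eqP.
apply: (tens_faithful ssC sphC repX unitS).
transitivity (tens_pair (s - t)); first by [].
rewrite (linB _ _ (@tens_pair_lin _ _ A B)); apply/eqP; rewrite subr_eq0; apply/eqP.
exact: e.
Qed.

Lemma cen_functor_full (A B : PC) (f : hom (cen_functor C A) (cen_functor C B)) :
  exists g, fmor (cen_functor C) g = f.
Proof.
have [m [u [v e]]] := cen_tens_full ssC sphC repX unitS (zvalP f).
exists (\sum_k (pten (u k) (v k) : hom A B)); apply: zval_inj.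
rewrite e; transitivity (tens_pair (\sum_k (pten (u k) (v k) : hom A B))); first by [].
rewrite (lin_sum _ _ _ (@tens_pair_lin _ _ A B)); apply: eq_bigr => k _.
exact: tens_pair_pten.
Qed.

(** By Schur's lemma in the second factor, the off-diagonal entries of e vanish and the diagonal
    ones are h ⊠ id with h an endomorphism of [B i]; these h are idempotent and split in C. *)
Lemma split_diagonal (B : 'I_n -> C) (M : deligne C (tilde C) := @AddOb F PC 'I_n (fun i
  => (B i, X i)))
    (e : hom M M) : e ∘ e = e ->
  exists (M' : deligne C (tilde C)) (p : hom M' M) (q : hom M M'),
    q ∘ p = idm M' /\ p ∘ q = e.
Proof.
move=> ee.
have simX i : simple (X i) by have [] := repX.
have diag i j : i != j -> ent e i j = 0.
  move=> ne; elim/tprod_ind: (ent e i j) => [f g|s t -> ->]; last by rewrite addr0.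
  rewrite /= in g *.
  rewrite (schur ssC sphC repX unitS g ne).
  exact: (lin0 ((pten_bilinear _ _).2 f)).
have /(_ _)/cid h i : exists h, ent e i i = pten h (idm (X i)).
  elim/tprod_ind: (ent e i i) => [f g|s t [h1 ->] [h2 ->]].
    exists (coef g *: f); rewrite /= in g *.
    rewrite {1}(coefE g (simX i)).
    rewrite (linZ _ _ ((pten_bilinear _ _).2 f)).
    by rewrite (linZ _ _ ((pten_bilinear _ _).1 (idm _))).
  exists (h1 + h2); have := (pten_bilinear _ _).1 (idm (X i)) 1 h1 h2.
  by rewrite !scale1r.
pose H i : hom (B i) (B i) := sval (h i).
have hE (i : 'I_n) : ent e i i = pten (H i) (idm (X i)) := svalP (h i).
have HH i : H i ∘ H i = H i.
  have := congr1 (fun f : hom M M => ent f i i) ee.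
  rewrite ent_amx (bigD1 i) //= big1 ?addr0 => [|j ne]; last first.
    by rewrite (diag j i ne); apply: (lin0 (@tbi_linl _ _ _ _ _ _ _ _ _ _)).
  (* The factor h is recovered from h ⊠ id by passing to tensor products in C, where [X i] can be
     cancelled. *)
  rewrite hE pcompE comp1m => /(congr1 (@tens_pair _ _ (B i, X i) (B i, X i))).
  rewrite !tens_pair_pten => E.
  apply/eqP; rewrite -subr_eq0; apply/eqP.
  apply: (tens_simple_inj ssC sphC repX unitS (j := i)).
  rewrite (linB _ _ (tens_linl (idm (X i)))).
  by apply/eqP; rewrite subr_eq0; apply/eqP.
have sp i := cid (ss_split ssC (HH i)).
have sp2 i := cid (svalP (sp i)).
have sp3 i := cid (svalP (sp2 i)).
pose Y i := sval (sp i); pose p i : hom (Y i) (B i) := sval (sp2 i).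
pose q i : hom (B i) (Y i) := sval (sp3 i).
have qp i : q i ∘ p i = idm (Y i) by have [] := svalP (sp3 i).
have pq i : p i ∘ q i = H i by have [] := svalP (sp3 i).
pose M' : deligne C (tilde C) := @AddOb F PC 'I_n (fun i => (Y i, X i)).
pose pm : hom M' M := amono (A := M') (B := M) (phi := id) (fun i => pten (p i) (idm (X
  i))).
pose qm : hom M M' := amono (A := M) (B := M') (phi := id) (fun i => pten (q i) (idm (X
  i))).
exists M', pm, qm; split.
  rewrite [LHS]mono_mono; apply: entP => i j; rewrite !ent_amx.
  have E : (pten (q i) (idm (X i)) : hom ((B i, X i) : PC) (Y i, X i))
      ∘ (pten (p i) (idm (X i)) : hom ((Y i, X i) : PC) (B i, X i)) =
      idm ((Y i, X i) : PC) by rewrite /= pcompE qp comp1m.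
  exact: (congr1 (dcast (V := fun k : 'I_n => hom ((Y i, X i) : PC) (Y k, X k)) j) E).
rewrite [LHS]mono_mono; apply: entP => i j; rewrite ent_amx.
have E : (pten (p i) (idm (X i)) : hom ((Y i, X i) : PC) (B i, X i))
    ∘ (pten (q i) (idm (X i)) : hom ((B i, X i) : PC) (Y i, X i)) = ent e i i.
  by rewrite /= pcompE pq comp1m hE.
transitivity (dcast (V := fun k : 'I_n => hom ((B i, X i) : PC) (B k, X k)) j (ent e i i)).
  by rewrite -E.
have [<-|ne] := eqVneq i j; first by rewrite dcast_id.
by rewrite dcast_neq // diag.
Qed.

Lemma center_eso (S : sums (Z1 C)) (A : Z1 C) :
  exists M : deligne C (tilde C), inhabited (isom (additive_functor S (cen_functor C) M) A).
Proof.
have [f [g gf]] := center_retract ssC sphC repX unitS A.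
pose N i : Z1 C := ztens (cen_tilde (X i)) (cen (D (X i) • zc A)).
pose M : deligne C (tilde C) := @AddOb F PC 'I_n (fun i => (D (X i) • zc A, X i)).
pose K := additive_functor S (cen_functor C).
(* The retract comes with the c~ factor first; the braiding of the center puts it second, as in
   [cen_functor]. *)
pose b i : isom (N i : Z1 C) (cen_functor C (D (X i) • zc A, X i)) :=
  braid (b := Z1 C) (cen_tilde (X i)) (cen (D (X i) • zc A)).
pose to : hom A (K M) := \sum_(i : aix M) (kin S (cen_functor C) (A := M) i ∘ (fw (b i) ∘
  f i)).
pose from : hom (K M) A := \sum_(i : aix M) ((g i ∘ bw (b i)) ∘ kpr S (cen_functor C) (A
  := M) i).
have ft : from ∘ to = idm A.
  rewrite -gf /to comp_sumr; apply: eq_bigr => i _.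
  rewrite /from comp_suml (bigD1 i) // big1 ?addr0 => [|j ne].
    rewrite -!compA (compA (kpr S (cen_functor C) (A := M) i)) kprin comp1m (compA (bw _)).
    by rewrite (fwK (b i)) comp1m; exact: addr0.
  have z : kpr S (cen_functor C) (A := M) j ∘ kin S (cen_functor C) (A := M) i = 0 by
    exact: kprin0.
  by rewrite [LHS]compA (compE z) compm0; exact: comp0m.
(* Fullness lifts the idempotent with image A, faithfulness keeps it idempotent, and its splitting
   in the product is sent to an object isomorphic to A. *)
have [e Ke] : exists e : hom M M, fmor K e = to ∘ from.
  by apply: kmor_full => i j; apply: cen_functor_full.
have ee : e ∘ e = e.
  apply: (kmor_faithful cen_functor_faithful).
  transitivity (fmor K e ∘ fmor K e); first exact: (fmorM K).
  transitivity (fmor K e); last by [].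
  by rewrite Ke compA (compE ft) compm1.
have [M' [p [q [qp pq]]]] := split_diagonal ee.
exists M'; exists.
exists (from ∘ fmor K p) (fmor K q ∘ to).
  by rewrite compA (compE (esym Ke)) -!fmorM -pq !compA qp comp1m qp fmor1.
rewrite compA -(compA from) -fmorM pq Ke compA (compE ft) compm1.
exact: ft.
Qed.

End Equivalence.

Theorem theorem7p10 (F : closedFieldType) (C : bcat F) (P : pivotal C)
  (C_strict : strict C) (C_modular : modular P) :
  exists K : bfunctor (deligne C (tilde C)) (Z1 C),
    equivalence K /\ canonical K.
Proof.
have [ssC sphC [n [X [repX unitS]]]] := C_modular.
pose S := center_sums ssC; exists (additive_functor S (cen_functor C)); split.
  apply: equivalence_ff_eso.
  - by move=> M N; apply: kmor_faithful; apply: (cen_functor_faithful ssC sphC repX unitS).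
  - move=> M N f; apply: kmor_full => i j; exact: (cen_functor_full ssC sphC repX unitS).
  - exact: (center_eso ssC sphC repX unitS).
(* A box is sent to a direct sum with a single summand, whose projection is therefore invertible and
   serves as theta. *)
pose B (U V : C) : deligne C (tilde C) := box (D := tilde C) U V.
have K1 U V : kpr S (cen_functor C) (A := B U V) tt ∘ kin S (cen_functor C) (A := B U V)
  tt = idm _ by exact: kprin.
have K2 U V : kin S (cen_functor C) (A := B U V) tt ∘ kpr S (cen_functor C) (A := B U V)
  tt = idm _.
  by rewrite -kinpr (bigD1 tt) // big1 => [|[]//]; exact: esym (addr0 _).
exists (fun U V => Isom (K2 U V) (K1 U V)); split.
- move=> U U' V V' f g.
  have := congr1 (@zval _ _ _ _) (kpr_kmor_single S (cen_functor C) (boxm (D := tilde C)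
    f g)).
  rewrite ent_amx => e; apply: (etrans e).
  by congr (_ ∘ _); exact: (@tens_pair_pten _ C (U, V) (U', V') f g).
- move=> U U' V V'.
  have := congr1 (@zval _ _ _ _) (kpr_kmuf_single S (cen_functor C) (box_tens (D := tilde
    C) U U' V V')).
  rewrite ent_amx => e; apply: (etrans e).
  have <- := comp1m (middle_swap U V U' V').
  congr (_ ∘ _ ∘ _); rewrite -(tens11 (U • U') (V • V')).
  exact: (@tens_pair_pten _ C (U • U', V • V') (U • U', V • V')).
have e := compA (kpr S (cen_functor C) (A := B tunit tunit) tt) (kin S (cen_functor C) (A
  := B tunit tunit) tt) (fw (cen_eta C)).
rewrite K1 comp1m in e.
exact: (congr1 (@zval _ _ _ _) e).
Qed.
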